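(* Let $\varepsilon>0$, let $d\geq 2$ be an integer, and let $A_1,\dots,A_d$ be nonempty, pairwise-disjoint open subsets of the Riemann sphere $\widehat{\mathbb{C}}$ sharing a common boundary $J$ (that is, $\partial A_j=J$ for every $j=1,\dots,d$), such that $\widehat{\mathbb{C}}=A_1\sqcup\dots\sqcup A_d\sqcup J$. Then there exists a rational map $r:\widehat{\mathbb{C}}\to\widehat{\mathbb{C}}$ with attracting fixed points $\zeta_1,\dots,\zeta_d$ such that the Fatou set of $r$ is the disjoint union $$\mathcal{F}(r)=\mathcal{A}(\zeta_1)\sqcup\dots\sqcup\mathcal{A}(\zeta_d)$$ of the basins of attraction of these fixed points, and such that $$d_H(J,\mathcal{J}(r))<\varepsilon\quad\text{and}\quad d_H(A_j,\mathcal{A}(\zeta_j))<\varepsilon\ \text{ for every } j=1,\dots,d.$$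
   Context: $\widehat{\mathbb{C}}=\mathbb{C}\cup\{\infty\}$ is the Riemann sphere, with distances between points measured in the spherical metric $d(\cdot,\cdot)$; boundaries are taken in $\widehat{\mathbb{C}}$. For $A,B\subset\widehat{\mathbb{C}}$, $d_H(A,B)$ is the Hausdorff distance: $d_H(A,B)<\varepsilon$ if and only if $A\subset N_\varepsilon(B)$ and $B\subset N_\varepsilon(A)$, where $N_\varepsilon(B):=\{z\in\widehat{\mathbb{C}}: d(z,B)<\varepsilon\}$. For a rational map $r$, the Fatou set $\mathcal{F}(r)$ is the set of points having a neighborhood on which the iterates $(r^n)_{n\ge1}$ form a normal family, and the Julia set is $\mathcal{J}(r)=\widehat{\mathbb{C}}\setminus\mathcal{F}(r)$. An attracting fixed point of $r$ is a point $\zeta\in\widehat{\mathbb{C}}$ with $r(\zeta)=\zeta$ and multiplier satisfying $|r'(\zeta)|<1$ (computed in a local coordinate if $\zeta=\infty$). Its basin of attraction $\mathcal{A}(\zeta)$ is the set of all $z\in\widehat{\mathbb{C}}$ with $r^n(z)\to\zeta$ as $n\to\infty$. *)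

(* Defs.v *)
From HB Require Import structures.
From mathcomp Require Import all_boot all_order all_algebra.
From mathcomp Require Import all_classical all_reals all_analysis.
From mathcomp Require Import complex.
From mathcomp Require Import ring lra.

Set Implicit Arguments.
Unset Strict Implicit.
Unset Printing Implicit Defensive.

Import Order.TTheory GRing.Theory Num.Theory.
Import numFieldNormedType.Exports.
Local Open Scope classical_set_scope.
Local Open Scope complex_scope.
Local Open Scope ring_scope.

(* The Riemann sphere: [Some z] is the finite point z and [None] is infinity. *)
Definition sphere (R : realType) : Type := option R[i].

Section SphericalMetric.
Variable R : realType.
Implicit Types (z w : sphere R) (u v : R * R * R).

(* Inverse stereographic projection onto the unit sphere of R^3, with infinity
   going to the north pole. *)
Definition stereo z : R * R * R :=
  match z with
  | Some (x +i* y) =>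
      let s := 1 + (x ^+ 2 + y ^+ 2) in
      (2 * x / s, 2 * y / s, (x ^+ 2 + y ^+ 2 - 1) / s)
  | None => (0, 0, 1)
  end.

Definition dot3 u v : R := u.1.1 * v.1.1 + u.1.2 * v.1.2 + u.2 * v.2.

(* Great-circle distance on the unit sphere, i.e. the distance of the
   Riemannian metric 2|dz|/(1 + |z|^2). *)
Definition sph_dist z w : R := acos (dot3 (stereo z) (stereo w)).

Lemma stereo_unit z : dot3 (stereo z) (stereo z) = 1.
Proof.
case: z => [[x y]|]; rewrite /dot3 /=; last by ring.
have s0 : 1 + (x ^+ 2 + y ^+ 2) != 0.
  by rewrite gt_eqF // ltr_wpDr // addr_ge0 ?sqr_ge0.
by field.
Qed.

Lemma dot3C u v : dot3 u v = dot3 v u.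
Proof. by rewrite /dot3; ring. Qed.

Lemma dot3_bound u v :
  dot3 u u = 1 -> dot3 v v = 1 -> -1 <= dot3 u v <= 1.
Proof.
move: u v => [[a b] c] [[a' b'] c']; rewrite /dot3 /= => Hu Hv.
have := sqr_ge0 (a - a'); have := sqr_ge0 (b - b'); have := sqr_ge0 (c - c').
have := sqr_ge0 (a + a'); have := sqr_ge0 (b + b'); have := sqr_ge0 (c + c').
by move=> *; apply/andP; split; nra.
Qed.

Lemma stereo_bound z w : -1 <= dot3 (stereo z) (stereo w) <= 1.
Proof. by apply: dot3_bound; exact: stereo_unit. Qed.

Lemma stereo_inj : injective stereo.
Proof.
have pos (x y : R) : 0 < 1 + (x ^+ 2 + y ^+ 2).
  by rewrite ltr_wpDr // addr_ge0 ?sqr_ge0.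
have north (x y : R) :
    (x ^+ 2 + y ^+ 2 - 1) / (1 + (x ^+ 2 + y ^+ 2)) != 1.
  apply/eqP => /(congr1 (fun t => t * (1 + (x ^+ 2 + y ^+ 2)))).
  rewrite mulfVK ?gt_eqF ?pos //; lra.
case=> [[x y]|] [[x' y']|] //= []; last 2 first.
- by move=> _ _ /eqP; rewrite (negbTE (north _ _)).
- by move=> _ _ /esym/eqP; rewrite (negbTE (north _ _)).
move=> e1 e2 e3.
set s := 1 + _ in e1 e2 e3; set s' := 1 + (x' ^+ 2 + _) in e1 e2 e3.
have s0 : 0 < s by exact: pos.
have s'0 : 0 < s' by exact: pos.
have ess : s = s'.
  have H : (s - 2) / s = (s' - 2) / s'.
    by move: e3; congr (_ / _ = _ / _); rewrite /s /s'; ring.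
  have : (s - 2) * s' = (s' - 2) * s.
    have -> : s - 2 = (s - 2) / s * s by rewrite mulfVK ?gt_eqF.
    by rewrite H; field; rewrite gt_eqF.
  by move=> ?; lra.
move: e1 e2; rewrite -ess => e1 e2.
have /(_ _ _) cancel (a b : R) : 2 * a / s = 2 * b / s -> a = b.
  have sV : s^-1 != 0 by rewrite invr_eq0 gt_eqF.
  by move/(mulIf sV)/mulfI; apply; rewrite pnatr_eq0.
by rewrite (cancel _ _ e1) (cancel _ _ e2).
Qed.

Lemma sph_distxx z : sph_dist z z = 0.
Proof. by rewrite /sph_dist stereo_unit acos1. Qed.

Lemma sph_dist_sym z w : sph_dist z w = sph_dist w z.
Proof. by rewrite /sph_dist dot3C. Qed.

Lemma sph_dist_positivity z w : sph_dist z w = 0 -> z = w.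
Proof.
move=> zw0.
have zw1 : dot3 (stereo z) (stereo w) = 1.
  by rewrite -[LHS]acosK ?in_itv/= ?stereo_bound // -/(sph_dist z w) zw0 cos0.
apply: stereo_inj; move: zw1 (stereo_unit z) (stereo_unit w).
case: (stereo z) (stereo w) => [[a b] c] [[a' b'] c']; rewrite /dot3 /=.
move=> H1 H2 H3.
have S : (a - a') ^+ 2 + ((b - b') ^+ 2 + (c - c') ^+ 2) = 0 by nra.
move/eqP: S; rewrite paddr_eq0 ?addr_ge0 ?sqr_ge0 //.
rewrite paddr_eq0 ?sqr_ge0 // !sqrf_eq0 !subr_eq0.
by move=> /and3P[/eqP-> /eqP-> /eqP->].
Qed.

Lemma gram3 (u v w : R * R * R) :
  dot3 u u = 1 -> dot3 v v = 1 -> dot3 w w = 1 ->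
  (dot3 u v * dot3 v w - dot3 u w) ^+ 2 <=
  (1 - dot3 u v ^+ 2) * (1 - dot3 v w ^+ 2).
Proof.
move=> Hu Hv Hw.
suff : 0 <= (dot3 u u * dot3 v v - dot3 u v ^+ 2) *
            (dot3 v v * dot3 w w - dot3 v w ^+ 2) -
            (dot3 u v * dot3 v w - dot3 u w * dot3 v v) ^+ 2.
  by rewrite Hu Hv Hw !mulr1 subr_ge0.
have -> : (dot3 u u * dot3 v v - dot3 u v ^+ 2) *
          (dot3 v v * dot3 w w - dot3 v w ^+ 2) -
          (dot3 u v * dot3 v w - dot3 u w * dot3 v v) ^+ 2 =
  dot3 v v * (u.1.1 * (v.1.2 * w.2 - v.2 * w.1.2) -
              u.1.2 * (v.1.1 * w.2 - v.2 * w.1.1) +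
              u.2 * (v.1.1 * w.1.2 - v.1.2 * w.1.1)) ^+ 2.
  by rewrite /dot3; ring.
by rewrite Hv mul1r sqr_ge0.
Qed.

Lemma sph_dist_triangle w z t : sph_dist z t <= sph_dist z w + sph_dist w t.
Proof.
rewrite /sph_dist.
have := gram3 (stereo_unit z) (stereo_unit w) (stereo_unit t).
have := stereo_bound z w; have := stereo_bound w t; have := stereo_bound z t.
move: (dot3 (stereo z) (stereo w)) (dot3 (stereo w) (stereo t)) => p q.
move: (dot3 (stereo z) (stereo t)) => r Br Bq Bp G.
have [le_pi|lt_pi] := leP (acos p + acos q) pi; last first.
  by rewrite (le_trans _ (ltW lt_pi)) // acos_lepi.
have S0 : 0 <= acos p + acos q by rewrite addr_ge0 // acos_ge0.
have cle : cos (acos p + acos q) <= r.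
  rewrite cosD !acosK ?in_itv//= !sin_acos //.
  rewrite -sqrtrM; last by rewrite subr_ge0; nra.
  rewrite lerBlDl -lerBlDr.
  by rewrite (le_trans (ler_norm _)) // -sqrtr_sqr ler_wsqrtr.
rewrite leNgt; apply/negP => lt.
have : cos (acos r) < cos (acos p + acos q).
  by rewrite ltr_cos // in_itv /= ?S0 ?le_pi // acos_ge0 // acos_lepi.
by rewrite acosK ?in_itv //= ltNge cle.
Qed.

End SphericalMetric.

HB.instance Definition _ (R : realType) := Choice.on (sphere R).
HB.instance Definition _ (R : realType) := isPointed.Build (sphere R) None.
HB.instance Definition _ (R : realType) :=
  isMetric.Build R (sphere R) (@sph_distxx R) (@sph_dist_positivity R)
    (@sph_dist_sym R) (@sph_dist_triangle R).

Definition boundary (T : topologicalType) (A : set T) : set T :=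
  closure A `\` interior A.

Section Hausdorff.
Variables (R : realType) (T : metricType R).
Implicit Types A B : set T.

(* [edist_inf B z] is the infimum distance d(z, B), equal to +oo for empty B. *)
Definition thickening (e : R) B : set T := [set z | (edist_inf B z < e%:E)%E].

(* d_H(A, B) < e *)
Definition hausdorff_lt (e : R) A B : Prop :=
  A `<=` thickening e B /\ B `<=` thickening e A.

End Hausdorff.

Section RationalDynamics.
Variable R : realType.
Implicit Types (f : sphere R -> sphere R) (z : sphere R).

(* The map z |-> p(z)/q(z), for coprime p and q with q nonzero.  The value at
   infinity compares degrees: if deg p <= deg q, the limit of p/q there is the
   coefficient of degree (deg q) in p divided by the leading coefficient of q. *)
Definition ratfun (p q : {poly R[i]}) z : sphere R :=
  match z with
  | Some x => if q.[x] == 0 then None else Some (p.[x] / q.[x])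
  | None => if (size q < size p)%N then None
            else Some (p`_(size q).-1 / lead_coef q)
  end.

Definition rational_map f : Prop :=
  exists p q : {poly R[i]}, [/\ q != 0, coprimep p q & f = ratfun p q].

(* Every sequence in F has a subsequence converging in the spherical metric,
   uniformly on the compact subsets of U; the constant limit infinity is
   allowed. *)
Definition normal_family (F : set (sphere R -> sphere R)) (U : set (sphere R)) :=
  forall u : nat -> sphere R -> sphere R, (forall n, F (u n)) ->
  exists phi : nat -> nat, {homo phi : m n / (m < n)%N} /\
  exists g : sphere R -> sphere R,
  forall K : set (sphere R), compact K -> K `<=` U ->
    {uniform K, (u \o phi) @ \oo --> g}.

Definition Fatou f : set (sphere R) :=
  [set z | exists U, [/\ open U, U z &
     normal_family [set g | exists2 n, (1 <= n)%N & g = iter n f] U]].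

Definition Julia f : set (sphere R) := ~` Fatou f.

(* 1/z on the sphere, exchanging 0 and infinity: the coordinate at infinity. *)
Definition sphere_inv z : sphere R :=
  match z with
  | Some x => if x == 0 then None else Some x^-1
  | None => Some 0
  end.

(* The value at infinity is junk; it is only used away from infinity. *)
Definition finite_part z : R[i] := odflt 0 z.

(* Complex derivative of f at a fixed point z, in the coordinate w at a finite
   point and in the coordinate 1/w at infinity.  R[i]^o is R[i] as a normed
   space over itself. *)
Definition multiplier f z : R[i] :=
  match z with
  | Some x => derive1 (fun w : R[i]^o => finite_part (f (Some w)) : R[i]^o) x
  | None => derive1 (fun w : R[i]^o =>
              finite_part (sphere_inv (f (sphere_inv (Some w)))) : R[i]^o) 0
  end.

Definition attracting_fixed_point f z : Prop :=
  f z = z /\ `|multiplier f z| < 1.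

Definition basin f z : set (sphere R) :=
  [set w | iter n f w @[n --> \oo] --> z].

End RationalDynamics.

(* Main.v *)
Require Import Defs.
From HB Require Import structures.
From mathcomp Require Import all_boot all_order all_algebra.
From mathcomp Require Import all_classical all_reals all_analysis.
From mathcomp Require Import complex ring lra.

(* Choose compact cores K_i of the A_i exhausting them up to a small distance from J,
   and let j0 be the index of the region containing infinity (any index if infinity
   lies in J).  For i != j0 an explicit rational function f_i = P_i/Q_i has |f_i| > 1
   on K_i and |f_i| < 1 off a small neighbourhood of K_i contained in A_i: it is the
   product of 1 - h^4/(z - w)^4 over the points w of a fine square lattice near K_i.
   Each factor is close to 1 far from w, while the product over a full box telescopes
   to its boundary and is bounded away from 1; equivalently, log|f_i| is the
   logarithmic potential of the discrete Laplacian of an indicator function.  Scaling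
   f_i by a constant, it has no critical point on |f_i| = 1.

   Fix distinct c_i in the cores and put, for large N,
     r = c_j0 + sum_(i != j0) (c_i - c_j0) f_i^N / (1 + f_i^N).
   Then r maps each K_i into a small disk around c_i, on which it is a contraction,
   and wherever r is in none of these disks, the point is close to some curve
   |f_i| = 1 and |r'| is large.  Hence the orbits avoiding the disks form a uniformly
   expanding compact set, which is the Julia set, and all others are attracted.
   As the set not covered by the cores is close to J and J is the boundary of every
   A_j, it does not matter that the neighbourhood of J is mostly given to the basin
   of index j0. *)

Set Implicit Arguments.
Unset Strict Implicit.
Unset Printing Implicit Defensive.

Import Order.TTheory GRing.Theory Num.Theory.
Import numFieldNormedType.Exports.
Local Open Scope classical_set_scope.
Local Open Scope complex_scope.
Local Open Scope ring_scope.

(** The exponent 4 carries the construction. Since h, -h, ih, -ih are the roots of x^4 = h^4, a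
    factor is the product over the four neighbours of w divided by (z - w)^4, which is what
    telescopes. Away from w it differs from 1 by O(h^4), while the box has O(h^-2) nodes, so the
    product over all distant nodes tends to 1 as the mesh is refined. What is left at the border is
    a discrete flux, bounded below independently of the mesh; this fixed gain separates K_i from its
    surroundings.

    The function s = f^N / (1 + f^N) satisfies s' = N s (1 - s) f'/f. So s' is tiny where |f| stays
    away from 1, and large where s is near neither 0 nor 1, provided that f' has no zero on |f| = 1:
    hence the scaling of f_i.

    The choice of j0 makes all other cores bounded and sends infinity into the disk of c_j0, so
    poles are attracted as well. Orbits avoiding the disks then stay in a bounded part of the plane,
    where Euclidean expansion contradicts normality directly. Julia points near J come from
    connectedness: a small connected set meeting two disjoint open basins is not covered by the
    basins. *)

Local Notation normc := (ComplexField.Normc.normc).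

(** * The modulus and the topology of the sphere *)

Section ComplexModulus.
Variable R : realType.
Implicit Types (a b c : R[i]).

Lemma normc_ge0 a : 0 <= normc a.
Proof. by case: a => x y; exact: sqrtr_ge0. Qed.

Lemma normcD a b : normc (a + b) <= normc a + normc b.
Proof. exact: (@le_normcD R a b). Qed.

Lemma normcNn a : normc (- a) = normc a.
Proof. exact: (@normcN R a). Qed.

Lemma normcBC a b : normc (a - b) = normc (b - a).
Proof. by rewrite -opprB normcNn. Qed.

Lemma normcBt b a c : normc (a - c) <= normc (a - b) + normc (b - c).
Proof. by rewrite -[a - c](subrKA b) normcD. Qed.

Lemma normcB_ge a b : normc a - normc b <= normc (a - b).
Proof. by rewrite lerBlDr -{1}[a](subrK b) normcD. Qed.

Lemma normc_eq0 a : (normc a == 0) = (a == 0).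
Proof.
apply/eqP/eqP => [/ComplexField.Normc.eq0_normc //|->].
exact: ComplexField.Normc.normc0.
Qed.

Lemma normc_gt0 a : (0 < normc a) = (a != 0).
Proof. by rewrite lt_def normc_ge0 andbT normc_eq0. Qed.

Lemma normcM a b : normc (a * b) = normc a * normc b.
Proof. exact: ComplexField.Normc.normcM. Qed.

Lemma normcV a : normc a^-1 = (normc a)^-1.
Proof. exact: ComplexField.Normc.normcV. Qed.

Lemma normcf_div a b : normc (a / b) = normc a / normc b.
Proof. by rewrite normcM normcV. Qed.

Lemma normc1 : normc (1 : R[i]) = 1.
Proof. exact: ComplexField.Normc.normc1. Qed.

Lemma normc0 : normc (0 : R[i]) = 0.
Proof. exact: ComplexField.Normc.normc0. Qed.

Lemma normcX a n : normc (a ^+ n) = normc a ^+ n.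
Proof. by elim: n => [|n IH]; rewrite ?expr0 ?normc1 // !exprS normcM IH. Qed.

Lemma normc_prod I (s : seq I) (P : pred I) (F : I -> R[i]) :
  normc (\prod_(i <- s | P i) F i) = \prod_(i <- s | P i) normc (F i).
Proof. by apply: (big_morph _ normcM normc1). Qed.

Lemma ler_normc_sum I (s : seq I) (P : pred I) (F : I -> R[i]) :
  normc (\sum_(i <- s | P i) F i) <= \sum_(i <- s | P i) normc (F i).
Proof.
elim/big_ind2 : _ => [|x1 x2 y1 y2 h1 h2|//]; first by rewrite normc0.
by rewrite (le_trans (normcD _ _)) // lerD.
Qed.

Lemma normc_real (x : R) : normc (x%:C) = `|x|.
Proof. by rewrite /= expr0n /= addr0 sqrtr_sqr. Qed.

Lemma sqr_normcE (x y : R) : normc (x +i* y) ^+ 2 = x ^+ 2 + y ^+ 2.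
Proof. by rewrite /= sqr_sqrtr // addr_ge0 // sqr_ge0. Qed.

Lemma normc_Re_le a : `|complex.Re a| <= normc a.
Proof.
case: a => x y /=; rewrite -sqrtr_sqr ler_wsqrtr // lerDl sqr_ge0 //.
Qed.

Lemma normc_Im_le a : `|complex.Im a| <= normc a.
Proof.
case: a => x y /=; rewrite -sqrtr_sqr ler_wsqrtr // lerDr sqr_ge0 //.
Qed.

Lemma normr_normc a : `|a| = (normc a)%:C.
Proof. by []. Qed.

End ComplexModulus.

(** * Chordal distance, neighbourhoods on the sphere and inversion *)

Section SphereTopology.
Variable R : realType.
Implicit Types (z w : sphere R) (a b : R[i]) (U : set (sphere R)).

(** The squared chord in space, |u - v|^2 = 2 (1 - u.v) for unit vectors. Unlike the great-circle
    distance it is rational in the coordinates, so comparisons with the planar modulus go through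
    it. *)
Definition chord2 z w : R := 2 * (1 - dot3 (stereo z) (stereo w)).

Lemma chord2_finite a b :
  chord2 (Some a) (Some b) =
  4 * normc (a - b) ^+ 2 / ((1 + normc a ^+ 2) * (1 + normc b ^+ 2)).
Proof.
case: a b => [x y] [x' y'].
have -> : (x +i* y) - (x' +i* y') = ((x - x') +i* (y - y')) by simpc.
rewrite /chord2 !sqr_normcE /dot3 /=.
have pos (u v : R) : 1 + (u ^+ 2 + v ^+ 2) != 0.
  by rewrite gt_eqF // ltr_wpDr // addr_ge0 ?sqr_ge0.
by field; rewrite !pos.
Qed.

Lemma chord2_infty a : chord2 None (Some a) = 4 / (1 + normc a ^+ 2).
Proof.
case: a => [x y].
rewrite /chord2 !sqr_normcE /dot3 /=.
have pos (u v : R) : 1 + (u ^+ 2 + v ^+ 2) != 0.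
  by rewrite gt_eqF // ltr_wpDr // addr_ge0 ?sqr_ge0.
by field; rewrite !pos.
Qed.

Lemma chord2C z w : chord2 z w = chord2 w z.
Proof. by rewrite /chord2 dot3C. Qed.

Lemma ballE z e : ball z e = [set w | sph_dist z w < e].
Proof. by []. Qed.

Lemma ball_of_chord2 (e : R) : 0 < e ->
  exists2 c, 0 < c & forall z w, chord2 z w < c -> ball z e w.
Proof.
(* The cap at [pi] keeps [e'] in the interval where the cosine is decreasing. *)
move=> e0; pose e' := Num.min e pi.
have e'0 : 0 < e' by rewrite lt_min e0 pi_gt0.
have e'pi : e' <= pi by rewrite ge_min lexx orbT.
exists (2 * (1 - cos e')).
  rewrite mulr_gt0 // subr_gt0 -[ltRHS]cos0 ltr_cos //.
    by rewrite in_itv /= lexx pi_ge0.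
  by rewrite in_itv /= (ltW e'0).
move=> z w; rewrite /chord2 ltr_pM2l // ltrD2l ltrN2 => h.
rewrite ballE /= /sph_dist (@lt_le_trans _ _ e') ?ge_min ?lexx // ltNge.
apply/negP => hge; move: h; rewrite ltNge => /negP; apply.
have hb := stereo_bound z w.
rewrite -[leLHS](@acosK R) ?in_itv //= leNgt ltr_cos -?leNgt //.
  by rewrite in_itv /= acos_ge0 // acos_lepi.
by rewrite in_itv /= (ltW e'0).
Qed.

Lemma chord2_of_ball (c : R) : 0 < c ->
  exists2 e, 0 < e & forall z w, ball z e w -> chord2 z w < c.
Proof.
move=> c0; pose c' := Num.min c 1.
have c'0 : 0 < c' by rewrite lt_min c0 ltr01.
have c'1 : c' <= 1 by rewrite ge_min lexx orbT.
have c'c : c' <= c by rewrite ge_min lexx.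
have hb : -1 <= 1 - c' / 2 <= 1 by apply/andP; split; lra.
exists (acos (1 - c' / 2)); first by rewrite acos_gt0 //; apply/andP; split; lra.
move=> z w; rewrite ballE /= /sph_dist => h.
have hzw := stereo_bound z w.
have : cos (acos (1 - c' / 2)) < cos (acos (dot3 (stereo z) (stereo w))).
  by rewrite ltr_cos // in_itv /= acos_ge0 // acos_lepi.
rewrite !acosK ?in_itv //= /chord2; lra.
Qed.

Lemma ball_finite (e : R) : 0 < e ->
  exists2 r, 0 < r & forall a b, normc (b - a) < r -> ball (Some a : sphere R) e (Some b).
Proof.
move=> /ball_of_chord2 [c c0 hc].
exists (Num.min 1 (c / 4)); first by rewrite lt_min ltr01 divr_gt0.
move=> a b; rewrite lt_min => /andP[h1 h2]; apply: hc; rewrite chord2_finite.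
have n0 := normc_ge0 (b - a); rewrite normcBC.
have A0 := sqr_ge0 (normc a); have B0 := sqr_ge0 (normc b).
rewrite ltr_pdivrMr; last by apply: mulr_gt0; lra.
have : 4 * normc (b - a) ^+ 2 < c by nra.
have : 1 <= (1 + normc a ^+ 2) * (1 + normc b ^+ 2) by nra.
by move=> *; nra.
Qed.

(** The bound [M] is essential: the spherical metric degenerates near infinity, so it controls the
    Euclidean one uniformly only on bounded sets. *)
Lemma finite_of_ball (M r : R) : 0 < r ->
  exists2 e, 0 < e & forall a w, normc a <= M -> ball (Some a : sphere R) e w ->
    exists2 b, w = Some b & normc (b - a) < r.
Proof.
move=> r0; pose A := 1 + M ^+ 2.
have A1 : 1 <= A by rewrite lerDl sqr_ge0.
have A0 : 0 < A by exact: lt_le_trans A1.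
(* The first bound excludes infinity and yields |b - a|^2 < A, hence 1 + |b|^2 < 4A; with this the
   second gives |b - a| < r. *)
have [e e0 he] : exists2 e, 0 < e & forall z w, ball z e w ->
    chord2 z w < Num.min A^-1 (r ^+ 2 / A ^+ 2).
  by apply: chord2_of_ball; rewrite lt_min invr_gt0 A0 divr_gt0 // exprn_gt0.
exists e => // a w aM /he; rewrite lt_min => /andP[].
set B := 1 + normc a ^+ 2.
have BA : B <= A by rewrite lerD2l lerXn2r ?nnegrE ?(le_trans (normc_ge0 a) aM) ?normc_ge0.
have B1 : 1 <= B by rewrite lerDl sqr_ge0.
case: w => [b|]; last first.
  rewrite chord2C chord2_infty -/B => h _; exfalso.
  have : A^-1 <= B^-1 by rewrite lef_pV2 // posrE; lra.
  have : 0 < B^-1 by rewrite invr_gt0; lra.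
  by move=> *; lra.
rewrite chord2_finite -/B normcBC => h1 h2; exists b => //.
have C0 : 0 < 1 + normc b ^+ 2 by rewrite ltr_wpDr // sqr_ge0.
set x := normc (b - a) in h1 h2 *.
have x0 : 0 <= x by exact: normc_ge0.
have bx : normc b <= normc a + x.
  by rewrite -lerBlDl; exact: normcB_ge.
have hb : 1 + normc b ^+ 2 <= 2 * A + 2 * x ^+ 2.
  have := sqr_ge0 (normc a - x); have := normc_ge0 b; have := normc_ge0 a.
  by rewrite /A /B in BA *; move=> *; nra.
move: h1 h2; rewrite !ltr_pdivrMr ?mulr_gt0 ?exprn_gt0 //; last 2 first.
  lra.
  lra.
set y := A^-1; have yA : y * A = 1 by rewrite mulVf // gt_eqF.
have y0 : 0 < y by rewrite invr_gt0.
set D := 1 + normc b ^+ 2 in C0 hb *.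
move=> h1 h2.
have h3 : 4 * x ^+ 2 < 2 * A + 2 * x ^+ 2.
  apply: lt_le_trans h1 _.
  have : y * (B * D) <= D.
    have -> : y * (B * D) = (y * B) * D by ring.
    rewrite ger_pMl //; have : y * B <= y * A by rewrite ler_pM2l.
    by rewrite yA.
  by move=> *; lra.
have h4 : x ^+ 2 < A by lra.
have h5 : D < 4 * A by lra.
have h6 : 4 * x ^+ 2 < r ^+ 2 / A ^+ 2 * (A * (4 * A)).
  apply: lt_le_trans h2 _; rewrite ler_wpM2l ?divr_ge0 ?sqr_ge0 //.
  by apply: ler_pM => //; lra.
have h7 : r ^+ 2 / A ^+ 2 * (A * (4 * A)) = 4 * r ^+ 2 by field; rewrite gt_eqF.
rewrite h7 in h6; have : x ^+ 2 < r ^+ 2 by lra.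
by rewrite ltr_pXn2r // ?nnegrE // ltW.
Qed.

Lemma nbhs_finiteP a U : nbhs (Some a : sphere R) U <->
  exists2 r, 0 < r & forall b, normc (b - a) < r -> U (Some b).
Proof.
split => [/nbhs_ballP[e /= e0 he]|[r r0 hr]].
  have [r r0 hr] := ball_finite e0.
  by exists r => // b /hr; exact: he.
have [e e0 he] := finite_of_ball (normc a) r0.
apply/nbhs_ballP; exists e => //= w /(he _ _ (lexx _)) [b -> ?].
exact: hr.
Qed.

Lemma nbhs_inftyP U : nbhs (None : sphere R) U <->
  U None /\ exists M, forall b, M < normc b -> U (Some b).
Proof.
split => [hU|[UN [M hM]]].
  split; first exact: (nbhs_singleton hU).
  have /nbhs_ballP[e /= /ball_of_chord2[c c0 hc] he] := hU.
  exists (4 / c) => b hb; apply: he; apply: hc; rewrite chord2_infty.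
  have n0 := sqr_ge0 (normc b).
  rewrite ltr_pdivrMr; last lra.
  have c40 : 0 < 4 / c by rewrite divr_gt0.
  have cc : c * (4 / c) = 4 by field; rewrite gt_eqF.
  have : 4 < c * normc b by rewrite -cc ltr_pM2l.
  have := sqr_ge0 (normc b - 1); nra.
have [e e0 he] := @chord2_of_ball (4 / (1 + M ^+ 2)) (divr_gt0 (ltr0n _ 4)
  (ltr_wpDr (sqr_ge0 M) ltr01)).
apply/nbhs_ballP; exists e => //= -[b|//] /he; rewrite chord2_infty => h.
apply: hM; rewrite ltNge; apply/negP => hb; move: h; rewrite ltNge => /negP; apply.
rewrite ler_pM2l // lef_pV2 ?posrE ?ltr_wpDr ?sqr_ge0 //.
by rewrite lerD2l lerXn2r ?nnegrE ?normc_ge0 // (le_trans (normc_ge0 b)).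
Qed.

(** The map 1/z is a half-turn of the unit sphere about the first coordinate axis, hence an
    isometry. This carries statements at infinity over to 0. *)
Lemma stereo_inv z : stereo (sphere_inv z) =
  ((stereo z).1.1, - (stereo z).1.2, - (stereo z).2).
Proof.
case: z => [[x y]|] /=; last first.
  by rewrite !mulr0 !mul0r expr0n /= !addr0 sub0r oppr0 divr1.
have [|] := eqVneq.
  by case=> -> -> /=; rewrite expr0n /= !mulr0 !mul0r !addr0 oppr0 divr1 add0r opprK.
rewrite eq_complex /= => nz.
have s0 : x ^+ 2 + y ^+ 2 != 0.
  rewrite paddr_eq0 ?sqr_ge0 // !sqrf_eq0; exact: nz.
have s1 : 1 + (x ^+ 2 + y ^+ 2) != 0.
  by rewrite gt_eqF // ltr_wpDr // addr_ge0 ?sqr_ge0.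
have key : 1 + ((x / (x ^+ 2 + y ^+ 2)) ^+ 2 + (- (y / (x ^+ 2 + y ^+ 2))) ^+ 2) =
   (1 + (x ^+ 2 + y ^+ 2)) / (x ^+ 2 + y ^+ 2) by field.
rewrite key; congr (_, _, _); field; rewrite s0 s1 //.
Qed.

Lemma sphere_inv_dist z w :
  sph_dist (sphere_inv z) (sphere_inv w) = sph_dist z w.
Proof. by rewrite /sph_dist !stereo_inv /dot3 /= !mulrNN. Qed.

Lemma sphere_invK : involutive (@sphere_inv R).
Proof.
case=> [a|] /=; last by rewrite eqxx.
have [->//|a0 /=] := eqVneq a 0.
by rewrite invr_eq0 (negbTE a0) invrK.
Qed.

Lemma sphere_inv_continuous : continuous (@sphere_inv R).
Proof.
move=> z U /nbhs_ballP[e e0 he]; apply/nbhs_ballP; exists e => // w hw.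
by apply: he; rewrite ballE /= sphere_inv_dist.
Qed.

Definition sphere_of_pair (u : R * R) : sphere R := Some (u.1 +i* u.2).

Lemma normc_le_sum (x y : R) : normc (x +i* y) <= `|x| + `|y|.
Proof.
rewrite -(@ler_pXn2r _ 2) // ?nnegrE ?addr_ge0 ?normc_ge0 //.
rewrite sqr_normcE sqrrD !real_normK ?num_real //.
by rewrite lerD2r lerDl mulrn_wge0 // mulr_ge0.
Qed.

Lemma sphere_of_pair_continuous : continuous sphere_of_pair.
Proof.
move=> -[x y] U /nbhs_ballP[e /= /ball_finite[r r0 hr] he].
apply/nbhs_ballP; exists (r / 2); first by rewrite /= divr_gt0.
move=> -[x' y'] [/= h1 h2]; apply: he; apply: hr.
have -> : (x' +i* y') - (x +i* y) = ((x' - x) +i* (y' - y)) by simpc.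
rewrite (le_lt_trans (normc_le_sum _ _)) //.
rewrite [ltRHS]splitr ltrD // distrC; first exact: h1.
exact: h2.
Qed.

Lemma sphere_compact : compact [set: sphere R].
Proof.
pose Q : set (R * R) := `[-1, 1] `*` `[-1, 1].
have Qc : compact Q by apply: compact_setX; exact: segment_compact.
have c1 : compact (sphere_of_pair @` Q).
  apply: continuous_compact => //.
  by apply: continuous_subspaceT => ?; exact: sphere_of_pair_continuous.
have c2 : compact (@sphere_inv R @` (sphere_of_pair @` Q)).
  apply: continuous_compact => //.
  by apply: continuous_subspaceT => ?; exact: sphere_inv_continuous.
have QS a : normc a <= 1 -> (sphere_of_pair @` Q) (Some a).
  move=> a1; exists (complex.Re a, complex.Im a); last by case: a {a1}.
  by split; rewrite /= in_itv /= -ler_norml (le_trans _ a1) //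
    ?normc_Re_le ?normc_Im_le.
suff -> : [set: sphere R] =
    (sphere_of_pair @` Q) `|` (@sphere_inv R @` (sphere_of_pair @` Q)).
  exact: compactU.
apply/seteqP; split=> // -[a|] _; last first.
  right; exists (Some 0) => /=; last by rewrite eqxx.
  by apply: QS; rewrite normc0.
have [a1|a1] := leP (normc a) 1; first by left; exact: QS.
right; exists (sphere_inv (Some a)); last exact: sphere_invK.
have a0 : a != 0 by rewrite -normc_gt0 (lt_trans ltr01).
rewrite /= (negbTE a0); apply: QS.
by rewrite normcV invf_le1 ?(ltW a1) // (lt_trans ltr01).
Qed.

(** A planar disk is a union of segments issuing from its centre; at infinity the image of such a
    disk under the isometry [sphere_inv] serves. *)
Lemma sphere_locally_connected z (e : R) : 0 < e ->
  exists C : set (sphere R), [/\ connected C, nbhs z C & C `<=` ball z e].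
Proof.
move=> e0; have [r r0 hr] := ball_finite e0.
pose disk a : set (sphere R) := [set w | exists2 b, w = Some b & normc (b - a) < r].
have dc a : connected (disk a).
  have -> : disk a = \bigcup_(v in [set v | normc v < r])
      ((fun t : R => Some (a + t%:C * v) : sphere R) @` `[0, 1]).
    apply/seteqP; split=> w.
      move=> [b -> hb]; exists (b - a) => //; exists 1; last by rewrite mul1r subrKC.
      by rewrite /= in_itv /= lexx ler01.
    move=> [v hv [t]]; rewrite /= in_itv /= => /andP[t0 t1] <-.
    exists (a + t%:C * v) => //; rewrite addrC addKr normcM normc_real ger0_norm //.
    by apply: le_lt_trans hv; rewrite ler_piMl // normc_ge0.
  apply: bigcup_connected.
    exists (Some a) => v _; exists 0; last by rewrite mul0r addr0.
    by rewrite /= in_itv /= lexx ler01.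
  move=> v _; apply: connected_continuous_connected; first exact: segment_connected.
  apply: continuous_subspaceT => t U /nbhs_ballP[e1 /= /ball_finite[r1 r10 hr1] he1].
  have v1 : 0 < normc v + 1 by rewrite ltr_wpDl // normc_ge0.
  apply/nbhs_ballP; exists (r1 / (normc v + 1)); first by rewrite /= divr_gt0.
  move=> s /= hs; apply: he1; apply: hr1.
  have -> : a + s%:C * v - (a + t%:C * v) = (s - t)%:C * v.
    by rewrite rmorphB /=; ring.
  rewrite normcM normc_real distrC.
  have n0 := normc_ge0 v.
  have : `|t - s| * (normc v + 1) < r1 by rewrite -ltr_pdivlMr.
  have := normr_ge0 (t - s); nra.
have dn a : nbhs (Some a : sphere R) (disk a).
  by apply/nbhs_finiteP; exists r => // b hb; exists b.
case: z => [a|].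
  exists (disk a); split => //.
  by move=> w [b -> /hr].
exists (@sphere_inv R @` disk 0); split.
- apply: connected_continuous_connected => //.
  by apply: continuous_subspaceT => ?; exact: sphere_inv_continuous.
- have hN : nbhs (None : sphere R) (@sphere_inv R @^-1` disk 0).
    by apply: (@sphere_inv_continuous None); exact: (dn 0).
  by apply: filterS hN => w hw; exists (sphere_inv w) => //; exact: sphere_invK.
- move=> _ [w [b -> hb] <-].
  suff : sph_dist None (sphere_inv (Some b)) < e by [].
  by rewrite -sphere_inv_dist sphere_invK; apply: hr.
Qed.

End SphereTopology.

(** * Strict derivatives and continuity of rational maps *)

Section ComplexCalculus.
Variable R : realType.
Implicit Types (a b z : R[i]) (p q : {poly R[i]}).

Lemma div_close (u0 v0 : R[i]) (e : R) : v0 != 0 -> 0 < e ->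
  exists2 r, 0 < r & forall u v, normc (u - u0) < r -> normc (v - v0) < r ->
    v != 0 /\ normc (u / v - u0 / v0) < e.
Proof.
rewrite -normc_gt0 => v00 e0.
have u00 := normc_ge0 u0.
have s0 : 0 < normc v0 + normc u0 + 1 by lra.
pose r := Num.min (normc v0 / 2) (e * normc v0 ^+ 2 / (2 * (normc v0 + normc u0 + 1))).
have r0 : 0 < r.
  by rewrite lt_min !divr_gt0 ?mulr_gt0 ?exprn_gt0.
have r1 : r <= normc v0 / 2 by rewrite ge_min lexx.
have r2 : r * (2 * (normc v0 + normc u0 + 1)) <= e * normc v0 ^+ 2.
  by rewrite -ler_pdivlMr ?mulr_gt0 // /r ge_min lexx orbT.
exists r => // u v hu hv.
have v1 : normc v0 / 2 < normc v.
  have := normcB_ge v0 v; rewrite normcBC; lra.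
have vn0 : 0 < normc v by lra.
split; first by rewrite -normc_gt0.
have -> : u / v - u0 / v0 = ((u - u0) * v0 - u0 * (v - v0)) / (v * v0).
  by field; rewrite -!normc_gt0 vn0 v00.
rewrite normcf_div normcM ltr_pdivrMr ?mulr_gt0 //.
rewrite (le_lt_trans (normcD _ _)) // normcNn !normcM.
have h1 : normc (u - u0) * normc v0 + normc u0 * normc (v - v0) <
    r * (normc v0 + normc u0 + 1).
  have : normc (u - u0) * normc v0 <= r * normc v0 by rewrite ler_pM2r // ltW.
  have : normc u0 * normc (v - v0) <= normc u0 * r by rewrite ler_wpM2l // ltW.
  by move=> *; lra.
have : e * (normc v0 / 2 * normc v0) < e * (normc v * normc v0).
  by rewrite ltr_pM2l // ltr_pM2r.
by move=> *; lra.
Qed.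

Lemma div_large (u0 : R[i]) (M : R) : u0 != 0 ->
  exists2 r, 0 < r & forall u v, normc (u - u0) < r -> normc v < r -> v != 0 ->
    M < normc (u / v).
Proof.
rewrite -normc_gt0 => u00.
pose r := Num.min (normc u0 / 2) (normc u0 / (2 * (`|M| + 1))).
have M0 := normr_ge0 M; have MM := ler_norm M.
have r0 : 0 < r by rewrite lt_min !divr_gt0 // mulr_gt0 //; lra.
have r1 : r <= normc u0 / 2 by rewrite ge_min lexx.
have r2 : r * (2 * (`|M| + 1)) <= normc u0.
  rewrite -ler_pdivlMr; last by apply: mulr_gt0; lra.
  by rewrite ge_min lexx orbT.
exists r => // u v hu hv; rewrite -normc_gt0 => v0.
rewrite normcf_div ltr_pdivlMr //.
have : normc u0 / 2 < normc u.
  have := normcB_ge u0 u; rewrite normcBC; lra.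
have : `|M| * normc v <= `|M| * r by rewrite ler_wpM2l // ltW.
have : M * normc v <= `|M| * normc v by rewrite ler_wpM2r // ltW.
by move=> *; lra.
Qed.

Lemma poly_bound p (M : R) :
  exists2 B, 0 <= B & forall a, normc a <= M -> normc p.[a] <= B.
Proof.
elim/poly_ind: p => [|p c [B B0 hB]].
  by exists 0 => // a _; rewrite horner0 normc0.
have [M0|M0] := ltP M 0.
  by exists 0 => // a /le_lt_trans /(_ M0); rewrite ltNge normc_ge0.
exists (B * M + normc c); first by rewrite addr_ge0 ?mulr_ge0 ?normc_ge0.
move=> a aM; rewrite hornerMXaddC (le_trans (normcD _ _)) // lerD2r normcM.
by rewrite ler_pM ?normc_ge0 // hB.
Qed.

Lemma poly_lipschitz p (M : R) :
  exists2 L, 0 <= L & forall a b, normc a <= M -> normc b <= M ->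
    normc (p.[a] - p.[b]) <= L * normc (a - b).
Proof.
elim/poly_ind: p => [|p c [L L0 hL]].
  by exists 0 => // a b _ _; rewrite !horner0 subr0 normc0 mul0r.
have [M0|M0] := ltP M 0.
  by exists 0 => // a b /le_lt_trans /(_ M0); rewrite ltNge normc_ge0.
have [B B0 hB] := poly_bound p M.
exists (L * M + B); first by rewrite addr_ge0 ?mulr_ge0.
move=> a b aM bM; rewrite !hornerMXaddC.
have -> : p.[a] * a + c - (p.[b] * b + c) =
  (p.[a] - p.[b]) * a + p.[b] * (a - b) by ring.
rewrite (le_trans (normcD _ _)) // !normcM mulrDl lerD //.
  by rewrite -mulrA [M * _]mulrC mulrA ler_pM ?normc_ge0 // hL.
by rewrite ler_wpM2r ?normc_ge0 // hB.
Qed.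

(** Strict differentiability: both points vary. Near z the function is multiplication by l up to a
    small Lipschitz error, so two-point expansion estimates follow without a mean value theorem. *)
Definition strict_deriv (f : R[i] -> R[i]) z (l : R[i]) :=
  forall e : R, 0 < e -> exists2 r, 0 < r & forall a b,
    normc (a - z) < r -> normc (b - z) < r ->
    normc (f a - f b - l * (a - b)) <= e * normc (a - b).

Lemma strict_deriv_cont f z l : strict_deriv f z l ->
  forall e : R, 0 < e -> exists2 r, 0 < r & forall a,
    normc (a - z) < r -> normc (f a - f z) < e.
Proof.
move=> hf e e0; have [r r0 hr] := hf 1 ltr01.
have l0 := normc_ge0 l.
pose r' := Num.min r (e / (normc l + 2)).
exists r' => [|a]; first by rewrite lt_min r0 divr_gt0 //; lra.
rewrite lt_min ltr_pdivlMr; last lra.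
move=> /andP[ar ae].
have := hr a z ar; rewrite subrr normc0 => /(_ r0).
move=> h.
have -> : f a - f z = (f a - f z - l * (a - z)) + l * (a - z) by ring.
rewrite (le_lt_trans (normcD _ _)) // normcM.
have n0 := normc_ge0 (a - z); nra.
Qed.

Lemma strict_deriv_cst c z : strict_deriv (fun=> c) z 0.
Proof.
move=> e e0; exists 1 => // a b _ _.
by rewrite subrr mul0r subr0 normc0 mulr_ge0 ?normc_ge0 // ltW.
Qed.

Lemma strict_deriv_id z : strict_deriv id z 1.
Proof.
move=> e e0; exists 1 => // a b _ _.
by rewrite mul1r subrr normc0 mulr_ge0 ?normc_ge0 // ltW.
Qed.

Lemma strict_derivD f g z l m : strict_deriv f z l -> strict_deriv g z m ->
  strict_deriv (fun a => f a + g a) z (l + m).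
Proof.
move=> hf hg e e0; have e20 : 0 < e / 2 by rewrite divr_gt0.
have [r r0 hr] := hf _ e20; have [s s0 hs] := hg _ e20.
exists (Num.min r s) => [|a b]; first by rewrite lt_min r0.
rewrite !lt_min => /andP[ar as_] /andP[br bs].
have -> : f a + g a - (f b + g b) - (l + m) * (a - b) =
  (f a - f b - l * (a - b)) + (g a - g b - m * (a - b)) by ring.
rewrite (le_trans (normcD _ _)) // [e]splitr mulrDl lerD //; first exact: hr.
exact: hs.
Qed.

Lemma strict_derivM f g z l m : strict_deriv f z l -> strict_deriv g z m ->
  strict_deriv (fun a => f a * g a) z (l * g z + f z * m).
Proof.
move=> hf hg e e0.
have [f0 g0 l0 m0] := And4 (normc_ge0 (f z)) (normc_ge0 (g z)) (normc_ge0 l)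
  (normc_ge0 m).
pose S := normc (f z) + normc (g z) + normc l + normc m + 2.
have S0 : 0 < S by rewrite /S; lra.
pose d := Num.min 1 (e / S).
have d0 : 0 < d by rewrite lt_min ltr01 divr_gt0.
have d1 : d <= 1 by rewrite ge_min lexx.
have dS : d * S <= e by rewrite -ler_pdivlMr // ge_min lexx orbT.
have [r1 r10 h1] := hf _ d0; have [r2 r20 h2] := hg _ d0.
have [r3 r30 h3] := strict_deriv_cont hf d0.
have [r4 r40 h4] := strict_deriv_cont hg d0.
exists (Num.min (Num.min r1 r2) (Num.min r3 r4)) => [|a b].
  by rewrite !lt_min r10 r20 r30.
rewrite !lt_min => /andP[/andP[a1 a2] /andP[a3 a4]] /andP[/andP[b1 b2] /andP[b3 b4]].
have -> : f a * g a - f b * g b - (l * g z + f z * m) * (a - b) =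
  ((f a - f b - l * (a - b)) * g a + l * (a - b) * (g a - g z)) +
  (f b * (g a - g b - m * (a - b)) + (f b - f z) * (m * (a - b))) by ring.
have ga : normc (g a) <= normc (g z) + 1.
  have := normcB_ge (g a) (g z); have := h4 a a4; lra.
have fb : normc (f b) <= normc (f z) + 1.
  have := normcB_ge (f b) (f z); have := h3 b b3; lra.
set n := normc (a - b); have n0 : 0 <= n by exact: normc_ge0.
apply: le_trans (_ : d * S * n <= _); last by rewrite ler_wpM2r.
have k1 : normc (f a - f b - l * (a - b)) * normc (g a) <=
    d * n * (normc (g z) + 1).
  by rewrite ler_pM ?normc_ge0 // h1.
have k2 : normc (l * (a - b)) * normc (g a - g z) <= normc l * n * d.
  by rewrite normcM ler_wpM2l ?mulr_ge0 // ltW // h4.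
have k3 : normc (f b) * normc (g a - g b - m * (a - b)) <=
    (normc (f z) + 1) * (d * n).
  by rewrite ler_pM ?normc_ge0 // h2.
have k4 : normc (f b - f z) * normc (m * (a - b)) <= d * (normc m * n).
  by rewrite normcM ler_wpM2r ?mulr_ge0 // ltW // h3.
rewrite (le_trans (normcD _ _)) // (le_trans (lerD (normcD _ _) (normcD _ _))) //.
rewrite !(normcM (_ - _) (g a)) !(normcM (l * _)) !(normcM (f b)) !(normcM (f b - _)).
by rewrite /S; move: k1 k2 k3 k4; move=> *; lra.
Qed.

Lemma strict_derivV g z m : g z != 0 -> strict_deriv g z m ->
  strict_deriv (fun a => (g a)^-1) z (- m / g z ^+ 2).
Proof.
move=> gz0 hg e e0.
have m0 := normc_ge0 m.
pose d := e / (2 * (normc m + 1)).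
have d0 : 0 < d by rewrite divr_gt0 // mulr_gt0 //; lra.
have dm : d * normc m <= e / 2.
  have h : d * (2 * (normc m + 1)) = e.
    by rewrite /d mulfVK // gt_eqF // mulr_gt0 //; lra.
  by nra.
have gz20 : g z ^+ 2 != 0 by rewrite expf_neq0.
have [c c0 hc] := div_close 1 gz20 d0.
have G0 : 0 < normc (g z) by rewrite normc_gt0.
pose G := normc (g z).
pose d2 := Num.min (G / 2) (c / (3 * G)).
have d20 : 0 < d2 by rewrite lt_min !divr_gt0 // mulr_gt0.
have d2G : d2 <= G / 2 by rewrite ge_min lexx.
have d2c : d2 * (3 * G) <= c by rewrite -ler_pdivlMr ?mulr_gt0 // ge_min lexx orbT.
have [r1 r10 h1] := strict_deriv_cont hg d20.
have G20 : 0 < G ^+ 2 by rewrite exprn_gt0.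
have [r2 r20 h2] := hg (e * G ^+ 2 / 8) (divr_gt0 (mulr_gt0 e0 G20) (ltr0n _ 8)).
exists (Num.min r1 r2) => [|a b]; first by rewrite lt_min r10.
rewrite !lt_min => /andP[a1 a2] /andP[b1 b2].
have ga := h1 a a1; have gb := h1 b b1.
have ga2 : G / 2 <= normc (g a).
  by have := normcB_ge (g z) (g a); rewrite normcBC -/G; lra.
have gb2 : G / 2 <= normc (g b).
  by have := normcB_ge (g z) (g b); rewrite normcBC -/G; lra.
have ga0 : g a != 0 by rewrite -normc_gt0; rewrite /G in ga2; lra.
have gb0 : g b != 0 by rewrite -normc_gt0; rewrite /G in gb2; lra.
have -> : (g a)^-1 - (g b)^-1 - - m / g z ^+ 2 * (a - b) =
  - ((g a - g b - m * (a - b)) / (g a * g b)) -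
   m * (a - b) * (1 / (g a * g b) - 1 / g z ^+ 2).
  by field; rewrite ga0 gb0 gz0.
have hgg : normc (g a * g b - g z ^+ 2) < c.
  have -> : g a * g b - g z ^+ 2 = (g a - g z) * g b + g z * (g b - g z) by ring.
  rewrite (le_lt_trans (normcD _ _)) // !normcM -/G.
  have gb3 : normc (g b) <= 2 * G.
    by have := normcB_ge (g b) (g z); rewrite -/G; lra.
  have k1 : normc (g a - g z) * normc (g b) <= d2 * (2 * G).
    by rewrite ler_pM ?normc_ge0 // ltW.
  have k2 : G * normc (g b - g z) < G * d2 by rewrite ltr_pM2l.
  by lra.
have [_ hd] := hc 1 (g a * g b) ltac:(by rewrite subrr normc0) hgg.
set n := normc (a - b); have n0 : 0 <= n by exact: normc_ge0.
rewrite (le_trans (normcD _ _)) // !normcNn.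
rewrite [X in _ <= X * _]splitr [leRHS]mulrDl lerD //.
  rewrite normcf_div normcM ler_pdivrMr; last by apply: mulr_gt0; rewrite normc_gt0.
  apply: le_trans (h2 a b a2 b2) _; rewrite -/n.
  have : G / 2 * (G / 2) <= normc (g a) * normc (g b).
    by rewrite ler_pM // divr_ge0 // ltW.
  move=> h; have : e / 2 * n * (G / 2 * (G / 2)) <= e / 2 * n * (normc (g a) * normc (g b)).
    by rewrite ler_wpM2l // mulr_ge0 // divr_ge0 // ltW.
  by apply: le_trans; rewrite le_eqVlt; apply/orP; left; apply/eqP; field.
rewrite !normcM -/n.
have : normc m * n * normc (1 / (g a * g b) - 1 / g z ^+ 2) <= normc m * n * d.
  by rewrite ler_wpM2l ?mulr_ge0 // ltW.
have : d * normc m * n <= e / 2 * n by rewrite ler_wpM2r.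
by move=> *; lra.
Qed.

Lemma strict_deriv_poly p z : strict_deriv (fun a => p.[a]) z p^`().[z].
Proof.
elim/poly_ind: p => [|p c IH].
  rewrite deriv0 horner0.
  have -> : (fun a => (0 : {poly R[i]}).[a]) = (fun=> 0).
    by apply/funext => a; rewrite horner0.
  exact: strict_deriv_cst.
rewrite derivD derivC addr0 derivM derivX mulr1 hornerD hornerM hornerX.
have -> : (fun a => (p * 'X + c%:P).[a]) = (fun a => p.[a] * a + c).
  by apply/funext => a; rewrite hornerMXaddC.
rewrite -[X in strict_deriv _ _ X]addr0.
apply: strict_derivD; last exact: strict_deriv_cst.
by rewrite -[X in _ + X]mulr1; apply: strict_derivM => //; exact: strict_deriv_id.
Qed.

Lemma strict_deriv_ratio p q z : q.[z] != 0 ->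
  strict_deriv (fun a => p.[a] / q.[a]) z
    ((p^`().[z] * q.[z] - p.[z] * q^`().[z]) / q.[z] ^+ 2).
Proof.
move=> qz.
have -> : (p^`().[z] * q.[z] - p.[z] * q^`().[z]) / q.[z] ^+ 2 =
  p^`().[z] * (q.[z])^-1 + p.[z] * (- q^`().[z] / q.[z] ^+ 2) by field.
apply: strict_derivM; first exact: strict_deriv_poly.
by apply: (@strict_derivV (fun a => q.[a])) => //; exact: strict_deriv_poly.
Qed.

Lemma poly_cont p z (e : R) : 0 < e -> exists2 r, 0 < r & forall a,
    normc (a - z) < r -> normc (p.[a] - p.[z]) < e.
Proof. exact: (strict_deriv_cont (@strict_deriv_poly p z)). Qed.

(** * Polynomials near infinity and continuity of rational maps *)

Lemma poly_at_infty p n (e : R) : (size p <= n.+1)%N -> 0 < e ->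
  exists2 M, 0 < M & forall a, M < normc a -> normc (p.[a] / a ^+ n - p`_n) < e.
Proof.
elim/poly_ind: p n e => [|p c IH] n e.
  by move=> _ e0; exists 1 => // a _; rewrite horner0 coef0 mul0r subrr normc0.
move=> sz e0; case: n sz => [|n] sz.
  have -> : p * 'X + c%:P = ((p * 'X + c%:P)`_0)%:P by exact: size1_polyC.
  by exists 1 => // a _; rewrite hornerC expr0 divr1 coefC eqxx subrr normc0.
have sp : (size p <= n.+1)%N.
  have [->|p0] := eqVneq p 0; first by rewrite size_poly0.
  by move: sz; rewrite size_MXaddC (negbTE p0) /= ltnS.
have e20 : 0 < e / 2 by rewrite divr_gt0.
have [M M0 hM] := IH n (e / 2) sp e20.
have c0 := normc_ge0 c.
exists (M + 1 + 2 * (normc c + 1) / e).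
  by rewrite ltr_wpDr ?divr_ge0 ?mulr_ge0 ?(ltW e0) //; lra.
move=> a ha.
have h20 : 0 <= 2 * (normc c + 1) / e.
  by rewrite divr_ge0 ?mulr_ge0 ?(ltW e0) //; lra.
have a1 : 1 < normc a by lra.
have a0 : a != 0 by rewrite -normc_gt0; lra.
have a2 : 2 * (normc c + 1) / e < normc a by lra.
rewrite hornerMXaddC coefD coefMX coefC /= addr0.
have -> : (p.[a] * a + c) / a ^+ n.+1 - p`_n =
    (p.[a] / a ^+ n - p`_n) + c / a ^+ n.+1.
  have an0 : a ^+ n != 0 by rewrite expf_neq0.
  by rewrite exprS; field; rewrite a0 an0.
rewrite (le_lt_trans (normcD _ _)) // [ltRHS]splitr.
apply: ltr_leD; first by apply: hM; lra.
rewrite normcf_div normcX ler_pdivrMr; last by apply: exprn_gt0; lra.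
have : normc a <= normc a ^+ n.+1.
  by rewrite exprS ler_peMr ?exprn_ege1 // ltW //; lra.
move: a2; rewrite ltr_pdivrMr // => a2 a3.
have : e * normc a <= e * normc a ^+ n.+1 by rewrite ler_pM2l.
by lra.
Qed.

Lemma ratfun_finite p q z : q.[z] != 0 -> ratfun p q (Some z) = Some (p.[z] / q.[z]).
Proof. by rewrite /= => /negbTE ->. Qed.

(** Coprimality excludes 0/0 at a zero of q, so the quotient really tends to infinity there. At
    infinity both polynomials are divided by the power of the larger degree, and their limits are
    coefficients. *)
Lemma ratfun_continuous p q : q != 0 -> coprimep p q -> continuous (ratfun p q).
Proof.
move=> q0 pq [z|] U hU.
  have [qz|qz] := eqVneq q.[z] 0.
    have pz : p.[z] != 0.
      by apply/negP => /(coprimep_root pq); rewrite qz eqxx.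
    move: hU; rewrite /= qz eqxx => /nbhs_inftyP[UN [M hM]].
    have [r r0 hr] := div_large M pz.
    have [r1 r10 h1] := poly_cont p z r0; have [r2 r20 h2] := poly_cont q z r0.
    apply/nbhs_finiteP; exists (Num.min r1 r2); first by rewrite lt_min r10.
    move=> b; rewrite lt_min => /andP[b1 b2]; rewrite /=.
    have [//|qb] := eqVneq; apply: hM; apply: hr => //; first exact: h1.
    by have := h2 b b2; rewrite qz subr0.
  move: hU; rewrite ratfun_finite // => /nbhs_finiteP[e e0 he].
  have [r r0 hr] := div_close p.[z] qz e0.
  have [r1 r10 h1] := poly_cont p z r0; have [r2 r20 h2] := poly_cont q z r0.
  apply/nbhs_finiteP; exists (Num.min r1 r2); first by rewrite lt_min r10.
  move=> b; rewrite lt_min => /andP[b1 b2].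
  have [qb hb] := hr _ _ (h1 b b1) (h2 b b2).
  by rewrite /preimage /mkset ratfun_finite //; exact: he.
move: hU; rewrite /=; case: ltnP => [spq|spq].
  move=> /nbhs_inftyP[UN [M hM]].
  have sp : size p = (size p).-1.+1 by case: (size p) spq.
  have p0 : p`_(size p).-1 != 0 by rewrite lead_coef_eq0 -size_poly_gt0 sp.
  have [r r0 hr] := div_large M p0.
  have [M1 M10 h1] := @poly_at_infty p (size p).-1 r ltac:(by rewrite -sp) r0.
  have [M2 M20 h2] := @poly_at_infty q (size p).-1 r ltac:(by rewrite -sp ltnW) r0.
  apply/nbhs_inftyP; split; first by rewrite /preimage /= spq.
  exists (Num.max M1 M2) => b; rewrite gt_max => /andP[b1 b2].
  rewrite /preimage /=; have [//|qb] := eqVneq; apply: hM.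
  have b0 : b ^+ (size p).-1 != 0 by rewrite expf_neq0 // -normc_gt0; lra.
  have -> : p.[b] / q.[b] = (p.[b] / b ^+ (size p).-1) / (q.[b] / b ^+ (size p).-1).
    by field; rewrite b0 qb.
  apply: hr; first exact: h1.
    have := h2 b b2; rewrite [q`__]nth_default ?subr0 //.
    by rewrite -ltnS -sp.
  by rewrite mulf_neq0 // invr_neq0.
move=> /nbhs_finiteP[e e0 he].
have sq : size q = (size q).-1.+1 by rewrite prednK // size_poly_gt0.
have q1 : q`_(size q).-1 != 0 by rewrite lead_coef_eq0.
have [r r0 hr] := div_close p`_(size q).-1 q1 e0.
have [M1 M10 h1] := @poly_at_infty p (size q).-1 r ltac:(by rewrite -sq) r0.
have [M2 M20 h2] := @poly_at_infty q (size q).-1 r ltac:(by rewrite -sq) r0.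
apply/nbhs_inftyP; split.
  rewrite /preimage /= ltnNge spq /=; apply: he; by rewrite subrr normc0.
exists (Num.max M1 M2) => b; rewrite gt_max => /andP[b1 b2].
have b0 : b ^+ (size q).-1 != 0 by rewrite expf_neq0 // -normc_gt0; lra.
have [h3 h4] := hr _ _ (h1 b b1) (h2 b b2).
have qb : q.[b] != 0 by apply: contraNneq h3 => ->; rewrite mul0r.
rewrite /preimage /mkset ratfun_finite //; apply: he.
suff -> : p.[b] / q.[b] = (p.[b] / b ^+ (size q).-1) / (q.[b] / b ^+ (size q).-1) by [].
by field; rewrite b0 qb.
Qed.

End ComplexCalculus.

(** * Lattice products *)

Section LatticeProducts.
Variable R : realType.
Local Notation C := R[i].
Implicit Types (z w : C).

(** The quotients v_(i+2) v_i / v_(i+1)^2 are multiplicative second differences, so only the two end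
    quotients survive. The identity is cross-multiplied in order to apply to polynomials. *)
Lemma prod_telescope (A : comNzRingType) (v : nat -> A) m :
  (\prod_(i < m) (v i.+2 * v i)) * (v 1%N * v m) =
  (\prod_(i < m) v i.+1 ^+ 2) * (v 0%N * v m.+1).
Proof.
elim: m => [|m IH]; first by rewrite !big_ord0 mulrC [v 1%N * _]mulrC mulrC.
rewrite !big_ord_recr /=.
have -> : \prod_(i < m) (v i.+2 * v i) * (v m.+2 * v m) * (v 1%N * v m.+1) =
  \prod_(i < m) (v i.+2 * v i) * (v 1%N * v m) * (v m.+2 * v m.+1) by ring.
by rewrite IH; ring.
Qed.

(** This is (1 + t)^k <= 1 / (1 - k t) cleared of its denominator; for k t <= e / 2 and e < 1 it
    bounds the power by 1 + e. *)
Lemma expr1D_inv_bound (t : R) k : 0 <= t -> (1 + t) ^+ k * (1 - k%:R * t) <= 1.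
Proof.
move=> t0; elim: k => [|k IH]; first by rewrite expr0 mul0r subr0 mulr1.
apply: le_trans IH; rewrite exprS -natr1.
have := exprn_ge0 k (addr_ge0 ler01 t0); set X := _ ^+ k => X0.
have kR : 0 <= k%:R :> R by [].
have -> : (1 + t) * X * (1 - (k%:R + 1) * t) =
  X * (1 - k%:R * t) - X * ((k%:R + 1) * t ^+ 2) by ring.
by rewrite gerBl mulr_ge0 // mulr_ge0 ?sqr_ge0 // addr_ge0.
Qed.

Lemma bernoulli_ge (t : R) k : 0 <= t -> 1 + k%:R * t <= (1 + t) ^+ k.
Proof.
move=> t0; elim: k => [|k IH]; first by rewrite expr0 mul0r addr0.
rewrite exprS -natr1; have kR : 0 <= k%:R :> R by [].
apply: le_trans (_ : (1 + t) * (1 + k%:R * t) <= _); last first.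
  by rewrite ler_wpM2l // addr_ge0.
have := mulr_ge0 kR (sqr_ge0 t); lra.
Qed.

Variables (h : R) (n : nat).
Hypothesis h0 : 0 < h.
Hypothesis n0 : (0 < n)%N.

Local Notation m := (n.*2.+1).

(** The lattice is centred: index n + 1 corresponds to 0. Indices 1 to [m] give the cell centres,
    filling a box of half-width h n; indices 0 and m + 1 give the outer neighbours. *)
Definition node (x y : nat) : C :=
  (h * (x%:R - n.+1%:R)) +i* (h * (y%:R - n.+1%:R)).

Definition lin (x y : nat) : {poly C} := 'X - (node x y)%:P.

(** The product over the four lattice neighbours of the cell, equal to (z - w)^4 - h^4. Horizontal
    and vertical neighbours are grouped, and [cellQ] is split accordingly, because the two
    directions telescope separately. *)
Definition cellP (u : 'I_m * 'I_m) : {poly C} :=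
  (lin u.1.+2 u.2.+1 * lin u.1 u.2.+1) * (lin u.1.+1 u.2.+2 * lin u.1.+1 u.2).

Definition cellQ (u : 'I_m * 'I_m) : {poly C} :=
  lin u.1.+1 u.2.+1 ^+ 2 * lin u.1.+1 u.2.+1 ^+ 2.

Definition cell_center (u : 'I_m * 'I_m) : C := node u.1.+1 u.2.+1.

Lemma subcE (a b c d : R) : (a +i* b) - (c +i* d) = (a - c) +i* (b - d).
Proof. by []. Qed.

Lemma mulcE (a b c d : R) :
  (a +i* b) * (c +i* d) = (a * c - b * d) +i* (a * d + b * c).
Proof. by []. Qed.

Lemma cellP_eval z u : (cellP u).[z] = (z - cell_center u) ^+ 4 - h%:C ^+ 4.
Proof.
case: z => a b; rewrite /cellP /lin !hornerM !hornerXsubC /cell_center /node.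
move: (nat_of_ord u.1) (nat_of_ord u.2) => x y.
rewrite -!natr1; move: (x%:R : R) (y%:R : R) (n%:R : R) => X Y N.
have -> : h%:C = h +i* 0 by [].
rewrite !exprS expr0 !mulr1 !subcE !mulcE.
by congr (_ +i* _); ring.
Qed.

Lemma cellQ_eval z u : (cellQ u).[z] = (z - cell_center u) ^+ 4.
Proof. by rewrite /cellQ -exprD horner_exp hornerXsubC. Qed.

Definition prodP (S : {set 'I_m * 'I_m}) : {poly C} := \prod_(u in S) cellP u.
Definition prodQ (S : {set 'I_m * 'I_m}) : {poly C} := \prod_(u in S) cellQ u.

(** Each factor has modulus at most 1 + (h / r)^4 and there are at most m^2 of them; the fourth
    power beats this number when the mesh is fine. *)
Lemma far_bound (S : {set 'I_m * 'I_m}) z (r e : R) : 0 < r -> 0 < e < 1 ->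
  (forall u, u \in S -> r <= normc (z - cell_center u)) ->
  (m * m)%:R * (h / r) ^+ 4 <= e / 2 ->
  (prodQ S).[z] != 0 /\ normc (prodP S).[z] <= (1 + e) * normc (prodQ S).[z].
Proof.
move=> r0 /andP[e0 e1] hS he; set t := (h / r) ^+ 4 in he.
have t0 : 0 <= t by rewrite exprn_ge0 // divr_ge0 // ltW.
split.
  rewrite /prodQ horner_prod prodf_seq_neq0; apply/allP => u _; apply/implyP => uS.
  rewrite cellQ_eval expf_neq0 // -normc_gt0.
  by rewrite (lt_le_trans r0) // hS.
rewrite /prodP /prodQ !horner_prod !normc_prod.
apply: le_trans (_ : (1 + t) ^+ #|S| * \prod_(u in S) normc (cellQ u).[z] <= _).
  rewrite -prodr_const -big_split /=; apply: ler_prod => u uS.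
  rewrite normc_ge0 /= cellP_eval cellQ_eval normcX.
  rewrite (le_trans (normcD _ _)) // normcNn !normcX normc_real gtr0_norm //.
  rewrite [leRHS]mulrDl mul1r lerD2l /t expr_div_n mulrAC ler_pdivlMr ?exprn_gt0 //.
  by rewrite ler_pM2l ?exprn_gt0 // lerXn2r ?nnegrE ?normc_ge0 ?(ltW r0) // hS.
rewrite ler_wpM2r //; first by apply: prodr_ge0 => u _; exact: normc_ge0.
apply: le_trans (_ : (1 + t) ^+ (m * m) <= _).
  rewrite ler_weXn2l ?lerDl //.
  by apply: leq_trans (max_card _) _; rewrite card_prod !card_ord.
have := expr1D_inv_bound (m * m) t0; set X := _ ^+ _; set k := _%:R * t in he * => hX.
have X0 : 0 <= X by rewrite exprn_ge0 // addr_ge0.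
nra.
Qed.

(** What remains of the full product: [boxN] runs over the outer ring, [boxD] over the outermost
    layer of cells, with its corners counted twice. Opposite sides are paired. The logarithm of
    |boxN / boxD| is the discrete flux of the potential through the border. *)
Definition boxN : {poly C} :=
  (\prod_(y < m) (lin 0 y.+1 * lin m.+1 y.+1)) *
  (\prod_(x < m) (lin x.+1 0 * lin x.+1 m.+1)).

Definition boxD : {poly C} :=
  (\prod_(y < m) (lin 1 y.+1 * lin m y.+1)) *
  (\prod_(x < m) (lin x.+1 1 * lin x.+1 m)).

(** Horizontal neighbours are multiplied row by row and vertical ones column by column; each line is
    an instance of [prod_telescope]. *)
Lemma box_telescope : prodP [set: _]%SET * boxD = prodQ [set: _]%SET * boxN.
Proof.
rewrite /prodP /prodQ /boxN /boxD.
have fullE (F : 'I_m * 'I_m -> {poly C}) :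
    \prod_(u in [set: 'I_m * 'I_m]%SET) F u = \prod_(u : 'I_m * 'I_m) F u.
  by apply: eq_bigl => u; rewrite finset.in_setT.
rewrite !fullE.
have colE (F : nat -> nat -> {poly C}) :
    \prod_(u : 'I_m * 'I_m) F u.1 u.2 = \prod_(x < m) \prod_(y < m) F x y.
  by rewrite pair_big.
have rowE (F : nat -> nat -> {poly C}) :
    \prod_(u : 'I_m * 'I_m) F u.1 u.2 = \prod_(y < m) \prod_(x < m) F x y.
  by rewrite colE exchange_big.
have -> : \prod_(u : 'I_m * 'I_m) cellP u =
    (\prod_(u : 'I_m * 'I_m) (lin u.1.+2 u.2.+1 * lin u.1 u.2.+1)) *
    (\prod_(u : 'I_m * 'I_m) (lin u.1.+1 u.2.+2 * lin u.1.+1 u.2)).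
  by rewrite -big_split.
have -> : \prod_(u : 'I_m * 'I_m) cellQ u =
    (\prod_(u : 'I_m * 'I_m) lin u.1.+1 u.2.+1 ^+ 2) *
    (\prod_(u : 'I_m * 'I_m) lin u.1.+1 u.2.+1 ^+ 2).
  by rewrite -big_split.
rewrite (rowE (fun x y => lin x.+2 y.+1 * lin x y.+1)).
rewrite (colE (fun x y => lin x.+1 y.+2 * lin x.+1 y)).
rewrite {1}(rowE (fun x y => lin x.+1 y.+1 ^+ 2)).
rewrite (colE (fun x y => lin x.+1 y.+1 ^+ 2)).
rewrite mulrACA [RHS]mulrACA -!big_split /=.
apply: eq_bigr => i _; congr (_ * _).
  exact: (prod_telescope (fun x => lin x i.+1)).
exact: (prod_telescope (fun y => lin i.+1 y)).
Qed.

(* With N the half-width of the box, D = N^2 - (p + i q)^2 is one factor of the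
   denominator and D + s the corresponding factor of the numerator. *)
Lemma box_factor (N s p q : R) : 0 < N -> 0 <= s ->
  `|p| <= N / 10 -> `|q| <= N * (11 / 10) ->
  let D := N ^+ 2 - p ^+ 2 + q ^+ 2 in
  0 < D /\ (1 + s / (9 * N ^+ 2)) * (D ^+ 2 + (2 * p * q) ^+ 2) <=
    (D + s) ^+ 2 + (2 * p * q) ^+ 2.
Proof.
move=> N0 s0 hp hq D.
have N20 : 0 < N ^+ 2 by rewrite exprn_gt0.
have p2 : p ^+ 2 <= N ^+ 2 / 100.
  rewrite -real_normK ?num_real //; have := normr_ge0 p.
  have -> : N ^+ 2 / 100 = (N / 10) ^+ 2 by field.
  by move=> ?; rewrite lerXn2r ?nnegrE // divr_ge0 // ltW.
have q2 : q ^+ 2 <= N ^+ 2 * (121 / 100).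
  rewrite -real_normK ?num_real //; have := normr_ge0 q.
  have -> : N ^+ 2 * (121 / 100) = (N * (11 / 10)) ^+ 2 by field.
  by move=> ?; rewrite lerXn2r ?nnegrE // mulr_ge0 // ltW.
have p20 := sqr_ge0 p; have q20 := sqr_ge0 q.
have D1 : N ^+ 2 * (99 / 100) <= D by rewrite /D; lra.
split; first lra.
have -> : (D + s) ^+ 2 + (2 * p * q) ^+ 2 =
  (D ^+ 2 + (2 * p * q) ^+ 2) + 2 * s * D + s ^+ 2 by ring.
rewrite [leLHS]mulrDl mul1r -[leRHS]addrA lerD2l.
have s20 := sqr_ge0 s.
apply: le_trans (_ : 2 * s * D <= _); last by rewrite lerDl.
rewrite mulrAC ler_pdivrMr ?mulr_gt0 // [X in X <= _]mulrC.
have : D ^+ 2 + (2 * p * q) ^+ 2 <= 2 * D * (9 * N ^+ 2).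
  have -> : (2 * p * q) ^+ 2 = 4 * (p ^+ 2 * q ^+ 2) by ring.
  have : p ^+ 2 * q ^+ 2 <= N ^+ 2 / 100 * (N ^+ 2 * (121 / 100)) by rewrite ler_pM.
  have D2 : D <= N ^+ 2 * (221 / 100) by rewrite /D; lra.
  move: D1 D2; move: (N ^+ 2) N20 (p ^+ 2 * q ^+ 2) => M M0 W D1 D2 hW.
  nra.
by move=> hD; have := ler_wpM2l s0 hD; lra.
Qed.

(** The hypothesis is the gain 1 + t of [box_factor] with N = h n and s = m h^2. Here m t = m^2 / (9
    n^2) >= 4/9, as m = 2n + 1, so by Bernoulli m factors gain 13/9 whatever the mesh. *)
Lemma box_row_lower (F G : 'I_m -> C) :
  (forall i, F i != 0) ->
  (forall i, (1 + m%:R * h ^+ 2 / (9 * (h * n%:R) ^+ 2)) * normc (F i) ^+ 2 <=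
    normc (G i) ^+ 2) ->
  \prod_(i < m) F i != 0 /\
  13 / 9 * normc (\prod_(i < m) F i) ^+ 2 <= normc (\prod_(i < m) G i) ^+ 2.
Proof.
move=> F0 FG; split.
  by rewrite prodf_seq_neq0; apply/allP => u _; rewrite F0.
have nR : 0 < n%:R :> R by rewrite ltr0n.
set t := m%:R * h ^+ 2 / (9 * (h * n%:R) ^+ 2) in FG.
have t0 : 0 <= t.
  by apply: divr_ge0; apply: mulr_ge0; rewrite ?sqr_ge0.
rewrite !normc_prod -!prodrXl.
apply: le_trans (_ : (1 + t) ^+ m * \prod_(i < m) normc (F i) ^+ 2 <= _).
  rewrite ler_wpM2r ?prodr_ge0 // => [i _|]; first exact: sqr_ge0.
  apply: le_trans (bernoulli_ge m t0).
  have -> : m%:R * t = m%:R ^+ 2 / (9 * n%:R ^+ 2).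
    by rewrite /t; field; rewrite !gt_eqF.
  have -> : m%:R = 2 * n%:R + 1 :> R by rewrite -natr1 -muln2 natrM mulrC.
  have : 4 / 9 <= (2 * n%:R + 1) ^+ 2 / (9 * n%:R ^+ 2) :> R.
    rewrite ler_pdivlMr ?mulr_gt0 ?exprn_gt0 //; nra.
  lra.
rewrite -{1}[m]card_ord -prodr_const -big_split /=; apply: ler_prod => i _.
by rewrite FG andbT mulr_ge0 ?sqr_ge0 // addr_ge0.
Qed.

Lemma node_coord (y : 'I_m) : `|y.+1%:R - n.+1%:R| <= n%:R :> R.
Proof.
case: y => y /=; rewrite ltnS -(ler_nat R) -muln2 natrM => hy.
have y0 : 0 <= y%:R :> R by [].
by rewrite -!natr1 ler_norml; apply/andP; split; lra.
Qed.

(** A node and its mirror image multiply to a difference of squares. The sides lie at distance h n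
    for the layer and h (n + 1) for the ring, and (n + 1)^2 - n^2 = m is the source of m h^2. *)
Lemma row_eval (x y : R) (j : nat) :
  let q := y - h * (j.+1%:R - n.+1%:R) in
  let D := (h * n%:R) ^+ 2 - x ^+ 2 + q ^+ 2 in
  (lin 1 j.+1 * lin m j.+1).[x +i* y] = (- D) +i* (2 * x * q) /\
  (lin 0 j.+1 * lin m.+1 j.+1).[x +i* y] =
    (- (D + m%:R * h ^+ 2)) +i* (2 * x * q).
Proof.
rewrite /lin !hornerM !hornerXsubC /node !subcE !mulcE -![_.+1%:R]natr1 -muln2 natrM.
by split; congr (_ +i* _); ring.
Qed.

Lemma col_eval (x y : R) (j : nat) :
  let q := x - h * (j.+1%:R - n.+1%:R) in
  let D := (h * n%:R) ^+ 2 - y ^+ 2 + q ^+ 2 in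
  (lin j.+1 1 * lin j.+1 m).[x +i* y] = D +i* (2 * y * q) /\
  (lin j.+1 0 * lin j.+1 m.+1).[x +i* y] = (D + m%:R * h ^+ 2) +i* (2 * y * q).
Proof.
rewrite /lin !hornerM !hornerXsubC /node !subcE !mulcE -![_.+1%:R]natr1 -muln2 natrM.
by split; congr (_ +i* _); ring.
Qed.

Lemma box_lower z : normc z <= h * n%:R / 10 ->
  boxD.[z] != 0 /\ 13 / 9 * normc boxD.[z] <= normc boxN.[z].
Proof.
move=> hz; have nR : 0 < n%:R :> R by rewrite ltr0n.
pose N := h * n%:R.
have N0 : 0 < N by rewrite mulr_gt0.
have s0 : 0 <= m%:R * h ^+ 2 by rewrite mulr_ge0 ?sqr_ge0.
case: z hz => x y hz.
have hx : `|x| <= N / 10 by exact: le_trans (normc_Re_le (x +i* y)) hz.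
have hy : `|y| <= N / 10 by exact: le_trans (normc_Im_le (x +i* y)) hz.
have q_bound (t : R) (i : 'I_m) : `|t| <= N / 10 ->
    `|t - h * (i.+1%:R - n.+1%:R)| <= N * (11 / 10).
  move=> ht; have hi : `|h * (i.+1%:R - n.+1%:R)| <= N.
    by rewrite normrM gtr0_norm // ler_pM2l // node_coord.
  have := ler_normB t (h * (i.+1%:R - n.+1%:R)); lra.
have mE : m%:R = 2 * n%:R + 1 :> R by rewrite -natr1 -muln2 natrM mulrC.
have row (i : 'I_m) : ((lin 1 i.+1 * lin m i.+1).[x +i* y] != 0) /\
    (1 + m%:R * h ^+ 2 / (9 * (h * n%:R) ^+ 2)) *
      normc (lin 1 i.+1 * lin m i.+1).[x +i* y] ^+ 2 <=
    normc (lin 0 i.+1 * lin m.+1 i.+1).[x +i* y] ^+ 2.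
  have [D0 hD] := box_factor N0 s0 hx (q_bound y i hy).
  set q := y - _ in D0 hD.
  have [e1 e2] := row_eval x y i.
  rewrite e1 e2 !sqr_normcE !sqrrN; split => //.
  by rewrite eq_complex /= oppr_eq0 gt_eqF.
have col (i : 'I_m) : ((lin i.+1 1 * lin i.+1 m).[x +i* y] != 0) /\
    (1 + m%:R * h ^+ 2 / (9 * (h * n%:R) ^+ 2)) *
      normc (lin i.+1 1 * lin i.+1 m).[x +i* y] ^+ 2 <=
    normc (lin i.+1 0 * lin i.+1 m.+1).[x +i* y] ^+ 2.
  have [D0 hD] := box_factor N0 s0 hy (q_bound x i hx).
  set q := x - _ in D0 hD.
  have [e1 e2] := col_eval x y i.
  rewrite e1 e2 !sqr_normcE; split => //.
  by rewrite eq_complex /= gt_eqF.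
have [r0 hr] := box_row_lower (fun i => (row i).1) (fun i => (row i).2).
have [c0 hc] := box_row_lower (fun i => (col i).1) (fun i => (col i).2).
rewrite /boxD /boxN !hornerM !horner_prod mulf_neq0 //; split => //.
(* Rows and columns each contribute 13/9 to the squared modulus, hence together 13/9 to the
   modulus. *)
rewrite -(@ler_pXn2r _ 2) // ?nnegrE ?mulr_ge0 ?normc_ge0 //.
rewrite !normcM !exprMn.
apply: le_trans (ler_pM _ _ hr hc); last 2 first.
- by rewrite mulr_ge0 ?sqr_ge0.
- by rewrite mulr_ge0 ?sqr_ge0.
rewrite le_eqVlt; apply/orP; left; apply/eqP.
by move: (normc _) (normc _) => a b; ring.
Qed.

End LatticeProducts.

(** * Separating fractions *)

Lemma reduce_fraction (F : fieldType) (p q : {poly F}) : q != 0 ->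
  exists P Q g : {poly F}, [/\ coprimep P Q, g != 0, p = P * g & q = Q * g].
Proof.
move=> q0; exists (p %/ gcdp p q), (q %/ gcdp p q), (gcdp p q); split.
- by apply: coprimep_div_gcd; rewrite q0 orbT.
- by rewrite gcdp_eq0 negb_and q0 orbT.
- by rewrite divpK // dvdp_gcdl.
- by rewrite divpK // dvdp_gcdr.
Qed.

(** Here A / B is the product over the cells left out and N / D the telescoped full box, so |P / Q|
    = |N / D| / |A / B| >= (13/9) / (11/10) = 130/99 > 13/10. The common factor g is cancelled
    before evaluation, since it may vanish at z. *)
Lemma reduced_lower (R : realType) (P Q g A B D N : {poly R[i]}) (z : R[i]) :
  g != 0 -> P * g * A * D = Q * g * B * N -> B.[z] != 0 ->
  normc A.[z] <= (1 + 1 / 10) * normc B.[z] -> D.[z] != 0 ->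
  13 / 9 * normc D.[z] <= normc N.[z] ->
  13 / 10 * normc Q.[z] <= normc P.[z].
Proof.
move=> g0 E.
have aux (u v w : {poly R[i]}) : u * v * w * g = u * g * v * w by ring.
have {g0}E : P * A * D = Q * B * N by apply: (mulIf g0); rewrite !aux.
have : normc P.[z] * normc A.[z] * normc D.[z] =
    normc Q.[z] * normc B.[z] * normc N.[z].
  by rewrite -!normcM -!hornerM E.
rewrite -!normc_gt0 => {}E.
have := normc_ge0 P.[z]; have := normc_ge0 Q.[z]; move: E.
move: (normc P.[z]) (normc Q.[z]) (normc A.[z]) (normc B.[z]) (normc D.[z]) (normc N.[z]).
move=> {aux P Q g A B D N z} a b p q D N E b0 a0 q0 hpq D0 hDN.
have h1 : b * q * (13 / 9 * D) <= b * q * N by rewrite ler_wpM2l // mulr_ge0 // ltW.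
have h2 : a * p * D <= a * ((1 + 1 / 10) * q) * D.
  by rewrite ler_pM2r // ler_wpM2l.
have h3 : b * (13 / 9) * (q * D) <= a * (11 / 10) * (q * D) by lra.
rewrite ler_pM2r ?mulr_gt0 // in h3; lra.
Qed.

Lemma reduced_upper (R : realType) (P Q g : {poly R[i]}) (z : R[i]) :
  (Q * g).[z] != 0 -> normc (P * g).[z] <= (1 + 1 / 10) * normc (Q * g).[z] ->
  normc P.[z] <= 11 / 10 * normc Q.[z].
Proof.
rewrite !hornerM !normcM mulf_eq0 negb_or => /andP[_].
rewrite -normc_gt0 => gz; rewrite mulrA ler_pM2r //.
by have -> : 1 + 1 / 10 = 11 / 10 :> R by field.
Qed.

Lemma fine_mesh (R : realType) (x : R) : 0 <= x ->
  exists2 n, (0 < n)%N & (n.*2.+1 * n.*2.+1)%:R * (x / n%:R) ^+ 4 <= (1 / 10) / 2 :> R.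
Proof.
move=> x0; have X0 : 0 <= x ^+ 4 by rewrite exprn_ge0.
have c0 : 0 <= 180 * x ^+ 4 by apply: mulr_ge0.
(* Since (2n + 1)^2 <= 9 n^2, the quantity is at most 9 x^4 / n^2, and it has to be at most 1/20:
   this gives 180. *)
have [n hn] : exists n, 180 * x ^+ 4 < n%:R.
  by exists (Num.bound (180 * x ^+ 4)); exact: archi_boundP.
have n0 : 0 < n%:R :> R by apply: le_lt_trans hn.
exists n; first by rewrite -(ltr_nat R).
have n1 : 1 <= n%:R :> R by rewrite ler1n -(ltr_nat R).
have -> : (n.*2.+1 * n.*2.+1)%:R = (2 * n%:R + 1) ^+ 2 :> R.
  by rewrite natrM -natr1 -muln2 natrM; ring.
rewrite expr_div_n mulrA ler_pdivrMr ?exprn_gt0 //.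
move: (x ^+ 4) (n%:R : R) n0 n1 hn X0 => X N n0 n1 hn X0 {c0}.
have h9 : (2 * N + 1) ^+ 2 <= 9 * N ^+ 2 by nra.
apply: le_trans (_ : 9 * N ^+ 2 * X <= _); first by rewrite ler_wpM2r.
have N20 : 0 < N ^+ 2 by rewrite exprn_gt0.
have : X * 180 < N ^+ 2 by nra.
have -> : N ^+ 4 = N ^+ 2 * N ^+ 2 by ring.
by move: (N ^+ 2) N20 => Y Y0 hY; nra.
Qed.

Lemma separating_fraction (R : realType) (K : set R[i]) (M r : R) :
  0 < M -> 0 < r -> (forall k, K k -> normc k <= M) ->
  exists P Q : {poly R[i]}, [/\ coprimep P Q,
    forall z, K z -> 13 / 10 * normc Q.[z] <= normc P.[z] &
    forall z, (forall k, K k -> 2 * r <= normc (z - k)) ->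
      normc P.[z] <= 11 / 10 * normc Q.[z]].
Proof.
move=> M0 r0 KM.
have M10 : 0 < 10 * M by rewrite mulr_gt0.
have [n n0 hn] := fine_mesh (ltW (divr_gt0 M10 r0)).
have nR : 0 < n%:R :> R by rewrite ltr0n.
(* The box has half-width 10 M, so that K lies in the central tenth where [box_lower] applies. *)
pose h := 10 * M / n%:R.
have h0 : 0 < h by rewrite divr_gt0.
have hnE : h * n%:R = 10 * M by rewrite /h mulfVK // gt_eqF.
rewrite mulrAC -/h in hn.
(* With this threshold, points of K are at distance at least r from the centres outside S, and
   points at distance at least 2r from K are at distance at least r from those in S; [far_bound]
   serves both times. *)
pose S : {set 'I_(n.*2.+1) * 'I_(n.*2.+1)} :=
  [set u | `[< exists2 k, K k & normc (cell_center h u - k) < r >]]%SET.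
have e01 : 0 < (1 / 10 : R) < 1 by apply/andP; split; lra.
have QS0 : prodQ h S != 0.
  apply/prodf_neq0 => u _; rewrite /cellQ mulf_neq0 // expf_neq0 // polyXsubC_eq0 //.
have [P [Q [g [cPQ g0 PE QE]]]] := reduce_fraction (prodP h S) QS0.
exists P, Q; split => //.
- move=> z Kz.
  have far u : u \in (~: S)%SET -> r <= normc (z - cell_center h u).
    rewrite finset.in_setC finset.in_set => /asboolPn hu.
    rewrite leNgt; apply/negP => hlt; apply: hu.
    by exists z => //; rewrite normcBC.
  have [Qz hPQ] := far_bound h0 r0 e01 far hn.
  have hz : normc z <= h * n%:R / 10 by have := KM z Kz; rewrite hnE; lra.
  have [Dz hDN] := box_lower h0 n0 hz.
  apply: (reduced_lower g0 _ Qz hPQ Dz hDN); rewrite -PE -QE.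
  have := box_telescope h n.
  have -> : prodP h [set: 'I_n.*2.+1 * 'I_n.*2.+1]%SET =
      prodP h S * prodP h (~: S)%SET :> {poly R[i]}.
    rewrite /prodP (bigID (mem S)) /=; congr (_ * _); apply: eq_bigl => u;
      by rewrite !inE.
  have -> // : prodQ h [set: 'I_n.*2.+1 * 'I_n.*2.+1]%SET =
      prodQ h S * prodQ h (~: S)%SET :> {poly R[i]}.
    rewrite /prodQ (bigID (mem S)) /=; congr (_ * _); apply: eq_bigl => u;
      by rewrite !inE.
- move=> z hz.
  have far u : u \in S -> r <= normc (z - cell_center h u).
    rewrite finset.in_set => /asboolP[k Kk hk].
    have := hz k Kk; have := normcBt (cell_center h u) z k; lra.
  have [] := far_bound h0 r0 e01 far hn.
  by rewrite PE QE; exact: reduced_upper.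
Qed.

Lemma interval_avoid_seq (R : realType) (a b : R) (s : seq R) : a < b ->
  exists2 x, a < x < b & x \notin s.
Proof.
move=> ab; pose f (k : nat) := a + (b - a) / (k.+2)%:R.
have fab k : a < f k < b.
  rewrite /f ltrDl divr_gt0 ?subr_gt0 // -ltrBrDl.
  by rewrite ltr_pdivrMr // ltr_pMr ?subr_gt0 // ltr1n.
have finj : injective f.
  move=> k l /addrI /(mulfI (lt0r_neq0 _)); rewrite subr_gt0 => /(_ ab) /invr_inj.
  by move=> /eqP; rewrite eqr_nat => /eqP[].
have : ~~ all (mem s) [seq f k | k <- iota 0 (size s).+1].
  apply/negP => /allP hs.
  have := @uniq_leq_size _ [seq f k | k <- iota 0 (size s).+1] s.
  rewrite map_inj_uniq // iota_uniq size_map size_iota ltnn.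
  by move=> /(_ isT) /(_ (fun x hx => hs x hx)).
by move=> /allPn[x /mapP[k _ ->] hx]; exists (f k).
Qed.

Lemma deriv_eq0_size (R : numDomainType) (p : {poly R}) :
  p^`() = 0 -> (size p <= 1)%N.
Proof.
move=> p'0; apply/leq_sizeP => -[//|j] _.
have := congr1 (fun q : {poly R} => q`_j) p'0.
by rewrite coef_deriv coef0 => /eqP; rewrite mulrn_eq0 /= => /eqP.
Qed.

(** From P' Q = P Q' and coprimality, P divides P' and Q divides Q'; by degrees both derivatives
    vanish. *)
Lemma wronskian_eq0 (F : numClosedFieldType) (P Q : {poly F}) : coprimep P Q ->
  P^`() * Q - P * Q^`() = 0 -> (size P <= 1)%N /\ (size Q <= 1)%N.
Proof.
have dvd_deriv (p : {poly F}) : p %| p^`() -> (size p <= 1)%N.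
  move=> dp; apply: deriv_eq0_size; apply/eqP; apply: contraT => p'0.
  have := dvdp_leq p'0 dp; rewrite leqNgt lt_size_deriv //.
  by apply: contraNneq p'0 => ->; rewrite deriv0.
move=> cPQ /eqP; rewrite subr_eq0 => /eqP E; split; apply: dvd_deriv.
  by rewrite -(Gauss_dvdpl _ cPQ) E dvdp_mulr.
rewrite coprimep_sym in cPQ.
by rewrite -(Gauss_dvdpr _ cPQ) -E dvdp_mulIr.
Qed.

Lemma poly_roots_seq (F : closedFieldType) (p : {poly F}) : p != 0 ->
  exists s : seq F, forall x, root p x -> x \in s.
Proof.
move=> p0; have [s ps] := closed_field_poly_normal p.
exists s => x; rewrite ps rootE hornerZ mulf_eq0 lead_coef_eq0 (negbTE p0) /=.
by rewrite -rootE root_prod_XsubC.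
Qed.

Lemma regular_separating_fraction (R : realType) (K : set R[i]) (M r : R) :
  K !=set0 -> 0 < M -> 0 < r -> (forall k, K k -> normc k <= M) ->
  exists P Q : {poly R[i]}, exists rho : R, [/\ coprimep P Q, 0 < rho < 1,
    forall z, K z -> normc Q.[z] <= rho * normc P.[z],
    forall z, (forall k, K k -> 2 * r <= normc (z - k)) ->
      normc P.[z] <= rho * normc Q.[z] &
    forall z, normc P.[z] = normc Q.[z] -> (P^`() * Q - P * Q^`()).[z] != 0].
Proof.
move=> [k0 Kk0] M0 r0 KM.
have [P [Q [cPQ inK offK]]] := separating_fraction M0 r0 KM.
(* Constants P and Q would satisfy both the estimate at a point of K and the opposite one at a
   distant real point, hence both be 0. *)
have G0 : P^`() * Q - P * Q^`() != 0.
  apply/eqP => /(wronskian_eq0 cPQ) [/size1_polyC PE /size1_polyC QE].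
  have h1 := inK k0 Kk0.
  have h2 : normc P.[(2 * M + 2 * r)%:C] <= 11 / 10 * normc Q.[(2 * M + 2 * r)%:C].
    apply: offK => k /KM kM.
    have := normcB_ge (2 * M + 2 * r)%:C k; rewrite normc_real ger0_norm; lra.
  move: h1 h2; rewrite PE QE !hornerC.
  have := normc_ge0 P`_0; have := normc_ge0 Q`_0 => Q0 P0 h1 h2.
  have /eqP : normc P`_0 = 0 by lra.
  have /eqP : normc Q`_0 = 0 by lra.
  rewrite !normc_eq0 => /eqP Q00 /eqP P00.
  by move: cPQ; rewrite PE QE Q00 P00 polyC0 coprimep0 -size_poly_eq1 size_poly0.
have [s hs] := poly_roots_seq G0.
(* Any factor l in this interval keeps |l P| above |Q| on K and below it far from K. It remains to
   avoid the finitely many values |Q / P| at the zeros of the Wronskian. *)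
have lt1 : 10 / 13 < 10 / 11 :> R by lra.
have [l /andP[l1 l2] ls] :=
  interval_avoid_seq [seq normc Q.[x] / normc P.[x] | x <- s] lt1.
have l0 : 0 < l by lra.
have lP z : normc (l%:C *: P).[z] = l * normc P.[z].
  by rewrite hornerZ normcM normc_real gtr0_norm.
have [rho [rho0 rho1 hr1 hr2]] : exists rho, [/\ 0 < rho, rho < 1,
    10 / 13 <= rho * l & l * (11 / 10) <= rho].
  exists (Num.max (10 / (13 * l)) (l * (11 / 10))).
  rewrite lt_max gt_max !le_max; split.
  - by apply/orP; left; rewrite divr_gt0 // mulr_gt0.
  - by rewrite ltr_pdivrMr ?mulr_gt0 //; apply/andP; split; lra.
  - have : 10 / (13 * l) <= Num.max (10 / (13 * l)) (l * (11 / 10)).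
      by rewrite le_max lexx.
    rewrite -(ler_pM2r l0); apply: le_trans; rewrite le_eqVlt; apply/orP; left.
    by apply/eqP; field; rewrite gt_eqF.
  - by rewrite lexx orbT.
exists (l%:C *: P), Q, rho; split.
- by rewrite coprimepZl // -normc_gt0 normc_real gtr0_norm.
- by rewrite rho0.
- move=> z /inK h; rewrite lP.
  have P0 := normc_ge0 P.[z]; have Q0 := normc_ge0 Q.[z].
  have : 10 / 13 * normc P.[z] <= rho * l * normc P.[z] by rewrite ler_wpM2r.
  lra.
- move=> z /offK h; rewrite lP.
  have Q0 := normc_ge0 Q.[z].
  have : l * normc P.[z] <= l * (11 / 10 * normc Q.[z]) by rewrite ler_pM2l.
  have : l * (11 / 10) * normc Q.[z] <= rho * normc Q.[z] by rewrite ler_wpM2r.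
  lra.
- move=> z; rewrite lP => hPQ.
  have lC0 : l%:C != 0 by rewrite -normc_gt0 normc_real gtr0_norm.
  rewrite derivZ -!scalerAl -scalerBr hornerZ mulf_neq0 //.
  apply/negP => Gz; move: ls => /negP; apply; apply/mapP; exists z.
    by apply: hs; rewrite rootE.
  have Pz : normc P.[z] != 0.
    apply/negP => /eqP Pz; move: hPQ; rewrite Pz mulr0 => /esym/eqP.
    rewrite normc_eq0 => Qz.
    have := coprimep_root cPQ (x := z); rewrite rootE -normc_eq0 Pz eqxx.
    by move=> /(_ isT) /negP; apply.
  by rewrite -hPQ mulfK.
Qed.

(** * High powers of a separating fraction *)

Section Asymptotics.
Variable R : realType.
Implicit Types (P Q : {poly R[i]}) (rho e M : R) (a b z : R[i]).

(** With q the square root of rho, one factor q^N absorbs N by Bernoulli applied to 1/q, and the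
    other tends to 0. *)
Lemma natr_geometric_small rho e : 0 < rho < 1 -> 0 < e ->
  \forall N \near \oo, N%:R * rho ^+ N <= e.
Proof.
move=> /andP[rho0 rho1] e0; pose q := Num.sqrt rho.
have q0 : 0 < q by rewrite sqrtr_gt0.
have q1 : q < 1 by rewrite -sqrtr1 ltr_sqrt.
have qq : rho = q * q by rewrite -expr2 sqr_sqrtr // ltW.
have qV1 : 1 < q^-1 by rewrite invf_gt1.
pose t := q^-1 - 1; have t0 : 0 < t by rewrite subr_gt0.
have et0 : 0 < e * t by rewrite mulr_gt0.
have qn1 : `|q| < 1 by rewrite gtr0_norm.
have /cvgrPdist_le /(_ _ et0) := cvg_expr qn1.
apply: filterS => N; rewrite sub0r normrN ger0_norm ?exprn_ge0 ?(ltW q0) // => hN.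
have hB : N%:R * t <= q^-1 ^+ N.
  have tE : 1 + t = q^-1 by rewrite /t addrC subrK.
  have := bernoulli_ge N (ltW t0); rewrite tE => h.
  by apply: le_trans h; rewrite lerDr.
have qN0 : 0 < q ^+ N by rewrite exprn_gt0.
have h1 : N%:R * t * q ^+ N <= 1.
  by rewrite -[leRHS](mulVf (lt0r_neq0 qN0)) -exprVn ler_pM2r.
rewrite qq exprMn mulrA -(ler_pM2r t0).
have : N%:R * t * q ^+ N * q ^+ N <= 1 * q ^+ N by rewrite ler_pM2r.
by move=> h2; have := le_trans h2 (eq_ind_r (fun x => x <= _) hN (mul1r _)); lra.
Qed.

(** The usual Lipschitz constant n rho^(n - 1), multiplied by rho to avoid the predecessor in the
    exponent. *)
Lemma expr_lipschitz rho (x y : R[i]) n : 0 <= rho ->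
  normc x <= rho -> normc y <= rho ->
  rho * normc (x ^+ n - y ^+ n) <= n%:R * rho ^+ n * normc (x - y).
Proof.
move=> rho0 hx hy; elim: n => [|n IH].
  by rewrite !expr0 subrr normc0 mulr0 !mul0r.
have -> : x ^+ n.+1 - y ^+ n.+1 = x * (x ^+ n - y ^+ n) + (x - y) * y ^+ n.
  by rewrite !exprS; ring.
apply: le_trans (_ : rho * (rho * normc (x ^+ n - y ^+ n) + normc (x - y) * rho ^+ n) <= _).
  rewrite ler_wpM2l // (le_trans (normcD _ _)) // !normcM normcX lerD //.
    by rewrite ler_wpM2r ?normc_ge0.
  by rewrite ler_wpM2l ?normc_ge0 // lerXn2r ?nnegrE ?normc_ge0.
apply: le_trans (_ : rho * (n%:R * rho ^+ n * normc (x - y) + normc (x - y) * rho ^+ n) <= _).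
  by rewrite ler_wpM2l // lerD2r.
by rewrite -natr1 exprS le_eqVlt; apply/orP; left; apply/eqP; ring.
Qed.

(** By Bezout u P + v Q is a nonzero constant, so Q cannot be small where it dominates P. *)
Lemma coprime_lower P Q rho M : coprimep P Q -> 0 <= rho ->
  exists2 q0, 0 < q0 & forall z, normc z <= M ->
    normc P.[z] <= rho * normc Q.[z] -> q0 <= normc Q.[z].
Proof.
move=> /Bezout_coprimepP[[u v] /=]; rewrite -size_poly_eq1 => /size_poly1P[c c0 E] rho0.
have [B1 B10 h1] := poly_bound u M; have [B2 B20 h2] := poly_bound v M.
have D0 : 0 < B1 * rho + B2 + 1 by rewrite ltr_wpDl // addr_ge0 // mulr_ge0.
exists (normc c / (B1 * rho + B2 + 1)); first by rewrite divr_gt0 // normc_gt0.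
move=> z zM hz; rewrite ler_pdivrMr //.
have -> : c = u.[z] * P.[z] + v.[z] * Q.[z] by rewrite -!hornerM -hornerD E hornerC.
rewrite (le_trans (normcD _ _)) // !normcM.
have : normc u.[z] * normc P.[z] <= B1 * (rho * normc Q.[z]).
  by rewrite ler_pM ?normc_ge0 // h1.
have : normc v.[z] * normc Q.[z] <= B2 * normc Q.[z].
  by rewrite ler_wpM2r ?normc_ge0 // h2.
have := normc_ge0 Q.[z]; lra.
Qed.

Lemma coprime_nonzero P Q rho z : coprimep P Q ->
  normc P.[z] <= rho * normc Q.[z] -> Q.[z] != 0.
Proof.
move=> cPQ h; apply/negP => /eqP Qz; move: h; rewrite Qz normc0 mulr0 => h.
have /eqP : normc P.[z] = 0 by apply: le_anti; rewrite h normc_ge0.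
rewrite normc_eq0 -rootE => /(coprimep_root cPQ); rewrite Qz eqxx //.
Qed.

(** This is f^N / (1 + f^N) for f = P / Q, in a form that also makes sense at the poles of f.
    Swapping P and Q gives the complement to 1, so estimates for |f| < 1 transfer to |f| > 1. *)
Definition level_frac P Q N z : R[i] := P.[z] ^+ N / (P.[z] ^+ N + Q.[z] ^+ N).

Lemma level_fracE P Q N z : Q.[z] != 0 ->
  level_frac P Q N z = (P.[z] / Q.[z]) ^+ N / (1 + (P.[z] / Q.[z]) ^+ N).
Proof.
move=> Qz; have QN : Q.[z] ^+ N != 0 by rewrite expf_neq0.
rewrite /level_frac expr_div_n.
have -> : P.[z] ^+ N + Q.[z] ^+ N = Q.[z] ^+ N * (1 + P.[z] ^+ N / Q.[z] ^+ N).
  by rewrite mulrDr mulr1 addrC mulrCA mulfV // mulr1.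
by rewrite invfM mulrA.
Qed.

Lemma level_frac_sym P Q N z : P.[z] ^+ N + Q.[z] ^+ N != 0 ->
  level_frac Q P N z = 1 - level_frac P Q N z.
Proof.
by move=> E0; rewrite /level_frac [Q.[z] ^+ N + _]addrC; field.
Qed.

(** Where |f| <= rho the fraction has size about rho^N and Lipschitz constant about N rho^N, both
    tending to 0; [coprime_lower] makes f itself Lipschitz there. *)
Lemma small_frac P Q rho M e : coprimep P Q -> 0 < rho < 1 -> 0 < e ->
  \forall N \near \oo,
    (forall z, normc P.[z] <= rho * normc Q.[z] ->
      P.[z] ^+ N + Q.[z] ^+ N != 0 /\ normc (level_frac P Q N z) <= e) /\
    (forall a b, normc a <= M -> normc b <= M ->
      normc P.[a] <= rho * normc Q.[a] -> normc P.[b] <= rho * normc Q.[b] ->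
      normc (level_frac P Q N a - level_frac P Q N b) <= e * normc (a - b)).
Proof.
move=> cPQ /andP[rho0 rho1] e0.
have [q0 q00 hq] := coprime_lower M cPQ (ltW rho0).
have [L1 L10 hL1] := poly_lipschitz P M; have [L2 L20 hL2] := poly_lipschitz Q M.
pose L := (L1 + L2) / q0 + 1.
have L0 : 0 < L by rewrite ltr_wpDl // divr_ge0 ?addr_ge0 // ltW.
(* The bound 1/2 keeps the denominators at least 1/2 in modulus, e/2 then bounds the values, and the
   last term the Lipschitz constant, with 4 for the two denominators. *)
pose d := Num.min (1 / 2) (Num.min (e / 2) (e * rho / (4 * L))).
have d0 : 0 < d.
  by rewrite !lt_min; apply/and3P; split; rewrite ?divr_gt0 ?mulr_gt0.
have rho01 : 0 < rho < 1 by rewrite rho0.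
have hN1 : \forall N \near \oo, (1 <= N)%N by exact: nbhs_infty_ge.
near=> N.
have N1 : (1 <= N)%N by near: N.
have hN : N%:R * rho ^+ N <= d by near: N; exact: natr_geometric_small.
have rN0 : 0 < rho ^+ N by rewrite exprn_gt0.
have rNd : rho ^+ N <= d by apply: le_trans hN; rewrite ler_peMl ?ler1n // ltW.
have : d <= 1 / 2 /\ d <= e / 2 /\ d <= e * rho / (4 * L).
  by rewrite !ge_min !lexx /= !orbT.
move=> [d1 [d2]]; rewrite ler_pdivlMr ?mulr_gt0 // => d3.
have main z : normc P.[z] <= rho * normc Q.[z] ->
    [/\ Q.[z] != 0, normc (P.[z] / Q.[z]) <= rho,
      1 / 2 <= normc (1 + (P.[z] / Q.[z]) ^+ N) &
      0 < normc (1 + (P.[z] / Q.[z]) ^+ N)].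
  move=> hz; have Qz := coprime_nonzero cPQ hz.
  have fr : normc (P.[z] / Q.[z]) <= rho.
    by rewrite normcf_div ler_pdivrMr // normc_gt0.
  have h12 : 1 / 2 <= normc (1 + (P.[z] / Q.[z]) ^+ N).
    have := normcB_ge 1 (- (P.[z] / Q.[z]) ^+ N).
    rewrite opprK normcNn normc1 normcX.
    have : normc (P.[z] / Q.[z]) ^+ N <= rho ^+ N.
      by rewrite lerXn2r ?nnegrE ?normc_ge0 // ltW.
    by move: rNd d1; clear; lra.
  by split => //; apply: lt_le_trans h12; rewrite divr_gt0.
split.
  move=> z hz; have [Qz fr h12 n1] := main z hz.
  have E0 : 1 + (P.[z] / Q.[z]) ^+ N != 0 by rewrite -normc_gt0.
  split.
    have -> : P.[z] ^+ N + Q.[z] ^+ N = Q.[z] ^+ N * (1 + (P.[z] / Q.[z]) ^+ N).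
      by rewrite expr_div_n mulrDr mulr1 addrC mulrCA mulfV ?mulr1 // expf_neq0.
    by rewrite mulf_neq0 // expf_neq0.
  rewrite level_fracE // normcf_div ler_pdivrMr //.
  rewrite normcX; apply: le_trans (_ : rho ^+ N <= _).
    by rewrite lerXn2r ?nnegrE ?normc_ge0 // ltW.
  have : e * (1 / 2) <= e * normc (1 + (P.[z] / Q.[z]) ^+ N) by rewrite ler_pM2l.
  by move: rNd d2; clear; lra.
move=> a b aM bM ha hb.
have [Qa fa ha2 na] := main a ha; have [Qb fb hb2 nb] := main b hb.
rewrite !level_fracE //.
set f := P.[a] / Q.[a] in fa ha2 na *; set g := P.[b] / Q.[b] in fb hb2 nb *.
have f0 : 1 + f ^+ N != 0 by rewrite -normc_gt0.
have g0 : 1 + g ^+ N != 0 by rewrite -normc_gt0.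
have -> : f ^+ N / (1 + f ^+ N) - g ^+ N / (1 + g ^+ N) =
  (f ^+ N - g ^+ N) / ((1 + f ^+ N) * (1 + g ^+ N)).
  by field; rewrite f0 g0.
have fg : normc (f - g) <= L * normc (a - b).
  have -> : f - g = (P.[a] - P.[b]) / Q.[a] - g * ((Q.[a] - Q.[b]) / Q.[a]).
    by rewrite /f /g; field; rewrite Qa Qb.
  have qa := hq a aM ha.
  have Qa0 : 0 < normc Q.[a] by rewrite normc_gt0.
  have n0 := normc_ge0 (a - b).
  have V : (normc Q.[a])^-1 <= q0^-1 by rewrite lef_pV2.
  have k1 : normc ((P.[a] - P.[b]) / Q.[a]) <= L1 / q0 * normc (a - b).
    rewrite normcf_div [leRHS]mulrAC; apply: ler_pM => //.
    - exact: normc_ge0.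
    - by rewrite invr_ge0 normc_ge0.
    - exact: hL1.
  have k2' : normc ((Q.[a] - Q.[b]) / Q.[a]) <= L2 / q0 * normc (a - b).
    rewrite normcf_div [leRHS]mulrAC; apply: ler_pM => //.
    - exact: normc_ge0.
    - by rewrite invr_ge0 normc_ge0.
    - exact: hL2.
  have k2 : normc (g * ((Q.[a] - Q.[b]) / Q.[a])) <= L2 / q0 * normc (a - b).
    rewrite normcM; apply: le_trans k2'; rewrite ler_piMl ?normc_ge0 //.
    by apply: le_trans fb _; exact: ltW.
  rewrite (le_trans (normcD _ _)) // normcNn /L; move: k1 k2 n0; clear; lra.
rewrite normcf_div normcM ler_pdivrMr; last exact: mulr_gt0.
have n0 := normc_ge0 (a - b).
have := expr_lipschitz N (ltW rho0) fa fb.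
set X := normc (f ^+ N - g ^+ N) => hX.
have X0 : 0 <= X by exact: normc_ge0.
have h1 : rho * X <= d * (L * normc (a - b)).
  apply: le_trans hX _; rewrite ler_pM ?normc_ge0 //.
  by rewrite mulr_ge0 // ltW.
have h2 : d * (L * normc (a - b)) <= e * rho / 4 * normc (a - b).
  by rewrite mulrA ler_wpM2r //; move: d3; clear; lra.
have h3 : X <= e / 4 * normc (a - b).
  by rewrite -(ler_pM2l rho0); move: h1 h2; clear; lra.
apply: le_trans h3 _.
have h4 : 1 / 4 <= normc (1 + f ^+ N) * normc (1 + g ^+ N).
  have -> : 1 / 4 = (1 / 2) * (1 / 2) :> R by field.
  by rewrite ler_pM // divr_ge0.
have : e * normc (a - b) * (1 / 4) <=
   e * normc (a - b) * (normc (1 + f ^+ N) * normc (1 + g ^+ N)).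
  by rewrite ler_wpM2l // mulr_ge0 // ltW.
by move: h4 => _; clear; lra.
Unshelve. all: by end_near. Qed.

(** Compactness as a Lebesgue number: what holds locally for all small parameters holds on a whole
    disk for a single one. It serves here for level curves, fixed points, the expansion radius and
    the cores. *)
Lemma planar_near_covering M (Pr : R -> R[i] -> Prop) :
  (forall z, exists2 r, 0 < r & forall w t, normc (w - z) < r -> 0 < t < r -> Pr t w) ->
  exists2 t, 0 < t & forall z, normc z <= M -> Pr t z.
Proof.
move=> h.
pose D := @sphere_of_pair R @` (`[- M, M] `*` `[- M, M]).
have Dc : compact D.
  apply: continuous_compact; last by apply: compact_setX; exact: segment_compact.
  by apply: continuous_subspaceT => ?; exact: sphere_of_pair_continuous.
move/compact_near_coveringP: Dc.
move=> /(_ R 0^'+ (fun t w => if w is Some z then Pr t z else True) _).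
case.
- move=> [z|] [u _] // _.
  have [r r0 hr] := h z.
  exists ([set w | if w is Some b then normc (b - z) < r else False],
      [set t | 0 < t < r]).
    split; first by apply/nbhs_finiteP; exists r.
    by near=> t; apply/andP; split; near: t;
      [exact: nbhs_right_gt | exact: nbhs_right_lt].
  by case=> -[b|] t [] //= hb ht; exact: hr.
- move=> r /= r0 hr; have r20 : 0 < r / 2 by rewrite divr_gt0.
  exists (r / 2) => // z zM.
  have := hr (r / 2); rewrite /= sub0r normrN gtr0_norm // => /(_ _ r20 (Some z)); apply.
    by rewrite ltr_pdivrMr // ltr_pMr // ltr1n.
  exists (complex.Re z, complex.Im z); last by case: z {zM}.
  by split; rewrite /= in_itv /= -ler_norml (le_trans _ zM) //
    ?normc_Re_le ?normc_Im_le.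
Unshelve. all: by end_near. Qed.

(** The Wronskian over P Q is the logarithmic derivative of f = P / Q. Near a point with |f|
    different from 1 the claim is vacuous for small t; near the level curve it follows from
    continuity of the Wronskian. *)
Lemma near_level P Q M : coprimep P Q ->
  (forall z, normc P.[z] = normc Q.[z] -> (P^`() * Q - P * Q^`()).[z] != 0) ->
  exists2 t, 0 < t & forall z, normc z <= M ->
    normc Q.[z] <= (1 + t) * normc P.[z] -> normc P.[z] <= (1 + t) * normc Q.[z] ->
    t * (normc P.[z] * normc Q.[z]) <= normc (P^`() * Q - P * Q^`()).[z].
Proof.
move=> cPQ reg; apply: (@planar_near_covering M (fun t z =>
  normc Q.[z] <= (1 + t) * normc P.[z] -> normc P.[z] <= (1 + t) * normc Q.[z] ->
    t * (normc P.[z] * normc Q.[z]) <= normc (P^`() * Q - P * Q^`()).[z])) => z.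
have vac (A B : {poly R[i]}) : normc A.[z] < normc B.[z] ->
    exists2 r, 0 < r & forall w t, normc (w - z) < r -> 0 < t < r ->
      (1 + t) * normc A.[w] < normc B.[w].
  move=> AB; pose d := (normc B.[z] - normc A.[z]) / 4.
  have d0 : 0 < d by rewrite divr_gt0 // subr_gt0.
  have A0 := normc_ge0 A.[z].
  have [r1 r10 h1] := poly_cont A z d0; have [r2 r20 h2] := poly_cont B z d0.
  have s0 : 0 < normc A.[z] + d by lra.
  exists (Num.min (Num.min r1 r2) (2 * d / (normc A.[z] + d))).
    by rewrite !lt_min r10 r20 divr_gt0 // mulr_gt0.
  move=> w t; rewrite !lt_min !ltr_pdivlMr // => /andP[/andP[w1 w2] _] /andP[t0 /andP[_ t1]].
  have k1 : normc A.[w] < normc A.[z] + d.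
    by have := normcB_ge A.[w] A.[z]; have := h1 w w1; lra.
  have k2 : normc B.[z] - d < normc B.[w].
    by have := normcB_ge B.[z] B.[w]; have := h2 w w2; rewrite normcBC; lra.
  have : (1 + t) * normc A.[w] < (1 + t) * (normc A.[z] + d).
    by rewrite ltr_pM2l //; lra.
  by rewrite /d in k1 k2 t1 *; lra.
have [lt|gt|eq] := ltgtP (normc P.[z]) (normc Q.[z]).
- have [r r0 hr] := vac P Q lt; exists r => // w t hw ht.
  by have := hr w t hw ht => h1 h2; lra.
- have [r r0 hr] := vac Q P gt; exists r => // w t hw ht.
  by have := hr w t hw ht => h1 h2 h3; lra.
- have := reg z eq; set G := P^`() * Q - P * Q^`(); rewrite -normc_gt0 => G0.
  have g20 : 0 < normc G.[z] / 2 by rewrite divr_gt0.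
  have [r1 r10 h1] := poly_cont P z ltr01; have [r2 r20 h2] := poly_cont Q z ltr01.
  have [r3 r30 h3] := poly_cont G z g20.
  have P0 := normc_ge0 P.[z].
  set a := normc P.[z] + 1; have a0 : 0 < a by rewrite /a; lra.
  exists (Num.min (Num.min r1 r2) (Num.min r3 (normc G.[z] / 2 / a ^+ 2))).
    by rewrite !lt_min r10 r20 r30 divr_gt0 // exprn_gt0.
  move=> w t; rewrite !lt_min !ltr_pdivlMr ?exprn_gt0 //.
  move=> /andP[/andP[w1 w2] /andP[w3 _]] /andP[t0 /andP[_ /andP[_ t1]]] _ _.
  have k1 : normc P.[w] <= a.
    by have := normcB_ge P.[w] P.[z]; have := h1 w w1; rewrite /a; lra.
  have k2 : normc Q.[w] <= a.
    by have := normcB_ge Q.[w] Q.[z]; have := h2 w w2; rewrite /a eq; lra.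
  have k3 : normc G.[z] / 2 <= normc G.[w].
    by have := normcB_ge G.[z] G.[w]; have := h3 w w3; rewrite normcBC; lra.
  have k4 : t * (normc P.[w] * normc Q.[w]) <= t * a ^+ 2.
    by rewrite ler_pM2l // expr2 ler_pM ?normc_ge0.
  lra.
Qed.

(** The logistic equation s' = N s (1 - s) f'/f, with 1 - s written as the swapped fraction. *)
Lemma level_frac_deriv P Q N z : (1 <= N)%N -> P.[z] != 0 -> Q.[z] != 0 ->
  P.[z] ^+ N + Q.[z] ^+ N != 0 ->
  strict_deriv (level_frac P Q N) z
    (N%:R * level_frac P Q N z * level_frac Q P N z *
      ((P^`() * Q - P * Q^`()).[z] / (P.[z] * Q.[z]))).
Proof.
case: N => // N _ Pz Qz E0.
have hE : (P ^+ N.+1 + Q ^+ N.+1).[z] != 0 by rewrite hornerD !horner_exp.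
have := strict_deriv_ratio (P ^+ N.+1) hE.
have -> : (fun a => (P ^+ N.+1).[a] / (P ^+ N.+1 + Q ^+ N.+1).[a]) =
    level_frac P Q N.+1.
  by apply/funext => a; rewrite /level_frac hornerD !horner_exp.
set D1 := (X in strict_deriv _ _ X); set D2 := (X in _ -> strict_deriv _ _ X).
suff -> : D1 = D2 by [].
rewrite /D1 /D2 /level_frac.
rewrite derivD !deriv_exp !hornerD !hornerN !hornerMn !hornerM !horner_exp /=.
rewrite [Q.[z] ^+ N.+1 + P.[z] ^+ N.+1]addrC -![(_ * _) *+ N.+1]mulr_natl.
rewrite (_ : P.[z] ^+ N = P.[z] ^+ N.+1 / P.[z]); last by rewrite exprS mulrAC divff ?mul1r.
rewrite (_ : Q.[z] ^+ N = Q.[z] ^+ N.+1 / Q.[z]); last by rewrite exprS mulrAC divff ?mul1r.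
move: E0; move: (P.[z] ^+ N.+1) (Q.[z] ^+ N.+1) => X Y E0.
by field; rewrite Pz Qz E0.
Qed.

(** The N-th root of a constant tends to 1: by Bernoulli (1 + t)^N exceeds c. *)
Lemma root_ratio_bound (c t : R) : 0 < t -> \forall N \near \oo,
  forall x y : R, 0 <= x -> 0 <= y -> x ^+ N <= c * y ^+ N -> x <= (1 + t) * y.
Proof.
move=> t0.
near=> N => x y x0 y0 h.
rewrite leNgt; apply/negP => hlt.
have N1 : (1 <= N)%N by near: N; exact: nbhs_infty_ge.
have hc : c < (1 + t) ^+ N.
  apply: lt_le_trans (bernoulli_ge N (ltW t0)).
  have : c / t < N%:R.
    near: N; have [k hk] : exists k : nat, c / t < k%:R.
      exists (Num.bound `|c / t|); apply: le_lt_trans (ler_norm _) _.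
      exact: archi_boundP.
    by apply: filterS (nbhs_infty_ge k) => n kn; apply: lt_le_trans hk _; rewrite ler_nat.
  by rewrite ltr_pdivrMr // => ?; rewrite ltr_wpDl.
have yt : 0 <= (1 + t) * y by rewrite mulr_ge0 // addr_ge0 // ltW.
have : ((1 + t) * y) ^+ N < x ^+ N by rewrite ltrXn2r ?nnegrE // -lt0n.
rewrite exprMn => h2.
have : c * y ^+ N <= (1 + t) ^+ N * y ^+ N by rewrite ler_wpM2r ?exprn_ge0 // ltW.
lra.
Unshelve. all: by end_near. Qed.

(** If s and 1 - s both have modulus at least k, then |P|^N and |Q|^N agree up to the factor 1 +
    1/k, so |f| is within 1 + t of 1 for large N. There |s'| >= N k^2 t, which is unbounded in N. *)
Lemma level_frac_expanding P Q M k B : coprimep P Q ->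
  (forall z, normc P.[z] = normc Q.[z] -> (P^`() * Q - P * Q^`()).[z] != 0) ->
  0 < k ->
  \forall N \near \oo, forall z, normc z <= M -> P.[z] ^+ N + Q.[z] ^+ N != 0 ->
    k <= normc (level_frac P Q N z) -> k <= normc (level_frac Q P N z) ->
    exists2 D, strict_deriv (level_frac P Q N) z D & B <= normc D.
Proof.
move=> cPQ reg k0; have [t t0 ht] := near_level M cPQ reg.
near=> N => z zM E0 hP hQ.
have N1 : (1 <= N)%N by near: N; exact: nbhs_infty_ge.
have E0' : 0 < normc (P.[z] ^+ N + Q.[z] ^+ N) by rewrite normc_gt0.
have sum_le : normc (P.[z] ^+ N + Q.[z] ^+ N) <= normc P.[z] ^+ N + normc Q.[z] ^+ N.
  by rewrite -!normcX normcD.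
have hP' : k * normc (P.[z] ^+ N + Q.[z] ^+ N) <= normc P.[z] ^+ N.
  by move: hP; rewrite /level_frac normcf_div normcX ler_pdivlMr.
have hQ' : k * normc (P.[z] ^+ N + Q.[z] ^+ N) <= normc Q.[z] ^+ N.
  by move: hQ; rewrite /level_frac [_ + P.[z] ^+ N]addrC normcf_div normcX ler_pdivlMr.
have ratio (x y E : R) : 0 <= x -> 0 <= y -> k * E <= y -> x <= y + E ->
    x <= (1 + k^-1) * y.
  move=> x0 y0 h1 h2; have : E <= k^-1 * y.
    by rewrite -(ler_pM2l k0) mulrA mulfV ?mul1r // gt_eqF.
  lra.
have x0 := exprn_ge0 N (normc_ge0 P.[z]); have y0 := exprn_ge0 N (normc_ge0 Q.[z]).
have subPQ : normc P.[z] ^+ N <= normc Q.[z] ^+ N + normc (P.[z] ^+ N + Q.[z] ^+ N).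
  have := normcB_ge (P.[z] ^+ N) (- Q.[z] ^+ N).
  by rewrite opprK normcNn !normcX; lra.
have subQP : normc Q.[z] ^+ N <= normc P.[z] ^+ N + normc (P.[z] ^+ N + Q.[z] ^+ N).
  have := normcB_ge (Q.[z] ^+ N) (- P.[z] ^+ N).
  by rewrite opprK normcNn !normcX [_ + P.[z] ^+ N]addrC; lra.
have hroot : forall x y : R, 0 <= x -> 0 <= y -> x ^+ N <= (1 + k^-1) * y ^+ N ->
    x <= (1 + t) * y.
  by near: N; exact: root_ratio_bound.
have h1 := hroot _ _ (normc_ge0 P.[z]) (normc_ge0 Q.[z]) (ratio _ _ _ x0 y0 hQ' subPQ).
have h2 := hroot _ _ (normc_ge0 Q.[z]) (normc_ge0 P.[z]) (ratio _ _ _ y0 x0 hP' subQP).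
have hG := ht z zM h2 h1.
have Pz : P.[z] != 0.
  apply/negP => /eqP Pz; move: hP.
  by rewrite /level_frac Pz expr0n eqn0Ngt N1 mul0r normc0 leNgt k0.
have Qz : Q.[z] != 0.
  apply/negP => /eqP Qz; move: hQ.
  by rewrite /level_frac Qz expr0n eqn0Ngt N1 mul0r normc0 leNgt k0.
exists (N%:R * level_frac P Q N z * level_frac Q P N z *
      ((P^`() * Q - P * Q^`()).[z] / (P.[z] * Q.[z]))).
  exact: level_frac_deriv.
have keyM (s1 s2 G p q : R[i]) : normc (N%:R * s1 * s2 * (G / (p * q))) =
    N%:R * normc s1 * normc s2 * (normc G / (normc p * normc q)).
  have NE : normc (N%:R : R[i]) = N%:R.
    by have := normc_real (N%:R : R); rewrite rmorph_nat normr_nat.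
  by rewrite !normcM normcV normcM NE.
rewrite keyM.
have PQ0 : 0 < normc P.[z] * normc Q.[z] by rewrite mulr_gt0 // normc_gt0.
have hG' : t <= normc (P^`() * Q - P * Q^`()).[z] / (normc P.[z] * normc Q.[z]).
  by rewrite ler_pdivlMr.
have kkt : 0 < k * k * t by rewrite !mulr_gt0.
have hN : B <= N%:R * (k * k * t).
  rewrite -ler_pdivrMr //.
  near: N; have [n hn] : exists n : nat, B / (k * k * t) < n%:R.
    exists (Num.bound `|B / (k * k * t)|); apply: le_lt_trans (ler_norm _) _.
    exact: archi_boundP.
  by apply: filterS (nbhs_infty_ge n) => l kn; apply: ltW; apply: lt_le_trans hn _; rewrite ler_nat.
apply: le_trans hN _; rewrite -!mulrA ler_wpM2l //.
apply: ler_pM => //; [exact: ltW|by rewrite mulr_ge0 // ltW|].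
by apply: ler_pM => //; exact: ltW.
Unshelve. all: by end_near. Qed.

End Asymptotics.

(** * The rational map in the plane *)

Section PlanarModel.
Variable R : realType.
Implicit Types (a b z : R[i]).

Definition near_set (K : set R[i]) (r : R) z := exists2 k, K k & normc (z - k) < r.

Lemma near_set_open (K : set R[i]) (r : R) z : near_set K r z ->
  exists2 t, 0 < t & forall a, normc (a - z) < t -> near_set K r a.
Proof.
move=> [k Kk hk]; exists (r - normc (z - k)); first by rewrite subr_gt0.
by move=> a ha; exists k => //; have := normcBt z a k; lra.
Qed.

(** The neighbourhoods of the K_i are disjoint, so near K_i all other terms are small with small
    Lipschitz constant, and F is a perturbation of [zeta j0] + c_i s_i. If F is close to neither
    [zeta j0] nor [zeta i], then s_i is close to neither 0 nor 1, where it expands. *)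
Lemma planar_model (d : nat) (j0 : 'I_d) (K : 'I_d -> set R[i])
    (zeta : 'I_d -> R[i]) (e M r : R) :
  0 < e -> 0 < M -> 0 < r ->
  (forall i, i != j0 -> K i !=set0) ->
  (forall i k, i != j0 -> K i k -> normc k <= M) ->
  (forall i l z, i != j0 -> l != j0 -> near_set (K i) (2 * r) z ->
    near_set (K l) (2 * r) z -> i = l) ->
  (forall i, i != j0 -> zeta i != zeta j0) ->
  exists p q : {poly R[i]}, exists F : R[i] -> R[i],
  [/\ q != 0, coprimep p q, forall z, q.[z] != 0 -> p.[z] / q.[z] = F z &
  [/\ forall i z, i != j0 -> K i z -> q.[z] != 0 /\ normc (F z - zeta i) <= e / 2,
   forall z, (forall i, i != j0 -> ~ near_set (K i) (2 * r) z) ->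
     q.[z] != 0 /\ normc (F z - zeta j0) <= e / 2,
   forall i a b, i != j0 -> K i a -> K i b ->
     normc (F a - F b) <= 1 / 2 * normc (a - b),
   forall a b, normc a <= M -> normc b <= M ->
     (forall i, i != j0 -> ~ near_set (K i) (2 * r) a) ->
     (forall i, i != j0 -> ~ near_set (K i) (2 * r) b) ->
     normc (F a - F b) <= 1 / 2 * normc (a - b) &
   forall i z, i != j0 -> near_set (K i) (2 * r) z -> q.[z] != 0 ->
     e <= normc (F z - zeta j0) -> e <= normc (F z - zeta i) ->
     exists2 t, 0 < t & forall a b, normc (a - z) < t -> normc (b - z) < t ->
       [/\ q.[a] != 0, q.[b] != 0 & 3 / 2 * normc (a - b) <= normc (F a - F b)]]].
Proof.
move=> e0 M0 r0 Kn KM Kdisj zeta_neq.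
have /choice[f hf] : forall i, exists f : {poly R[i]} * {poly R[i]} * R, i != j0 ->
    [/\ coprimep f.1.1 f.1.2, 0 < f.2 < 1,
    forall z, K i z -> normc f.1.2.[z] <= f.2 * normc f.1.1.[z],
    forall z, (forall k, K i k -> 2 * r <= normc (z - k)) ->
      normc f.1.1.[z] <= f.2 * normc f.1.2.[z] &
    forall z, normc f.1.1.[z] = normc f.1.2.[z] ->
      (f.1.1^`() * f.1.2 - f.1.1 * f.1.2^`()).[z] != 0].
  move=> i; have [->|ij] := eqVneq i j0; first by exists (0, 0, 0).
  have [P [Q [rho h]]] := regular_separating_fraction (Kn i ij) M0 r0
    (fun k => KM i k ij).
  by exists (P, Q, rho).
pose P i := (f i).1.1; pose Q i := (f i).1.2; pose rho i := (f i).2.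
have cPQ i : i != j0 -> coprimep (P i) (Q i) by move=> /hf[].
have rho01 i : i != j0 -> 0 < rho i < 1 by move=> /hf[].
have inK i z : i != j0 -> K i z -> normc (Q i).[z] <= rho i * normc (P i).[z].
  by move=> /hf[_ _ h _ _]; exact: h.
have offK i z : i != j0 -> ~ near_set (K i) (2 * r) z ->
    normc (P i).[z] <= rho i * normc (Q i).[z].
  move=> /hf[_ _ _ h _] hz; apply: h => k Kk; rewrite leNgt; apply/negP => hlt.
  by apply: hz; exists k.
have reg i : i != j0 -> forall z, normc (P i).[z] = normc (Q i).[z] ->
    ((P i)^`() * Q i - P i * (Q i)^`()).[z] != 0 by move=> /hf[].
pose c i := zeta i - zeta j0.
have c0 i : i != j0 -> 0 < normc (c i).
  by move=> /zeta_neq h; rewrite normc_gt0 subr_eq0.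
pose Cs := \sum_(i | i != j0) normc (c i) + 1.
have Cs0 : 0 < Cs.
  by rewrite ltr_wpDl // sumr_ge0 // => i _; exact: normc_ge0.
have cCs i : i != j0 -> normc (c i) <= Cs.
  move=> ij; rewrite /Cs (bigD1 i) //= -addrA lerDl addr_ge0 //.
  by rewrite sumr_ge0 // => l _; exact: normc_ge0.
(* A bound [e1] = m / Cs on each s_i and on its Lipschitz constant makes the sum smaller than e/2
   and 1/2-Lipschitz at once. *)
pose m := Num.min (e / 2) (1 / 2).
have m0 : 0 < m by rewrite lt_min !divr_gt0.
have me : m <= e / 2 by rewrite ge_min lexx.
have m2 : m <= 1 / 2 by rewrite ge_min lexx orbT.
pose e1 := m / Cs.
have e10 : 0 < e1 by rewrite divr_gt0.
have e1E : Cs * e1 = m by rewrite /e1 mulrC mulfVK // gt_eqF.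
have sumb (y : 'I_d -> R[i]) (t : R) : 0 <= t ->
    (forall l, l != j0 -> normc (y l) <= e1 * t) ->
    normc (\sum_(l | l != j0) c l * y l) <= m * t.
  move=> t0 hy; rewrite (le_trans (ler_normc_sum _ _ _)) //.
  apply: le_trans (_ : \sum_(l | l != j0) normc (c l) * (e1 * t) <= _).
    by apply: ler_sum => l lj; rewrite normcM ler_wpM2l ?normc_ge0 // hy.
  rewrite -mulr_suml -e1E -[leRHS]mulrA; apply: ler_wpM2r; last by rewrite lerDl.
  by rewrite mulr_ge0 // ltW.
(* When F is at distance e from a target, the other terms account for at most e/2, so |c_i s_i| or
   |c_i (1 - s_i)| is at least e/2. *)
pose kappa := e / (2 * Cs).
have kappa0 : 0 < kappa by rewrite divr_gt0 // mulr_gt0.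
(* The derivative bound 3 / |c_i| makes c_i s_i expand by 3; strict differentiability costs 1 and
   the other terms 1/2, which leaves 3/2. *)
pose good (i : 'I_d) N := i != j0 ->
   [/\ (forall z, normc (P i).[z] <= rho i * normc (Q i).[z] ->
      (P i).[z] ^+ N + (Q i).[z] ^+ N != 0 /\
      normc (level_frac (P i) (Q i) N z) <= e1) /\
    (forall a b, normc a <= M + 2 * r -> normc b <= M + 2 * r ->
      normc (P i).[a] <= rho i * normc (Q i).[a] ->
      normc (P i).[b] <= rho i * normc (Q i).[b] ->
      normc (level_frac (P i) (Q i) N a - level_frac (P i) (Q i) N b) <=
      e1 * normc (a - b)),
     (forall z, normc (Q i).[z] <= rho i * normc (P i).[z] ->
      (Q i).[z] ^+ N + (P i).[z] ^+ N != 0 /\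
      normc (level_frac (Q i) (P i) N z) <= e1) /\
    (forall a b, normc a <= M + 2 * r -> normc b <= M + 2 * r ->
      normc (Q i).[a] <= rho i * normc (P i).[a] ->
      normc (Q i).[b] <= rho i * normc (P i).[b] ->
      normc (level_frac (Q i) (P i) N a - level_frac (Q i) (P i) N b) <=
      e1 * normc (a - b)) &
     forall z, normc z <= M + 2 * r -> (P i).[z] ^+ N + (Q i).[z] ^+ N != 0 ->
      kappa <= normc (level_frac (P i) (Q i) N z) ->
      kappa <= normc (level_frac (Q i) (P i) N z) ->
      exists2 D, strict_deriv (level_frac (P i) (Q i) N) z D &
        3 / normc (c i) <= normc D].
have [N hN] : exists N, forall i, good i N.
  apply: (@filter_ex _ \oo); apply: (@filter_forall _ _ good \oo) => i.
  have [->|ij] := eqVneq i j0; first by apply: nearW => N; rewrite /good eqxx.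
  have h1 := small_frac (M + 2 * r) (cPQ i ij) (rho01 i ij) e10.
  have cQP : coprimep (Q i) (P i) by rewrite coprimep_sym cPQ.
  have h2 := small_frac (M + 2 * r) cQP (rho01 i ij) e10.
  have h3 := level_frac_expanding (M + 2 * r) (3 / normc (c i)) (cPQ i ij)
    (reg i ij) kappa0.
  by apply: filterS3 h1 h2 h3 => N k1 k2 k3 _; split.
pose s i z := level_frac (P i) (Q i) N z.
pose E i : {poly R[i]} := P i ^+ N + Q i ^+ N.
have EE i z : (E i).[z] = (P i).[z] ^+ N + (Q i).[z] ^+ N.
  by rewrite hornerD !horner_exp.
have off_small i z : i != j0 -> ~ near_set (K i) (2 * r) z ->
    (E i).[z] != 0 /\ normc (s i z) <= e1.
  by move=> ij hz; rewrite EE; have [[h _] _ _] := hN i ij; apply/h/offK.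
have in_small i z : i != j0 -> K i z ->
    (E i).[z] != 0 /\ normc (s i z - 1) <= e1.
  move=> ij Kz; have [_ [h _] _] := hN i ij.
  have [h1 h2] := h z (inK i z ij Kz); rewrite addrC in h1; rewrite EE; split => //.
  by move: h2; rewrite level_frac_sym // normcBC.
pose q := \prod_(i | i != j0) E i.
pose p := zeta j0 *: q +
  \sum_(i | i != j0) c i *: (P i ^+ N * \prod_(l | (l != j0) && (l != i)) E l).
pose F z := zeta j0 + \sum_(i | i != j0) c i * s i z.
have qz0 z : (forall i, i != j0 -> (E i).[z] != 0) -> q.[z] != 0.
  by move=> h; rewrite horner_prod; apply/prodf_neq0.
have qE z i : i != j0 -> q.[z] != 0 -> (E i).[z] != 0.
  move=> ij; apply: contraNneq => Ez.
  by rewrite /q horner_prod (bigD1 i) //= Ez mul0r.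
have FE z : q.[z] != 0 -> p.[z] / q.[z] = F z.
  move=> qz; rewrite /p hornerD hornerZ mulrDl mulfK // horner_sum mulr_suml.
  congr (_ + _); apply: eq_bigr => i ij.
  have qX : q.[z] = (E i).[z] * (\prod_(l | (l != j0) && (l != i)) E l).[z].
    by rewrite /q (bigD1 i) //= hornerM.
  move: (qz); rewrite qX mulf_eq0 negb_or => /andP[].
  rewrite hornerZ hornerM horner_exp /s /level_frac EE.
  move: ((\prod_(l | (l != j0) && (l != i)) E l).[z]) => X E0 Xz.
  by rewrite -mulrA; congr (_ * _); field; rewrite Xz E0.
have in_off i z l : i != j0 -> near_set (K i) (2 * r) z -> l != j0 -> l != i ->
    ~ near_set (K l) (2 * r) z.
  by move=> ij hz lj /eqP li hl; apply: li; exact: Kdisj hl hz.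
have K_near i z : K i z -> near_set (K i) (2 * r) z.
  by move=> Kz; exists z => //; rewrite subrr normc0 mulr_gt0.
have near_M i z : i != j0 -> near_set (K i) (2 * r) z -> normc z <= M + 2 * r.
  move=> ij [k Kk hk]; have := KM i k ij Kk; have := normcB_ge z k; lra.
have dichotomy z : (exists2 i, i != j0 & near_set (K i) (2 * r) z) \/
    (forall i, i != j0 -> ~ near_set (K i) (2 * r) z).
  have [h|h] := pselect (exists2 i, i != j0 & near_set (K i) (2 * r) z); first by left.
  by right=> i ij hi; apply: h; exists i.
exists p, q, F; split => //.
- rewrite /q; apply/prodf_neq0 => i ij.
  have [k Kk] := Kn i ij; have [h _] := in_small i k ij Kk.
  by apply: contraNneq h => ->; rewrite horner0.
(* A zero of q is a zero of some [E i], hence near K_i only. There all other summands of p contain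
   the factor [E i], so p = 0 would force P_i = 0, and then Q_i = 0. *)
- apply/Pdiv.ClosedField.coprimepP => z pz; apply/negP => /eqP qz.
  have [i ij Ez] : exists2 i, i != j0 & (E i).[z] = 0.
    move/eqP: qz; rewrite /q horner_prod => /eqP h.
    have [/'exists_andP[i [ij /eqP Ez]]|/'exists_andP hn] :=
      boolP [exists i, (i != j0) && ((E i).[z] == 0)]; first by exists i.
    exfalso; have : \prod_(i | i != j0) (E i).[z] != 0.
      by apply/prodf_neq0 => i ij; apply/negP => Ez; apply: hn; exists i.
    by rewrite h eqxx.
  have zi : near_set (K i) (2 * r) z.
    apply: contrapT => hz; have [] := off_small i z ij hz.
    by rewrite Ez eqxx.
  move: pz; rewrite rootE /p hornerD hornerZ qz mulr0 add0r horner_sum (bigD1 i) //=.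
  rewrite [X in _ + X]big1 ?addr0; last first.
    move=> l /andP[lj li]; rewrite hornerZ hornerM horner_prod (bigD1 i) /=.
      by rewrite Ez mul0r !mulr0.
    by rewrite ij eq_sym.
  rewrite hornerZ hornerM horner_exp horner_prod !mulf_eq0.
  have ci0 : c i != 0 by rewrite -normc_gt0 c0.
  rewrite (negbTE ci0) /= => /orP[Pz|]; last first.
    apply/negP; apply/prodf_neq0 => l /andP[lj li].
    by have [] := off_small l z lj (in_off i z l ij zi lj li).
  have N0 : (0 < N)%N.
    by case: (N) Pz => //; rewrite expr0 oner_eq0.
  have Pz0 : (P i).[z] = 0 by move: Pz; rewrite expf_eq0 N0 => /eqP.
  move: Ez; rewrite EE Pz0 expr0n eqn0Ngt N0 add0r => /eqP.
  rewrite expf_eq0 N0 /= => /eqP Qz.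
  have := coprimep_root (cPQ i ij) (x := z); rewrite rootE Pz0 Qz eqxx.
  by move=> /(_ isT).
- split.
  + move=> i z ij Kz; have zi := K_near i z Kz.
    split.
      apply: qz0 => l lj; have [->|li] := eqVneq l i.
        by have [] := in_small i z ij Kz.
      by have [] := off_small l z lj (in_off i z l ij zi lj li).
    have -> : F z - zeta i = \sum_(l | l != j0) c l * (s l z - (l == i)%:R).
      rewrite /F [in RHS](bigD1 i) //= [in LHS](bigD1 i) //= eqxx.
      have -> : \sum_(l < d | (l != j0) && (l != i)) c l * (s l z - (l == i)%:R) =
          \sum_(l < d | (l != j0) && (l != i)) c l * s l z.
        by apply: eq_bigr => l /andP[_ /negbTE ->]; rewrite subr0.
      have -> : true%:R = 1 :> R[i] by [].
      by rewrite /c; ring.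
    apply: le_trans (sumb _ 1 ler01 _) _; last by rewrite mulr1.
    move=> l lj; rewrite mulr1; have [->|li] := eqVneq l i.
      by have [] := in_small i z ij Kz.
    by rewrite subr0; have [] := off_small l z lj (in_off i z l ij zi lj li).
  + move=> z hz; split; first by apply: qz0 => l lj; have [] := off_small l z lj (hz l lj).
    rewrite /F addrAC subrr add0r.
    apply: le_trans (sumb _ 1 ler01 _) _; last by rewrite mulr1.
    by move=> l lj; rewrite mulr1; have [] := off_small l z lj (hz l lj).
  + move=> i a b ij Ka Kb.
    have -> : F a - F b = \sum_(l | l != j0) c l * (s l a - s l b).
      by rewrite /F opprD addrACA subrr add0r -sumrB; apply: eq_bigr => l _; rewrite mulrBr.
    apply: le_trans (sumb _ (normc (a - b)) (normc_ge0 _) _) _; last first.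
      by rewrite ler_wpM2r ?normc_ge0.
    have ai := K_near i a Ka; have bi := K_near i b Kb.
    move=> l lj; have [->|li] := eqVneq l i.
      have [h1 _] := in_small i a ij Ka; have [h2 _] := in_small i b ij Kb.
      have [_ [_ h] _] := hN i ij.
      have := h a b (near_M i a ij ai) (near_M i b ij bi) (inK i a ij Ka) (inK i b ij Kb).
      have fl y : (E i).[y] != 0 -> level_frac (Q i) (P i) N y = 1 - s i y.
        by rewrite EE; exact: level_frac_sym.
      rewrite (fl a h1) (fl b h2) normcBC.
      by congr (normc _ <= _); ring.
    have [[_ h] _ _] := hN l lj; apply: h; [exact: near_M ai|exact: near_M bi| |].
      by apply: offK => //; exact: in_off ai lj li.
    by apply: offK => //; exact: in_off bi lj li.
  + move=> a b aM bM ha hb.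
    have -> : F a - F b = \sum_(l | l != j0) c l * (s l a - s l b).
      by rewrite /F opprD addrACA subrr add0r -sumrB; apply: eq_bigr => l _; rewrite mulrBr.
    apply: le_trans (sumb _ (normc (a - b)) (normc_ge0 _) _) _; last first.
      by rewrite ler_wpM2r ?normc_ge0.
    move=> l lj; have [[_ h] _ _] := hN l lj; apply: h.
    * by apply: le_trans aM _; rewrite lerDl mulr_ge0 // ltW.
    * by apply: le_trans bM _; rewrite lerDl mulr_ge0 // ltW.
    * by apply: offK => //; exact: ha.
    * by apply: offK => //; exact: hb.
  + move=> i z ij zi qz h1 h2.
    pose rest a := \sum_(l | l != j0) c l * (if l == i then 0 else s l a).
    have FR a : F a = zeta j0 + c i * s i a + rest a.
      rewrite /F /rest (bigD1 i) //= [in RHS](bigD1 i) //= eqxx mulr0 add0r -addrA.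
      congr (_ + (_ + _)); apply: eq_bigr => l /andP[_ /negbTE ->] //.
    have Ez := qE z i ij qz.
    have restz : normc (rest z) <= e / 2.
      apply: le_trans (sumb _ 1 ler01 _) _; last by rewrite mulr1.
      move=> l lj; rewrite mulr1; have [_|li] := eqVneq l i; first by rewrite normc0 ltW.
      by have [] := off_small l z lj (in_off i z l ij zi lj li).
    have kap (x : R[i]) : e / 2 <= normc (c i * x) -> kappa <= normc x.
      rewrite normcM => h; rewrite /kappa ler_pdivrMr ?mulr_gt0 //.
      have : normc (c i) * normc x <= Cs * normc x by rewrite ler_wpM2r ?normc_ge0 ?cCs.
      lra.
    have k1 : kappa <= normc (s i z).
      apply: kap; have : normc (F z - zeta j0) <= normc (c i * s i z) + normc (rest z).
        rewrite FR; have -> : zeta j0 + c i * s i z + rest z - zeta j0 =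
          c i * s i z + rest z by ring.
        exact: normcD.
      lra.
    have k2 : kappa <= normc (level_frac (Q i) (P i) N z).
      rewrite level_frac_sym -?EE // -/(s i z).
      apply: kap; have : normc (F z - zeta i) <= normc (c i * (1 - s i z)) + normc (rest z).
        rewrite FR; have -> : zeta j0 + c i * s i z + rest z - zeta i =
          - (c i * (1 - s i z)) + rest z by rewrite /c; ring.
        by apply: le_trans (normcD _ _) _; rewrite normcNn.
      lra.
    have [_ _ h] := hN i ij.
    have [D sD hD] := h z (near_M i z ij zi) ltac:(by rewrite -EE) k1 k2.
    have ci0 := c0 i ij.
    have [t1 t10 ht1] := sD (1 / normc (c i)) ltac:(by rewrite divr_gt0).
    have [t2 t20 ht2] := near_set_open zi.
    have [t3 t30 ht3] : exists2 t3, 0 < t3 & forall a, normc (a - z) < t3 -> q.[a] != 0.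
      have qz1 : 0 < normc q.[z] by rewrite normc_gt0.
      have [t3 t30 ht3] := poly_cont q z qz1.
      exists t3 => // a /ht3 ha; apply/negP => /eqP qa; move: ha.
      by rewrite qa sub0r normcNn ltxx.
    exists (Num.min t1 (Num.min t2 t3)); first by rewrite !lt_min t10 t20.
    move=> a b; rewrite !lt_min => /and3P[a1 a2 a3] /and3P[b1 b2 b3].
    split; [exact: ht3|exact: ht3|].
    have ai := ht2 a a2; have bi := ht2 b b2.
    have hrest : normc (rest a - rest b) <= 1 / 2 * normc (a - b).
      have -> : rest a - rest b = \sum_(l | l != j0) c l * (if l == i then 0 else s l a - s l b).
        rewrite /rest -sumrB; apply: eq_bigr => l _; rewrite -mulrBr.
        by case: (l == i) => //; rewrite subrr.
      apply: le_trans (sumb _ (normc (a - b)) (normc_ge0 _) _) _; last first.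
        by rewrite ler_wpM2r ?normc_ge0.
      move=> l lj; have [_|li] := eqVneq l i.
        by rewrite normc0 mulr_ge0 ?normc_ge0 // ltW.
      have [[_ hl] _ _] := hN l lj; apply: hl; [exact: near_M ai|exact: near_M bi| |].
        by apply: offK => //; exact: in_off ai lj li.
      by apply: offK => //; exact: in_off bi lj li.
    have hmain := ht1 a b a1 b1; rewrite -/(s i a) -/(s i b) in hmain.
    have n0 := normc_ge0 (a - b).
    have lower : 2 * normc (a - b) <= normc (c i * (s i a - s i b)).
      rewrite normcM.
      have k3 : normc (D * (a - b)) - normc (s i a - s i b - D * (a - b)) <=
          normc (s i a - s i b).
        have := normcB_ge (D * (a - b)) (D * (a - b) - (s i a - s i b)).
        by rewrite subKr [normc (_ - (s i a - s i b))]normcBC.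
      have k4 : normc (D * (a - b)) >= 3 / normc (c i) * normc (a - b).
        by rewrite normcM ler_wpM2r.
      have k5 : 2 / normc (c i) * normc (a - b) <= normc (s i a - s i b).
        have -> : 2 / normc (c i) * normc (a - b) =
          3 / normc (c i) * normc (a - b) - 1 / normc (c i) * normc (a - b) by ring.
        by move: k3 k4 hmain; clear; lra.
      rewrite -(ler_pM2l ci0) in k5; apply: le_trans k5.
      by rewrite le_eqVlt; apply/orP; left; apply/eqP; field; rewrite gt_eqF.
    have -> : F a - F b = c i * (s i a - s i b) - (rest b - rest a).
      rewrite !FR mulrBr; move: (c i * s i a) (c i * s i b) (rest a) (rest b) (zeta j0).
      by clear=> *; ring.
    apply: le_trans (normcB_ge _ _); rewrite [normc (rest b - _)]normcBC.
    by move: lower hrest; clear; lra.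
Qed.

End PlanarModel.

(** * Dynamics near attracting disks *)

Section Dynamics.
Variable R : realType.
Implicit Types (a b c z : R[i]) (x y w : sphere R).

Definition disk c (e : R) : set (sphere R) :=
  [set w | exists2 b, w = Some b & normc (b - c) < e].

Lemma disk_open c (e : R) : open (disk c e).
Proof.
rewrite openE => _ [b -> hb]; apply/nbhs_finiteP.
exists (e - normc (b - c)); first by rewrite subr_gt0.
by move=> a ha; exists a => //; have := normcBt b a c; lra.
Qed.

Lemma iter_continuous (T : topologicalType) (f : T -> T) n :
  continuous f -> continuous (iter n f).
Proof.
move=> cf; elim: n => [|n IH] x; first exact: cvg_id.
by apply: (@continuous_comp _ _ _ (iter n f) f); [exact: IH | exact: cf].
Qed.

Lemma uniform_cvgP (K : set (sphere R)) (u : nat -> sphere R -> sphere R) g :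
  {uniform K, u @ \oo --> g} <->
  forall e : R, 0 < e -> \forall n \near \oo, forall x, K x -> ball (g x) e (u n x).
Proof.
split=> [h e e0|h P /uniform_nbhs[E [entE sub]]].
  apply: (h [set f | forall x, K x -> ball (g x) e (f x)]).
  apply/uniform_nbhs; exists [set xy | ball xy.1 e xy.2]; split => //.
  by rewrite -entourage_ballE; exists e.
move: entE; rewrite -entourage_ballE => -[e /= e0 he].
apply: filterS (h e e0) => n hn; apply: sub => x Kx.
by apply: he; exact: hn.
Qed.

Lemma multiplier_strict_deriv (r : sphere R -> sphere R) (F : R[i] -> R[i]) (z l : R[i])
    (t : R) : 0 < t ->
  (forall a, normc (a - z) < t -> r (Some a) = Some (F a)) ->
  strict_deriv F z l -> multiplier r (Some z) = l.
Proof.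
move=> t0 hr hF; rewrite /multiplier /derive1.
apply: (@cvg_lim R[i]^o (@norm_hausdorff _ _)).
apply/cvgrPdist_lt => e e0.
(* Here e is a positive element of [R[i]], hence real. *)
have eE : e = (complex.Re e)%:C by rewrite RRe_real // gtr0_real.
have e1 : 0 < complex.Re e by rewrite -ltcR -eE.
have e2 : 0 < complex.Re e / 2 by rewrite divr_gt0.
have [s s0 hs] := hF _ e2.
near=> h.
have h0 : h != 0 by near: h; exact: nbhs_dnbhs_neq.
have hn : `|h| < (Num.min s t)%:C.
  by near: h; apply: dnbhs0_lt; rewrite ltcR lt_min s0.
move: hn; rewrite normr_normc ltcR lt_min => /andP[hs1 ht1].
have hz : normc (h + z - z) = normc h by rewrite addrK.
have zz : normc (z - z) = 0 by rewrite subrr normc0.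
rewrite !hr ?hz ?zz //=.
have := hs (h + z) z; rewrite hz zz addrK => /(_ hs1 s0) hh.
rewrite normr_normc eE ltcR.
have -> : l - h^-1 *: (F (h + z) - F z) = - (h^-1 * (F (h + z) - F z - l * h)).
  rewrite mulrBr [h^-1 * (l * h)]mulrCA mulVf // mulr1 opprB. by [].
rewrite normcNn normcM normcV -ltr_pdivlMl ?invr_gt0 ?normc_gt0 // invrK.
apply: le_lt_trans hh _; rewrite mulrC ltr_pM2l ?normc_gt0 //; lra.
Unshelve. all: by end_near. Qed.

(** Instead of passing to a limit of iterates: without a fixed point, |F w - w| has a positive lower
    bound on the closed half-size disk by compactness, whereas the steps of the orbit of c shrink
    geometrically. *)
Lemma contraction_fixed_point (F : R[i] -> R[i]) c (e : R) : 0 < e ->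
  (forall a, normc (a - c) < e -> normc (F a - c) <= e / 2) ->
  (forall a b, normc (a - c) < e -> normc (b - c) < e ->
    normc (F a - F b) <= 1 / 2 * normc (a - b)) ->
  exists2 z, normc (z - c) <= e / 2 & F z = z.
Proof.
move=> e0 hF1 hF2; apply: contrapT => nofix.
have e2 : e / 2 < e by rewrite ltr_pdivrMr // ltr_pMr // ltr1n.
have [t t0 ht] : exists2 t, 0 < t & forall w : R[i], normc w <= normc c + e ->
    normc (w - c) <= e / 2 -> t <= normc (F w - w).
  apply: (@planar_near_covering R (normc c + e)
    (fun t (w : R[i]) => normc (w - c) <= e / 2 -> t <= normc (F w - w))) => z.
  have [hz|hz] := leP (normc (z - c)) (e / 2); last first.
    exists (normc (z - c) - e / 2); first by rewrite subr_gt0.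
    move=> w t hw _ hwc; have := normcBt w z c; rewrite [normc (z - w)]normcBC; lra.
  have g0 : 0 < normc (F z - z).
    rewrite normc_gt0 subr_eq0; apply/negP => /eqP Fz; apply: nofix.
    by exists z.
  exists (normc (F z - z) / 4); first by rewrite divr_gt0.
  move=> w t hw /andP[_ ht] hwc.
  have := hF2 z w (le_lt_trans hz e2) (le_lt_trans hwc e2).
  have := normcBt (F w) (F z) z; have := normcBt w (F w) z.
  rewrite [normc (z - w)]normcBC => h1 h2 h3; lra.
pose x n := iter n F c.
have xe n : normc (x n - c) < e.
  elim: n => [|n IH]; first by rewrite subrr normc0.
  by rewrite /x iterS; apply: le_lt_trans (hF1 _ IH) e2.
have xc n : normc (x n - c) <= e / 2.
  case: n => [|n]; last by rewrite /x iterS; apply: hF1; exact: xe.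
  by rewrite subrr normc0 divr_ge0 // ltW.
have step n : normc (x n.+1 - x n) <= (1 / 2) ^+ n * e.
  elim: n => [|n IH]; first by rewrite expr0 mul1r; have := xc 1%N; rewrite /x /=; lra.
  apply: le_trans (hF2 _ _ (xe n.+1) (xe n)) _.
  by rewrite exprS -[leRHS]mulrA ler_pM2l.
have small : \forall n \near \oo, (1 / 2 : R) ^+ n <= t / (2 * e).
  have te : 0 < t / (2 * e) by rewrite divr_gt0 // mulr_gt0.
  have h12 : `|1 / 2 : R| < 1 by rewrite ger0_norm; lra.
  have /cvgrPdist_le /(_ _ te) := cvg_expr h12.
  by apply: filterS => n; rewrite sub0r normrN ger0_norm // exprn_ge0 // divr_ge0.
have [n hn] := filter_ex small.
have k1 : t <= normc (x n.+1 - x n).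
  by apply: ht => //; have := xc n; have := normcB_ge (x n) c; lra.
have := step n; have : (1 / 2 : R) ^+ n * e <= t / (2 * e) * e by rewrite ler_pM2r.
have -> : t / (2 * e) * e = t / 2 by field; rewrite gt_eqF.
lra.
Qed.

Lemma iter_choice (k : nat -> nat) :
  (exists b : nat, forall m, exists2 n, (m < n)%N & k n = b) \/
  (forall B, \forall n \near \oo, (B <= k n)%N).
Proof.
have [h|h] := pselect (exists b : nat, forall m, exists2 n, (m < n)%N & k n = b); first by left.
right; elim=> [|B IH]; first by apply: nearW.
have [m hm] : exists m, forall n, (m < n)%N -> k n <> B.
  apply: contrapT => hm; apply: h; exists B => m.
  by apply: contrapT => hmB; apply: hm; exists m => n mn kn; apply: hmB; exists n.
apply: filterS2 IH (nbhs_infty_gt m) => n h1 h2.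
by rewrite ltn_neqAle h1 andbT; apply/eqP => /esym; exact: hm.
Qed.

(** A sequence of iterates need not have growing exponents. Either an exponent recurs infinitely
    often and a subsequence is constant, or the exponents tend to infinity and the sequence
    converges to x. *)
Lemma normal_family_of_cvg (r : sphere R -> sphere R) (U : set (sphere R)) x :
  (forall e : R, 0 < e -> \forall n \near \oo, forall w, U w -> ball x e (iter n r w)) ->
  normal_family [set g | exists2 n, (1 <= n)%N & g = iter n r] U.
Proof.
move=> hU u hu.
have /choice[k hk] : forall n, exists k, u n = iter k r.
  by move=> n; have [k _ ->] := hu n; exists k.
have [[b hb]|hinf] := iter_choice k.
  have /choice[f hf] : forall m, exists n, (m < n)%N /\ k n = b.
    by move=> m; have [n mn kn] := hb m; exists n.
  pose phi n := iter n.+1 f 0%N.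
  exists phi; split.
    move=> m n; elim: n => // n IH; rewrite ltnS leq_eqVlt => /orP[/eqP ->|/IH h].
      exact: (hf _).1.
    by apply: ltn_trans h _; exact: (hf _).1.
  exists (iter b r) => K _ _; apply/uniform_cvgP => e e0; apply: nearW => n y _.
  by rewrite /= hk /phi iterS (hf _).2; exact: ballxx.
exists id; split => //; exists (fun=> x) => K _ KU; apply/uniform_cvgP => e e0.
have [m _ hm] := hU e e0.
apply: filterS (hinf m) => n hn y Ky; rewrite /= hk.
by apply: (hm (k n) hn); exact: KU.
Qed.

(* Normality is tested on the separating iterates only: orbits that have been
   separated may come close again later. *)
Lemma not_normal_of_separation (r : sphere R -> sphere R) (U : set (sphere R)) z (e : R) :
  continuous r -> 0 < e -> open U -> U (Some z) ->
  (forall t : R, 0 < t -> exists m b, [/\ (1 <= m)%N, normc (b - z) < t &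
    ~ ball (iter m r (Some z)) e (iter m r (Some b))]) ->
  ~ normal_family [set g | exists2 n, (1 <= n)%N & g = iter n r] U.
Proof.
move=> cr e0 Uo Uz hsep hnorm.
have /choice[mb hmb] : forall n : nat, exists mb : nat * R[i],
    [/\ (1 <= mb.1)%N, normc (mb.2 - z) < n.+1%:R^-1 &
    ~ ball (iter mb.1 r (Some z)) e (iter mb.1 r (Some mb.2))].
  move=> n; have n0 : 0 < n.+1%:R^-1 :> R by rewrite invr_gt0.
  by have [m [b h]] := hsep _ n0; exists (m, b).
pose u n := iter (mb n).1 r.
have [phi [phi_inc [g hg]]] : exists phi : nat -> nat, {homo phi : m n / (m < n)%N} /\
    exists g : sphere R -> sphere R, forall K : set (sphere R), compact K -> K `<=` U ->
    {uniform K, (u \o phi) @ \oo --> g}.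
  by apply: hnorm => n; exists (mb n).1 => //; have [] := hmb n.
have phi_ge n : (n <= phi n)%N.
  elim: n => // n IH; apply: leq_ltn_trans IH _; exact: phi_inc.
have /nbhs_finiteP[t t0 ht] : nbhs (Some z : sphere R) U by exact: open_nbhs_nbhs.
pose x0 := complex.Re z; pose y0 := complex.Im z; pose s := t / 4.
have s0 : 0 < s by rewrite divr_gt0.
pose K := @sphere_of_pair R @` (`[x0 - s, x0 + s] `*` `[y0 - s, y0 + s]).
have Kc : compact K.
  apply: continuous_compact; last by apply: compact_setX; exact: segment_compact.
  by apply: continuous_subspaceT => ?; exact: sphere_of_pair_continuous.
have KU : K `<=` U.
  move=> _ [[x y] [/= hx hy] <-]; apply: ht.
  have -> : (x +i* y) - z = (x - x0) +i* (y - y0) by rewrite /x0 /y0; case: (z).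
  apply: le_lt_trans (normc_le_sum _ _) _; move: hx hy; rewrite !in_itv /=.
  move=> /andP[x1 x2] /andP[y1 y2].
  have : `|x - x0| <= s by rewrite ler_norml; apply/andP; split; lra.
  have : `|y - y0| <= s by rewrite ler_norml; apply/andP; split; lra.
  rewrite /s; lra.
have inK b : normc (b - z) <= s -> K (Some b).
  move=> hb; exists (complex.Re b, complex.Im b); last by case: (b).
  have h1 := le_trans (normc_Re_le _) hb; have h2 := le_trans (normc_Im_le _) hb.
  move: h1 h2; rewrite !raddfB /= !ler_norml => /andP[h1 h2] /andP[h3 h4].
  by split; rewrite /= in_itv /= /x0 /y0; apply/andP; split; lra.
(* Five steps: from [u (phi n)] to g to [u (phi N)] at z, then from z to b by continuity of the
   fixed map [u (phi N)], then back through g at b. *)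
have e5 : 0 < e / 5 by rewrite divr_gt0.
have /uniform_cvgP/(_ _ e5)[N _ hN] := hg K Kc KU.
have Kz : K (Some z) by apply: inK; rewrite subrr normc0 ltW.
have cN : continuous (u (phi N)) by apply: iter_continuous.
have /nbhs_finiteP[t1 t10 ht1] : nbhs (Some z : sphere R)
    (u (phi N) @^-1` ball (u (phi N) (Some z)) (e / 5)).
  by apply: cN; exact: nbhsx_ballx.
have [n [nN nt1 ns]] : exists n, [/\ (N <= n)%N, n.+1%:R^-1 < t1 & n.+1%:R^-1 < s].
  pose n := maxn N (maxn (Num.bound t1^-1) (Num.bound s^-1)).
  have big (v : R) : 0 < v -> (Num.bound v^-1 <= n)%N -> n.+1%:R^-1 < v.
    move=> v0 hn; rewrite invf_plt ?posrE //.
    apply: lt_le_trans (archi_boundP _) _; first by rewrite invr_ge0 ltW.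
    by rewrite ler_nat ltnW.
  exists n; split; first exact: leq_maxl.
    by apply: big => //; rewrite /n maxnCA leq_maxl.
  by apply: big => //; rewrite /n maxnA leq_maxr.
have [_ hb hnb] := hmb (phi n); set b := (mb (phi n)).2 in hb hnb.
have hb' : normc (b - z) < n.+1%:R^-1.
  apply: lt_le_trans hb _; rewrite lef_pV2 ?posrE // ler_nat ltnS; exact: phi_ge.
have Kb : K (Some b) by apply: inK; apply: ltW; exact: lt_trans ns.
have b1 := hN N (leqnn N) _ Kz; have b2 := hN N (leqnn N) _ Kb.
have b3 := hN n nN _ Kz; have b4 := hN n nN _ Kb.
have b5 := ht1 b (lt_trans hb' nt1).
apply: hnb; rewrite -/(u (phi n)).
have -> : e = e / 5 + (e / 5 + e / 5 + e / 5) + e / 5 by field.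
apply: ball_triangle b4.
apply: ball_triangle (ball_sym b3) _.
apply: ball_triangle (ball_sym b2).
by apply: ball_triangle b5.
Qed.

Lemma geometric_lt (q C e : R) : 0 <= q < 1 -> 0 < e ->
  \forall n \near \oo, q ^+ n * C < e.
Proof.
move=> /andP[q0 q1] e0; have C0 : 0 < `|C| + 1 by rewrite ltr_wpDl.
have eC : 0 < e / (`|C| + 1) by rewrite divr_gt0.
have qn1 : `|q| < 1 by rewrite ger0_norm.
have /cvgrPdist_lt /(_ _ eC) := cvg_expr qn1.
apply: filterS => n; rewrite sub0r normrN ger0_norm ?exprn_ge0 //.
rewrite ltr_pdivlMr //; apply: le_lt_trans.
by rewrite ler_wpM2l ?exprn_ge0 // (le_trans (ler_norm _)) // lerDl.
Qed.

(** * Basins captured by disks, and expansion elsewhere *)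

Section AttractingDisks.
Variables (d : nat) (r : sphere R -> sphere R) (F : R[i] -> R[i]) (e : R).
Variables (c zf : 'I_d -> R[i]).
Hypothesis r_cont : continuous r.
Hypothesis e0 : 0 < e.
Hypothesis disk_stable : forall i a, normc (a - c i) < e ->
  r (Some a) = Some (F a) /\ normc (F a - c i) <= e / 2.
Hypothesis disk_contraction : forall i a b,
  normc (a - c i) < e -> normc (b - c i) < e ->
  normc (F a - F b) <= 1 / 2 * normc (a - b).
Hypothesis zf_disk : forall i, normc (zf i - c i) <= e / 2.
Hypothesis zf_fixed : forall i, F (zf i) = zf i.

Let e2 : e / 2 < e.
Proof. by rewrite ltr_pdivrMr // ltr_pMr // ltr1n. Qed.

Lemma iter_disk i a n : normc (a - c i) < e ->
  exists b, [/\ iter n r (Some a) = Some b, normc (b - c i) < e &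
    normc (b - zf i) <= (1 / 2) ^+ n * (2 * e)].
Proof.
move=> ha; elim: n => [|n [b [h1 h2 h3]]].
  exists a; split => //; rewrite expr0 mul1r.
  apply: le_trans (normcBt (c i) _ _) _; rewrite [X in _ + X <= _]normcBC.
  apply: le_trans (lerD (ltW ha) (zf_disk i)) _.
  by rewrite mulr_natl mulr2n lerD2l ltW.
have [rb Fb] := disk_stable h2; exists (F b); split.
- by rewrite iterS h1 rb.
- exact: le_lt_trans e2.
- rewrite -[X in _ - X]zf_fixed.
  apply: le_trans (disk_contraction h2 (le_lt_trans (zf_disk i) e2)) _.
  by rewrite exprS -[leRHS]mulrA ler_pM2l.
Qed.

Lemma disk_attracted i (s : R) : 0 < s -> \forall n \near \oo,
  forall w, disk (c i) e w -> ball (Some (zf i) : sphere R) s (iter n r w).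
Proof.
move=> s0; have [t t0 ht] := ball_finite s0.
have h12 : 0 <= (1 / 2 : R) < 1 by apply/andP; split; lra.
apply: filterS (geometric_lt (2 * e) h12 t0) => n hn _ [a -> ha].
have [b [-> _ hb]] := iter_disk n ha.
by apply: ht; exact: le_lt_trans hn.
Qed.

Lemma disk_attracted_from i m (s : R) : 0 < s -> \forall n \near \oo,
  forall w, disk (c i) e (iter m r w) -> ball (Some (zf i) : sphere R) s (iter n r w).
Proof.
move=> s0; have [N _ hN] := disk_attracted i s0.
apply: filterS (nbhs_infty_ge (N + m)%N) => n hn w hw.
have -> : n = ((n - m) + m)%N by rewrite subnK // (leq_trans _ hn) // leq_addl.
by rewrite iterD; apply: (hN (n - m)%N) => //; rewrite /= leq_subRL ?(leq_trans _ hn) ?leq_addl // addnC.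
Qed.

(** Entering the disk once suffices for convergence to the fixed point. Openness and invariance of
    the basins are read off from this finite-time description. *)
Lemma basin_disk i :
  basin r (Some (zf i)) = [set w | exists n, disk (c i) e (iter n r w)].
Proof.
apply/seteqP; split=> w.
  move=> hw; have [N _ hN] : \forall n \near \oo, disk (c i) e (iter n r w).
    apply: hw; apply: open_nbhs_nbhs; split; first exact: disk_open.
    by exists (zf i) => //; exact: le_lt_trans e2.
  by exists N; apply: hN; rewrite /=.
move=> [m hm] U /nbhs_ballP[s /= s0 hs].
by apply: filterS (disk_attracted_from i m s0) => n hn; apply: hs; exact: hn.
Qed.

Lemma basin_open i : open (basin r (Some (zf i))).
Proof.
rewrite basin_disk.
have -> : [set w | exists n, disk (c i) e (iter n r w)] =
    \bigcup_n (iter n r @^-1` disk (c i) e).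
  by apply/seteqP; split=> w [n]; [exists n|move=> _; exists n].
apply: bigcup_open => n _; apply: open_comp; last exact: disk_open.
by move=> w _; exact: iter_continuous.
Qed.

Lemma basin_Fatou i : basin r (Some (zf i)) `<=` Fatou r.
Proof.
move=> w; rewrite {1}basin_disk => -[m hm].
exists (iter m r @^-1` disk (c i) e); split => //.
  apply: open_comp; last exact: disk_open.
  by move=> x _; exact: iter_continuous.
apply: normal_family_of_cvg => s s0.
by apply: filterS (disk_attracted_from i m s0) => n h x; exact: h.
Qed.

(** Infinity enters a disk in one step and a pole in two, so expansion is required only where the
    image is finite and outside the disks. *)
Hypothesis infty_disk : exists i, disk (c i) e (r None).
Hypothesis expanding : forall z, r (Some z) <> None ->
  (forall i, ~ disk (c i) e (r (Some z))) ->
  exists2 t, 0 < t & forall a b, normc (a - z) < t -> normc (b - z) < t ->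
    [/\ r (Some a) = Some (F a), r (Some b) = Some (F b) &
      3 / 2 * normc (a - b) <= normc (F a - F b)].

(** An orbit outside the open set [O] of attracted points stays in a bounded set, where the
    expansion radius is uniform. A nearby orbit must then separate from it by a fixed amount, even
    if it is itself attracted. *)
Lemma Fatou_eq_basins : Fatou r = \bigcup_i basin r (Some (zf i)).
Proof.
pose O := \bigcup_i basin r (Some (zf i)).
have Oo : open O by apply: bigcup_open => i _; exact: basin_open.
apply/seteqP; split; last by move=> w [i _]; exact: basin_Fatou.
move=> w; apply: contraPP => hw [U [Uo Uw hU]].
have iterO x n : ~ O x -> ~ O (iter n r x).
  move=> Ox [i _]; rewrite basin_disk => -[m hm]; apply: Ox; exists i => //.
  by rewrite basin_disk; exists (m + n)%N; rewrite iterD.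
have notdisk x n i : ~ O x -> ~ disk (c i) e (iter n r x).
  by move=> Ox h; apply: Ox; exists i => //; rewrite basin_disk; exists n.
have OInf : O None.
  by have [i hi] := infty_disk; exists i => //; rewrite basin_disk; exists 1%N.
have [_ [M hM]] : O None /\ exists M, forall b, M < normc b -> O (Some b).
  by apply/nbhs_inftyP; exact: open_nbhs_nbhs.
have finO x : ~ O x -> exists2 a, x = Some a & normc a <= M.
  case: x => [a|] Ox; last by [].
  by exists a => //; rewrite leNgt; apply/negP => /hM.
have locO z : ~ O (Some z) -> exists2 t, 0 < t & forall a b,
    normc (a - z) < t -> normc (b - z) < t ->
    [/\ r (Some a) = Some (F a), r (Some b) = Some (F b) &
      3 / 2 * normc (a - b) <= normc (F a - F b)].
  move=> Oz; apply: expanding.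
    by move=> rz; have := iterO _ 1%N Oz; rewrite /= rz.
  by move=> i; exact: (notdisk _ 1%N i Oz).
have [eta eta0 heta] : exists2 eta, 0 < eta & forall z : R[i], normc z <= M ->
    ~ O (Some z) -> forall a, normc (a - z) < eta ->
    [/\ r (Some a) = Some (F a), r (Some z) = Some (F z) &
      3 / 2 * normc (a - z) <= normc (F a - F z)].
  apply: (@planar_near_covering R M (fun eta (z : R[i]) => ~ O (Some z) ->
    forall a, normc (a - z) < eta ->
    [/\ r (Some a) = Some (F a), r (Some z) = Some (F z) &
      3 / 2 * normc (a - z) <= normc (F a - F z)])) => z.
  (* Around an attracted point the condition is vacuous, as [O] is open; otherwise halving t leaves
     room for both points in the disk of expansion. *)
  have [Oz|Oz] := pselect (O (Some z)).
    have /nbhs_finiteP[t t0 ht] : nbhs (Some z : sphere R) O by exact: open_nbhs_nbhs.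
    by exists t => // v s hv _ Ov; case: Ov; exact: ht.
  have [t t0 ht] := locO z Oz.
  exists (t / 2); first by rewrite divr_gt0.
  move=> v s hv /andP[_ hs] _ a ha; apply: ht; last lra.
  by have := normcBt v a z; lra.
have [z wz zM] := finO w hw; subst w.
have [e1 e10 he1] := finite_of_ball M eta0.
apply: not_normal_of_separation r_cont e10 Uo Uw _ hU => t t0.
pose s := Num.min t eta / 2.
have s0 : 0 < s by rewrite divr_gt0 // lt_min t0.
have [st seta] : s < t /\ s < eta.
  have h : s < Num.min t eta by rewrite /s ltr_pdivrMr ?ltr_pMr ?ltr1n // lt_min t0.
  by move: h; rewrite lt_min => /andP.
pose b := z + s%:C.
have bz : normc (b - z) = s.
  by rewrite /b addrC addKr normc_real gtr0_norm.
apply: contrapT => hno.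
have close m : ball (iter m.+1 r (Some z)) e1 (iter m.+1 r (Some b)).
  by apply: contrapT => h; apply: hno; exists m.+1, b; split => //; rewrite bz.
(* Were the iterates never [e1] apart, their planar distance would stay below [eta], so that
   expansion could be applied forever and the distance would grow like (3/2)^m. *)
have orbit m : exists x v : R[i], [/\ iter m r (Some z) = Some x,
    iter m r (Some b) = Some v, normc (v - x) < eta & (3 / 2) ^+ m * s <= normc (v - x)].
  elim: m => [|m [x [v [hx hv hvx hlow]]]].
    by exists z, b; rewrite bz expr0 mul1r.
  have Ox : ~ O (Some x) by rewrite -hx; exact: iterO.
  have xM : normc x <= M by have [_ [<-]] := finO _ Ox.
  have [rv rx hexp] := heta x xM Ox v hvx.
  have Ox' : ~ O (Some (F x)) by rewrite -rx; exact: (iterO _ 1%N Ox).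
  have xM' : normc (F x) <= M by have [_ [<-]] := finO _ Ox'.
  have := close m; rewrite !iterS hx hv rx rv => /(he1 _ _ xM')[_ [<-] hd].
  exists (F x), (F v); split => //.
  by apply: le_trans hexp; rewrite exprS -[leLHS]mulrA ler_pM2l.
have h23 : 0 <= (2 / 3 : R) < 1 by apply/andP; split; lra.
have [m hm] := filter_ex (geometric_lt eta h23 s0).
have [x [v [_ _ h1 h2]]] := orbit m.
have p0 : 0 < (2 / 3 : R) ^+ m by rewrite exprn_gt0 // divr_gt0.
have pq : (2 / 3 : R) ^+ m * (3 / 2) ^+ m = 1.
  by rewrite -exprMn (_ : 2 / 3 * (3 / 2) = 1) ?expr1n //; field.
have : (3 / 2) ^+ m * s < eta by exact: le_lt_trans h1.
by rewrite -(ltr_pM2l p0) mulrA pq mul1r => h3; have := lt_trans hm h3; rewrite ltxx.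
Qed.

End AttractingDisks.

End Dynamics.

(** * Regions with a common boundary *)

Section Assembly.
Variable R : realType.
Implicit Types (a b c z : R[i]) (x y w p : sphere R).

Lemma strict_deriv_lipschitz (f : R[i] -> R[i]) z l (k t : R) : 0 < t ->
  (forall a, normc (a - z) < t -> normc (f a - f z) <= k * normc (a - z)) ->
  strict_deriv f z l -> normc l <= k.
Proof.
move=> t0 hf hl; apply/ler_addgt0Pr => e e0; have [s s0 hs] := hl e e0.
pose u := Num.min s t / 2.
have m0 : 0 < Num.min s t by rewrite lt_min s0.
have u0 : 0 < u by rewrite divr_gt0.
have : u < Num.min s t by rewrite /u ltr_pdivrMr // ltr_pMr // ltr1n.
rewrite lt_min => /andP[us ut].
have az : normc (z + u%:C - z) = u by rewrite addrC addKr normc_real gtr0_norm.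
have h1 := hf (z + u%:C); rewrite az in h1.
have h2 := hs (z + u%:C) z; rewrite az subrr normc0 in h2.
have {}h1 := h1 ut; have {}h2 := h2 us s0.
rewrite [z + _ - z]addrC addKr in h2.
have h3 := normcB_ge (l * u%:C) (l * u%:C - (f (z + u%:C) - f z)).
rewrite subKr [normc (_ * _ - _)]normcBC normcM normc_real gtr0_norm // in h3.
rewrite -(ler_pM2r u0); lra.
Qed.

Lemma thickening_ball (e : R) (B : set (sphere R)) x y :
  ball x e y -> B y -> thickening e B x.
Proof.
move=> hd0 By; have hd : sph_dist x y < e := hd0.
have d0 : 0 <= sph_dist x y by rewrite /sph_dist acos_ge0 // stereo_bound.
pose s := (sph_dist x y + e) / 2.
have [s1 s2] : sph_dist x y < s /\ s < e by rewrite /s; split; lra.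
rewrite /thickening /=; apply: le_lt_trans (_ : (s%:E < e%:E)%E); last by rewrite lte_fin.
apply: le_trans (_ : (edist (x, y) <= s%:E)%E); last first.
  by apply: edist_fin; [exact: le_lt_trans s1 | exact: s1].
by apply: ereal_inf_lbound; exists y.
Qed.

(** Otherwise C would be covered by disjoint open sets, and its trace on one of them would be
    relatively open and closed. This is the source of Julia points near J. *)
Lemma connected_meets_compl (C : set (sphere R)) (I : eqType)
    (B : I -> set (sphere R)) (i j : I) :
  connected C -> (forall k, open (B k)) -> trivIset setT B -> i != j ->
  C `&` B i !=set0 -> C `&` B j !=set0 -> exists2 x, C x & ~ (\bigcup_k B k) x.
Proof.
move=> Cc Bo Bt ij Ci [y [Cy Bjy]]; apply: contrapT => h.
have CB : C `<=` \bigcup_k B k.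
  by move=> x Cx; apply: contrapT => hx; apply: h; exists x.
have : C `&` B i = C.
  apply: Cc => //; first by exists (B i).
  exists (~` \bigcup_(k in [set k | k != i]) B k).
    by apply: open_closedC; apply: bigcup_open.
  apply/seteqP; split=> x [Cx hx]; split => //.
    move=> [k /eqP ki Bk]; apply: ki; apply: Bt => //; by exists x.
  have [k _ Bk] := CB x Cx; have [<-//|ki] := eqVneq k i.
  by exfalso; apply: hx; exists k.
move=> E; have : (C `&` B i) y by rewrite E.
move=> [_ Biy]; move/eqP: ij; apply; apply: Bt => //; by exists y.
Qed.

(** * Cores of the regions, and the choice of all scales *)

Section Regions.
Variables (d : nat) (A : 'I_d -> set (sphere R)) (J : set (sphere R)).
Hypothesis A_open : forall j, open (A j).
Hypothesis A_triv : trivIset setT A.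
Hypothesis A_boundary : forall j, boundary (A j) = J.
Hypothesis A_cover : (\bigcup_j A j) `|` J = setT.
Hypothesis A_disj : (\bigcup_j A j) `&` J = set0.

Definition core (s : R) i : set (sphere R) :=
  [set w | A i w /\ forall p, J p -> s <= sph_dist w p].

Lemma region_cases w : (exists i, A i w) \/ J w.
Proof.
have : ((\bigcup_j A j) `|` J) w by rewrite A_cover.
by case=> [[i _ h]|]; [left; exists i | right].
Qed.

Lemma region_notJ i w : A i w -> ~ J w.
Proof.
move=> Aw Jw; have : ((\bigcup_j A j) `&` J) w by split => //; exists i.
by rewrite A_disj.
Qed.

Lemma region_uniq i j w : A i w -> A j w -> i = j.
Proof. by move=> h1 h2; apply: A_triv => //; exists w. Qed.

Lemma J_closure i p : J p -> closure (A i) p.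
Proof. by rewrite -(A_boundary i) => -[]. Qed.

Lemma J_closed : closed J.
Proof.
have -> : J = ~` (\bigcup_j A j).
  apply/seteqP; split=> w.
    by move=> Jw [i _ Aw]; exact: region_notJ Aw Jw.
  by move=> h; have [[i Aw]|//] := region_cases w; case: h; exists i.
by apply: open_closedC; apply: bigcup_open.
Qed.

Lemma core_ball i w (s : R) : 0 < s -> ball w s `<=` A i -> core s i w.
Proof.
move=> s0 h; split; first by apply: h; exact: ballxx.
move=> p Jp; rewrite leNgt; apply/negP => hlt.
by apply: (@region_notJ i p) => //; exact: h.
Qed.

Lemma core_le i (s t : R) : s <= t -> core t i `<=` core s i.
Proof.
by move=> st w [Aw h]; split => // p Jp; apply: le_trans st _; exact: h.
Qed.

Lemma not_core_near (s : R) w : (forall i, ~ core s i w) ->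
  J w \/ exists2 p, J p & ball w s p.
Proof.
move=> h; have [[i Aw]|Jw] := region_cases w; last by left.
right; apply: contrapT => hn; apply: (h i); split => // p Jp.
by rewrite leNgt; apply/negP => hlt; apply: hn; exists p.
Qed.

(** In other words, the closure of the core stays inside A_i. At infinity this gives boundedness of
    the core, at finite points a uniform margin. *)
Lemma core_far_nbhs (s : R) i w : 0 < s -> ~ A i w ->
  \forall x \near w, ~ core s i x.
Proof.
move=> s0 nAw; have [[j Aw]|Jw] := region_cases w.
  have : nbhs w (A j) by exact: open_nbhs_nbhs.
  apply: filterS => x Ax [Aix _]; apply: nAw.
  by rewrite (region_uniq Aix Ax).
have : nbhs w (ball w s) by exact: nbhsx_ballx.
apply: filterS => x hx [_ /(_ w Jw)]; rewrite leNgt => /negP; apply.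
by rewrite sph_dist_sym.
Qed.

Lemma core_lebesgue (s M : R) i : 0 < s ->
  exists2 t, 0 < t & forall z : R[i], normc z <= M -> core s i (Some z) ->
    forall a, normc (a - z) < t -> A i (Some a).
Proof.
move=> s0; apply: (@planar_near_covering R M (fun t (z : R[i]) =>
  core s i (Some z) -> forall a, normc (a - z) < t -> A i (Some a))) => z.
have [Az|Az] := pselect (A i (Some z)).
  have /nbhs_finiteP[t t0 ht] : nbhs (Some z : sphere R) (A i) by exact: open_nbhs_nbhs.
  exists (t / 2); first by rewrite divr_gt0.
  move=> w u hw /andP[_ hu] _ a ha; apply: ht.
  by have := normcBt w a z; lra.
have /nbhs_finiteP[t t0 ht] := core_far_nbhs s0 Az.
by exists t => // w u hw _ Kw; case: (ht w hw).
Qed.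

Lemma core_bounded (s : R) i : 0 < s -> ~ A i None ->
  exists M, forall z : R[i], core s i (Some z) -> normc z <= M.
Proof.
move=> s0 Ai; have /nbhs_inftyP[_ [M hM]] := core_far_nbhs s0 Ai.
by exists M => z Kz; rewrite leNgt; apply/negP => /hM.
Qed.

Lemma region_finite_point i : A i !=set0 -> exists c, A i (Some c).
Proof.
move=> [[a|] Aw]; first by exists a.
have /nbhs_inftyP[_ [M hM]] : nbhs (None : sphere R) (A i) by exact: open_nbhs_nbhs.
exists (`|M| + 1)%:C; apply: hM; rewrite normc_real ger0_norm ?addr_ge0 //.
by apply: le_lt_trans (ler_norm _) _; rewrite ltrDl.
Qed.

(** Cores grow as t decreases, so centres and radius can be fixed first and the core parameter
    lowered later without losing the disks. *)
Lemma core_disks : (forall i, A i !=set0) ->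
  exists c : 'I_d -> R[i], exists e s : R, [/\ 0 < e, 0 < s &
    forall i t, t <= s -> disk (c i) e `<=` core t i].
Proof.
move=> An.
have /choice[c hc] : forall i, exists c, A i (Some c).
  by move=> i; exact: region_finite_point.
exists c.
have : \forall s \near 0^'+, forall i, exists2 e, 0 < e & disk (c i) e `<=` core s i.
  apply: filter_forall => i.
  have /nbhs_ballP[u /= u0 hu] : nbhs (Some (c i) : sphere R) (A i) by exact: open_nbhs_nbhs.
  have u20 : 0 < u / 2 by rewrite divr_gt0.
  near=> s; have [e e0 he] := ball_finite u20.
  exists e => // _ [b -> /he hb].
  apply: core_ball => [|x hx]; first by near: s; exact: nbhs_right_gt.
   apply: hu.
  rewrite [u]splitr; apply: ball_triangle hb _; apply: le_ball hx.
  by apply: ltW; near: s; exact: nbhs_right_lt.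
move=> hs; have [s [s0 hse]] : exists s : R, 0 < s /\
    forall i, exists2 e, 0 < e & disk (c i) e `<=` core s i.
  near (0 : R)^'+ => s; exists s; split; first by near: s; exact: nbhs_right_gt.
  by near: s.
have [e [e0 he]] : exists e : R, 0 < e /\ forall i, disk (c i) e `<=` core s i.
  have : \forall e \near 0^'+, forall i, disk (c i) e `<=` core s i.
    apply: filter_forall => i; have [u u0 hu] := hse i.
    near=> e; apply: subset_trans hu => _ [b -> hb]; exists b => //.
    by apply: lt_trans hb _; near: e; exact: nbhs_right_lt.
  move=> h; near (0 : R)^'+ => e; exists e.
  by split; [near: e; exact: nbhs_right_gt | near: e].
exists e, s; split => // i t ts; apply: subset_trans (he i) _; exact: core_le.
Unshelve. all: by end_near. Qed.

(** Here the common boundary enters: a small connected neighbourhood of a point of J meets every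
    A_i, in a point that belongs to the core for small t. The same set serves all nearby points of
    J, and compactness of J makes t uniform. *)
Lemma core_net (e : R) : 0 < e -> exists2 s, 0 < s &
  forall t, 0 < t <= s -> forall p, J p -> exists C : set (sphere R),
    [/\ connected C, C `<=` ball p e & forall i, exists2 x, C x & core t i x].
Proof.
move=> e0; have e20 : 0 < e / 2 by rewrite divr_gt0.
have Jc : compact J by apply: subclosed_compact J_closed (@sphere_compact R) _.
move/compact_near_coveringP: Jc => /(_ R 0^'+ (fun t p => exists C : set (sphere R),
    [/\ connected C, C `<=` ball p e & forall i, exists2 x, C x & core t i x]) _).
case.
- move=> p Jp.
  have [C [Cc Cn Cb]] := sphere_locally_connected p e20.
  have /choice[f hf] : forall i, exists x, C x /\ A i x.
    by move=> i; have [x [Ax Cx]] := J_closure i Jp Cn; exists x.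
  exists (ball p (e / 2), [set t : R | forall i, core t i (f i)]).
    split; first exact: nbhsx_ballx.
    apply: (@filter_forall _ _ (fun i => [set t : R | core t i (f i)]) 0^'+) => i.
    have /nbhs_ballP[u /= u0 hu] : nbhs (f i) (A i).
      by apply: open_nbhs_nbhs; split => //; exact: (hf i).2.
    near=> t; apply: core_ball => [|x hx]; first by near: t; exact: nbhs_right_gt.
    apply: hu; apply: le_ball hx.
    by apply: ltW; near: t; exact: nbhs_right_lt.
  move=> [x t] [/= hx ht]; exists C; split => //.
    move=> y /Cb hy; rewrite [e]splitr; apply: ball_triangle hy; exact: ball_sym.
  by move=> i; exists (f i) => //; exact: (hf i).1.
- move=> r /= r0 hr; have r20 : 0 < r / 2 by rewrite divr_gt0.
  exists (r / 2) => // t /andP[t0 tr] p Jp.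
  have := hr t; rewrite /= sub0r normrN gtr0_norm // => /(_ _ t0 p Jp); apply.
  by apply: le_lt_trans tr _; rewrite ltr_pdivrMr // ltr_pMr // ltr1n.
Unshelve. all: by end_near. Qed.

Lemma region_model (eps : R) (j0 : 'I_d) : 0 < eps -> (forall i, A i !=set0) ->
  (forall i, A i None -> i = j0) ->
  exists p q : {poly R[i]}, exists s : R, exists zf : 'I_d -> R[i],
  [/\ q != 0, coprimep p q & [/\ 0 < s <= eps / 2,
    forall i, attracting_fixed_point (ratfun p q) (Some (zf i)),
    Fatou (ratfun p q) = \bigcup_i basin (ratfun p q) (Some (zf i)) /\
      forall i, open (basin (ratfun p q) (Some (zf i))),
    forall i, core s i `<=` basin (ratfun p q) (Some (zf i)) /\
      core s i (Some (zf i)) &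
    forall x, J x -> exists C : set (sphere R),
    [/\ connected C, C `<=` ball x (eps / 2) & forall i, exists2 y, C y & core s i y]]].
Proof.
move=> eps0 An Ainf.
have eps20 : 0 < eps / 2 by rewrite divr_gt0.
have [c [e [s1 [e0 s10 hdisk]]]] := core_disks An.
have [s2 s20 hnet] := core_net eps20.
(* The three bounds put points missed by all cores within eps/2 of J, the target disks inside the
   cores, and every core near each point of J. *)
pose s := Num.min (eps / 2) (Num.min s1 s2).
have s0 : 0 < s by rewrite !lt_min eps20 s10.
have [seps [ss1 ss2]] : s <= eps / 2 /\ s <= s1 /\ s <= s2.
  by rewrite !ge_min !lexx /= !orbT.
pose K i := [set b : R[i] | core s i (Some b)].
have diskK i b : normc (b - c i) < e -> K i b.
  by move=> hb; apply: (hdisk i s ss1); exists b.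
have Ainf' i : i != j0 -> ~ A i None by move=> /eqP ij /Ainf.
(* M also covers the disk about [c j0], because the contraction estimate away from the other cores
   is stated for bounded points. *)
have [M [M0 KM Mc]] : exists M, [/\ 0 < M,
    forall i k, i != j0 -> K i k -> normc k <= M & normc (c j0) + e <= M].
  have /choice[f hf] : forall i, exists M, i != j0 -> forall k, K i k -> normc k <= M.
    move=> i; have [->|ij] := eqVneq i j0; first by exists 0.
    by have [M hM] := core_bounded s0 (Ainf' i ij); exists M.
  exists (\sum_i `|f i| + (normc (c j0) + e)); split.
  - by rewrite ltr_wpDl ?sumr_ge0 // ltr_wpDl // normc_ge0.
  - move=> i k ij Kk; apply: le_trans (hf i ij k Kk) _; apply: le_trans (ler_norm _) _.
    rewrite (bigD1 i) //= -addrA lerDl addr_ge0 ?sumr_ge0 // addr_ge0 ?normc_ge0 //.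
    exact: ltW.
  - by rewrite lerDr sumr_ge0.
have [r [r0 hr]] : exists r : R, 0 < r /\ forall i, i != j0 -> forall z : R[i],
    near_set (K i) (2 * r) z -> A i (Some z).
  have : \forall r \near 0^'+, forall i, i != j0 -> forall z : R[i],
      near_set (K i) (2 * r) z -> A i (Some z).
    apply: (@filter_forall _ _ (fun i => [set r : R | i != j0 -> forall z : R[i],
      near_set (K i) (2 * r) z -> A i (Some z)]) 0^'+) => i.
    have [t t0 ht] := core_lebesgue M i s0.
    near=> r => ij z [k Kk hk]; apply: (ht k) => //; first exact: KM Kk.
    apply: lt_trans hk _; rewrite mulrC -ltr_pdivlMr //.
    by near: r; apply: nbhs_right_lt; rewrite divr_gt0.
  move=> h; near (0 : R)^'+ => r; exists r.
  by split; [near: r; exact: nbhs_right_gt | near: r].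
have far i z l : i != j0 -> near_set (K i) (2 * r) z -> A l (Some z) -> i = l.
  by move=> ij /(hr i ij) h1 h2; exact: region_uniq h1 h2.
have Kdisj i l z : i != j0 -> l != j0 -> near_set (K i) (2 * r) z ->
    near_set (K l) (2 * r) z -> i = l.
  by move=> ij lj h1 /(hr l lj); exact: far.
have Kn i : i != j0 -> K i !=set0.
  by move=> _; exists (c i); apply: diskK; rewrite subrr normc0.
have Kc i : K i (c i) by apply: diskK; rewrite subrr normc0.
have c_neq i : i != j0 -> c i != c j0.
  move=> ij; apply/negP => /eqP cc; move/eqP: ij; apply.
  apply: (@region_uniq _ _ (Some (c i))); first exact: (Kc i).1.
  by rewrite cc; exact: (Kc j0).1.
have far0 z : A j0 (Some z) -> forall i, i != j0 -> ~ near_set (K i) (2 * r) z.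
  by move=> Az i ij hz; move/eqP: (ij); apply; exact: far Az.
have [p [q [F [q0 cpq FE [inK off lipK lip0 expd]]]]] :=
  planar_model e0 M0 r0 Kn KM Kdisj c_neq.
pose f := ratfun p q.
have fc : continuous f by exact: ratfun_continuous.
have fF z : q.[z] != 0 -> f (Some z) = Some (F z).
  by move=> qz; rewrite /f ratfun_finite // FE.
have e2 : e / 2 < e by rewrite ltr_pdivrMr // ltr_pMr // ltr1n.
have Kmap i z : K i z -> q.[z] != 0 /\ normc (F z - c i) <= e / 2.
  have [->|ij] := eqVneq i j0; last exact: inK.
  by move=> Kz; apply: off; apply: far0; exact: Kz.1.
have dcontr i a b : normc (a - c i) < e -> normc (b - c i) < e ->
    normc (F a - F b) <= 1 / 2 * normc (a - b).
  move=> ha hb; have [ij|ij] := eqVneq i j0; last by apply: lipK ij _ _; exact: diskK.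
  rewrite ij in ha hb.
  apply: lip0.
  - by have := normcB_ge a (c j0); lra.
  - by have := normcB_ge b (c j0); lra.
  - by apply: far0; exact: (diskK j0 a ha).1.
  - by apply: far0; exact: (diskK j0 b hb).1.
have dstable i a : normc (a - c i) < e ->
    f (Some a) = Some (F a) /\ normc (F a - c i) <= e / 2.
  by move=> /diskK /Kmap[qa hF]; rewrite fF.
(* The value at infinity is located by continuity rather than by degrees: large z are far from all
   bounded cores, so their images are within e/2 of [c j0]. *)
have finf : disk (c j0) e (f None).
  have farM z : M + 2 * r < normc z -> normc (F z - c j0) <= e / 2 /\ f (Some z) = Some (F z).
    move=> hz; have [qz hF] : q.[z] != 0 /\ normc (F z - c j0) <= e / 2.
      apply: off => i ij [k Kk hk]; have := KM i k ij Kk; have := normcB_ge z k; lra.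
    by rewrite fF.
  apply: contrapT => hf.
  have hU : nbhs (f None) [set w | forall b, w = Some b -> e / 2 < normc (b - c j0)].
    case E : (f None) => [b|].
      have hb : e <= normc (b - c j0).
        by rewrite leNgt; apply/negP => hb; apply: hf; exists b.
      apply/nbhs_finiteP; exists (e / 2); first by rewrite divr_gt0.
      move=> a ha _ [<-]; have := normcBt a b (c j0); rewrite [normc (b - a)]normcBC.
      lra.
    apply/nbhs_inftyP; split => //; exists (normc (c j0) + e) => a ha _ [<-].
    have := normcB_ge a (c j0); lra.
  have /nbhs_inftyP[_ [M' hM']] := fc None _ hU.
  pose z : R[i] := (`|M'| + (M + 2 * r) + 1)%:C.
  have r20 : 0 < 2 * r by rewrite mulr_gt0.
  have M'0 := normr_ge0 M'; have M'1 := ler_norm M'.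
  have nz : normc z = `|M'| + (M + 2 * r) + 1.
    by rewrite normc_real ger0_norm //; lra.
  have [h1 h2] := farM z ltac:(by rewrite nz; lra).
  have h3 := hM' z ltac:(by rewrite nz; lra) _ h2; lra.
have /choice[zf hzf] : forall i, exists z, normc (z - c i) <= e / 2 /\ F z = z.
  move=> i; have [z h1 h2] := contraction_fixed_point e0
    (fun a ha => (dstable i a ha).2) (dcontr i); by exists z.
have zf1 i := (hzf i).1; have zf2 i := (hzf i).2.
have zfe i : normc (zf i - c i) < e by exact: le_lt_trans e2.
have fexp z : f (Some z) <> None -> (forall i, ~ disk (c i) e (f (Some z))) ->
    exists2 t, 0 < t & forall a b, normc (a - z) < t -> normc (b - z) < t ->
    [/\ f (Some a) = Some (F a), f (Some b) = Some (F b) &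
      3 / 2 * normc (a - b) <= normc (F a - F b)].
  move=> fz nd.
  have qz : q.[z] != 0.
    by apply/negP => qz; apply: fz; rewrite /f /= qz.
  have ge i : e <= normc (F z - c i).
    by rewrite leNgt; apply/negP => h; apply: (nd i); rewrite fF //; exists (F z).
  have [[i ij hz]|hz] := pselect (exists2 i, i != j0 & near_set (K i) (2 * r) z).
    have [t t0 ht] := expd i z ij hz qz (ge j0) (ge i).
    by exists t => // a b ha hb; have [qa qb h] := ht a b ha hb; rewrite !fF.
  (* Away from the neighbourhoods of the cores the image is in the disk of index [j0], so only the
     transition zones have to expand. *)
  have [_] := off z ltac:(by move=> i ij h; apply: hz; exists i).
  by have := ge j0; lra.
have bd := basin_disk e0 dstable dcontr zf1 zf2.
exists p, q, s, zf; split => //; split.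
- by rewrite s0.
- move=> i; have [h1 h2] := dstable i (zf i) (zfe i); split; first by rewrite -[LHS]/(f (Some (zf i))) h1 zf2.
  have qzf : q.[zf i] != 0 by have [] := Kmap i (zf i) (diskK i _ (zfe i)).
  have sd := strict_deriv_ratio p qzf.
  have t0 : 0 < e / 2 by rewrite divr_gt0.
  have near_zf a : normc (a - zf i) < e / 2 -> normc (a - c i) < e.
    by move=> ha; have := normcBt (zf i) a (c i); have := zf1 i; lra.
  have qn a : normc (a - zf i) < e / 2 -> q.[a] != 0.
    by move=> /near_zf /diskK /Kmap[].
  rewrite (multiplier_strict_deriv t0 _ sd); last first.
    by move=> a /qn qa; rewrite ratfun_finite.
  rewrite normr_normc -[ltRHS]/(1%:C) ltcR.
  apply: le_lt_trans (_ : 1 / 2 < 1); last lra.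
  apply: strict_deriv_lipschitz t0 _ sd => a ha.
  rewrite (FE a (qn a ha)) (FE _ qzf).
  by apply: (dcontr i); [exact: near_zf | exact: zfe].
- split; first by apply: (Fatou_eq_basins fc e0 dstable dcontr zf1 zf2 _ fexp); exists j0.
  by move=> i; exact: (basin_open fc e0 dstable dcontr zf1 zf2).
- move=> i; split; last exact: (diskK i _ (zfe i)).
  move=> w Kw; rewrite bd; exists 1%N => /=.
  (* Finite core points enter their disk in one step; infinity can only lie in the core of index
     [j0] and is covered by [finf]. *)
  case: w Kw => [z|] Kw.
    have [qz hF] := Kmap i z Kw; rewrite -/f fF //; exists (F z) => //.
    exact: le_lt_trans e2.
  by rewrite (Ainf i Kw.1).
- by move=> x Jx; apply: hnet; rewrite ?s0.
Unshelve. all: by end_near. Qed.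

End Regions.

End Assembly.

Theorem theorem1 (R : realType) (eps : R) (d : nat)
    (A : 'I_d -> set (sphere R)) (J : set (sphere R)) :
  0 < eps ->
  (2 <= d)%N ->
  (forall j, A j !=set0) ->
  (forall j, open (A j)) ->
  trivIset setT A ->
  (forall j, boundary (A j) = J) ->
  (\bigcup_j A j) `|` J = setT ->
  (\bigcup_j A j) `&` J = set0 ->
  exists r : sphere R -> sphere R, rational_map r /\
  exists zeta : 'I_d -> sphere R,
    [/\ forall j, attracting_fixed_point r (zeta j),
        Fatou r = \bigcup_j basin r (zeta j),
        trivIset setT (fun j => basin r (zeta j)),
        hausdorff_lt eps J (Julia r)
      & forall j, hausdorff_lt eps (A j) (basin r (zeta j))].
Proof.
move=> eps0 d2 An Ao At Ab Ac Ad.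
have eps20 : 0 < eps / 2 by rewrite divr_gt0.
have [j0 hj0] : exists j0, forall i, A i None -> i = j0.
  have [[i hi]|h] := pselect (exists i, A i None).
    by exists i => l hl; exact: (region_uniq At hl hi).
  by exists (Ordinal (ltnW d2)) => i hi; case: h; exists i.
have [p [q [s [zf [q0 cpq [/andP[s0 seps] attr [FE Bo] hK hnet]]]]]] :=
  region_model Ao At Ab Ac Ad eps0 An hj0.
set r := ratfun p q in attr FE Bo hK.
pose B i := basin r (Some (zf i)).
(* A common point would make the two attracting points equal as limits, but they lie in disjoint
   regions. *)
have Bt : trivIset setT B.
  move=> i j _ _ [w [hi hj]].
  have zz : (Some (zf i) : sphere R) = Some (zf j).
    by apply: (cvg_unique (@metric_hausdorff _ _)) hi hj.
  apply: (region_uniq At (w := Some (zf i))); first exact: (hK i).2.1.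
  by rewrite zz; exact: (hK j).2.1.
have core_basin i w : core A J s i w -> B i w by exact: (hK i).1.
have ball_eps (x y : sphere R) : ball x (eps / 2) y -> ball x eps y.
  by apply: le_ball; rewrite ler_pdivrMr // ler_pMr // ler1n.
have ball_s (x y : sphere R) : ball x s y -> ball x (eps / 2) y by exact: le_ball.
have notJulia w : ~ Julia r w -> exists i, B i w.
  by move=> /contrapT; rewrite FE => -[i _ h]; exists i.
have refl (e : R) (X : set (sphere R)) w : 0 < e -> X w -> thickening e X w.
  by move=> e0; apply: thickening_ball; exact: ballxx.
exists r; split; first by exists p, q.
exists (fun i => Some (zf i)); split => //.
- split=> w.
    move=> Jw; have [C [Cc Cb Ch]] := hnet w Jw.
    (* Since d >= 2 there are the indices 0 and 1, and the small connected set meets both their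
       basins. *)
    have [x1 Cx1 h1] := Ch (Ordinal (ltnW d2)); have [x2 Cx2 h2] := Ch (Ordinal d2).
    have [x Cx hx] : exists2 x, C x & ~ (\bigcup_k B k) x.
      apply: (@connected_meets_compl R C 'I_d B (Ordinal (ltnW d2)) (Ordinal d2)) => //.
        by exists x1; split => //; exact: core_basin.
      by exists x2; split => //; exact: core_basin.
    apply: (@thickening_ball R eps _ w x); first by apply: ball_eps; exact: Cb.
    by rewrite /Julia FE.
  (* A Julia point lies in no basin, hence in no core, hence close to J. *)
  move=> Jw; have [|Jw'|[x Jx hx]] := @not_core_near R d A J Ac s w.
  + move=> i /core_basin hB; apply: Jw; rewrite FE; by exists i.
  + exact: refl.
  + by apply: thickening_ball Jx; apply: ball_eps; exact: ball_s.
- move=> j; split=> w.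
    move=> Aw; have [Kw|Kw] := pselect (core A J s j w).
      by apply: refl => //; exact: core_basin.
    have [x Jx hx] : exists2 x, J x & ball w s x.
      apply: contrapT => hn; apply: Kw; split => // x Jx.
      by rewrite leNgt; apply/negP => hlt; apply: hn; exists x.
    have [C [_ Cb Ch]] := hnet x Jx; have [y Cy Ky] := Ch j.
    apply: (@thickening_ball R eps _ w y); last exact: core_basin.
    rewrite [eps]splitr; apply: ball_triangle (Cb y Cy); exact: ball_s.
  (* A basin point outside A_j lies in no core: a core of another index is in another basin. It is
     therefore close to J, and so to the core of A_j, whichever region it belongs to. *)
  move=> Bw; have [Aw|Aw] := pselect (A j w); first exact: refl.
  have [|Jw|[x Jx hx]] := @not_core_near R d A J Ac s w.
  + move=> i Kw; apply: Aw.
    have ij : i = j.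
      by apply: Bt => //; exists w; split => //; exact: core_basin.
    by rewrite -ij; exact: Kw.1.
  + have [C [_ Cb Ch]] := hnet w Jw; have [y Cy Ky] := Ch j.
    by apply: thickening_ball Ky.1; apply: ball_eps; exact: Cb.
  + have [C [_ Cb Ch]] := hnet x Jx; have [y Cy Ky] := Ch j.
    apply: thickening_ball Ky.1.
    rewrite [eps]splitr; apply: ball_triangle (Cb y Cy); exact: ball_s.
Qed.
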